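(* Let $P=(P_0,\dots,P_{2n-1})$ be a CPPOS. The function $p\mapsto A^*\bigl(\operatorname{ART}_P(p)\bigr)$, $p\in\operatorname{int}(P)$, extends continuously to $P$ by the value $0$ on $\partial P$. More precisely, let $x=P_i+se_i$ with $0<s<1$, and put $$\rho_i(s)=\frac{\mu_{i-1}s}{\mu_{i-1}s+\mu_{i+1}(1-s)},\qquad R_i(x)=P_{i+n}+\rho_i(s)e_{i+n}.$$ As $p\to x$ from $\operatorname{int}(P)$, the completed $\operatorname{ART}_P(p)$ converges to the segment $[\,\sigma_P(x),R_i(x)\,]$ traversed once in each direction. Consequently, $$\lim_{p\to x,\ p\in\operatorname{int}(P)}A^*\bigl(\operatorname{ART}_P(p)\bigr)=0.$$ The segment reduces to one point precisely when $\mu_{i-1}=\mu_{i+1}$. In particular this occurs in the centrally symmetric case.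
   Context: A CPPOS (convex polygon with parallel opposite sides) is a positively oriented convex polygon $P=(P_0,\dots,P_{2n-1})$, indices modulo $2n$, all $P_i$ genuine vertices (consecutive edge vectors linearly independent), whose edge vectors $e_i=P_{i+1}-P_i$ satisfy $e_{i+n}=-\mu_ie_i$ with $\mu_i>0$ (so $\mu_{i+n}=\mu_i^{-1}$). $P$ also denotes the closed convex region it bounds. Boundary involution: $\sigma_P(P_i+s e_i)=P_{i+n}+s e_{i+n}$, $0\le s\le1$. For a line $\ell$ meeting $\operatorname{int}(P)$ with boundary intersection points $x_\ell,y_\ell$, $\Phi_P(\ell)=\overline{\sigma_P(x_\ell)\sigma_P(y_\ell)}$. $\Lambda_p$ is the pencil of lines through $p\in\operatorname{int}(P)$. A cell is a maximal open arc of $\Lambda_p$ on which the boundary points of the line lie in two fixed open sides; at a cell transition the line passes through a vertex. Put $n(\theta)=(\cos\theta,\sin\theta)$, $\tau(\theta)=(-\sin\theta,\cos\theta)$. For each $\theta$ there is exactly one line of $\Phi_P(\Lambda_p)$ with normal $n(\theta)$, written $n(\theta)\cdot(z-p)=q_p(\theta)$, where $q_p$ is continuous, smooth on each cell, with one-sided derivatives at transitions, and $q_p(\theta+\pi)=-q_p(\theta)$. The completed affine reflection transform $\operatorname{ART}_P(p)$ is the closed front made of the cellwise envelopes $X(\theta)=p+q_pn+q_p'\tau$ and, at each transition angle, of the oriented segment joining the two one-sided envelope points $X^-$ to $X^+$, traversed once as $\theta$ runs over one period $\pi$. Its oriented area is $A^*=\frac12\oint[X,dX]$, with $[u,v]=\det(u,v)$.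 *)

(* Defs.v *)
(* MathComp-Analysis; the plane is R * R over an abstract realType R. *)
From HB Require Import structures.
From mathcomp Require Import all_boot all_order all_algebra.
From mathcomp Require Import all_classical all_reals all_analysis.

Set Implicit Arguments.
Unset Strict Implicit.
Unset Printing Implicit Defensive.

Import Order.TTheory GRing.Theory Num.Theory.
Import numFieldNormedType.Exports.

Local Open Scope classical_set_scope.
Local Open Scope ring_scope.

Section Plane.
Context {R : realType}.
Implicit Types (a b u v z : R * R) (t : R).

Definition det2 u v : R := u.1 * v.2 - u.2 * v.1.
Definition dot2 u v : R := u.1 * v.1 + u.2 * v.2.

Definition nvec t : R * R := (cos t, sin t).
Definition tvec t : R * R := (- sin t, cos t).

Definition line_thru a b : set (R * R) := [set a + t *: (b - a) | t in [set: R]].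

Definition pencil z : set (set (R * R)) :=
  [set L | exists a b, [/\ a != b, L = line_thru a b & L z]].

Definition right_deriv (f : R -> R) t : R :=
  lim ((h^-1 * (f (t + h) - f t)) @[h --> 0^'+]).
Definition left_deriv (f : R -> R) t : R :=
  lim ((h^-1 * (f (t + h) - f t)) @[h --> 0^'-]).

(* For 0 <= t <= 1: runs from a to b on [0, 1/2], then back to a on [1/2, 1]. *)
Definition there_and_back a b t : R * R := a + (1 - `|1 - 2 * t|) *: (b - a).

(* Closed oriented curves are given by the set of their 1-periodic monotone
   parametrizations.  [curves_cvg F C g] says that C z tends to the closed curve
   parametrized by g on [0, 1], for the Frechet distance, as z runs along F. *)
Definition curves_cvg (F : set_system (R * R))
    (C : R * R -> set (R -> R * R)) (g : R -> R * R) : Prop :=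
  forall eps : R, 0 < eps -> \forall z \near F,
    exists2 c, C z c & forall t, 0 <= t <= 1 -> `|c t - g t| <= eps.

End Plane.

Section Polygon.
Context {R : realType} {n : nat}.

(* Vertices are indexed by Z/2n; 'Z_(n.*2) has 2n elements because n > 1. *)
Implicit Types (P : 'Z_(n.*2) -> R * R) (mu : 'Z_(n.*2) -> R).
Implicit Types (i j : 'Z_(n.*2)) (L : set (R * R)) (p z : R * R) (t : R).

Definition opp_idx i : 'Z_(n.*2) := i + n%:R.

Definition edge P i : R * R := P (i + 1) - P i.

Definition side_pt P i (s : R) : R * R := P i + s *: edge P i.

(* A positively oriented convex polygon: the vertices are distinct and lie to
   the left of the line through each directed edge.  Distinctness excludes
   closed polygons that wind several times around the same region. *)
Record cppos P mu : Prop := Cppos {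
  cppos_gt1 : (1 < n)%N;
  cppos_inj : injective P;
  cppos_convex : forall i j, 0 <= det2 (edge P i) (P j - P i);
  cppos_vertex : forall i, det2 (edge P i) (edge P (i + 1)) != 0;
  cppos_mu_gt0 : forall i, 0 < mu i;
  cppos_edge : forall i, edge P (opp_idx i) = - (mu i *: edge P i) }.

Definition region P : set (R * R) :=
  [set z | forall i, 0 <= det2 (edge P i) (z - P i)].

Definition boundary P : set (R * R) :=
  [set z | exists i s, 0 <= s <= 1 /\ z = side_pt P i s].

Definition centrally_symmetric P : Prop :=
  exists c : R * R, forall z, region P z -> region P (c *+ 2 - z).

Definition sigma P (x : R * R) : R * R :=
  xget 0 [set y | exists i s,
    [/\ 0 <= s <= 1, x = side_pt P i s & y = side_pt P (opp_idx i) s]].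

(* If L meets the interior, then L `&` boundary P consists of two points and
   this set is the line through their images. *)
Definition Phi P L : set (R * R) :=
  [set z | exists x y, [/\ x != y, (L `&` boundary P) x, (L `&` boundary P) y
                         & line_thru (sigma P x) (sigma P y) z]].

Definition normal_line p t (c : R) : set (R * R) :=
  [set z | dot2 (nvec t) (z - p) = c].

Definition qfun P p t : R :=
  xget 0 [set c | (Phi P @` pencil p) (normal_line p t c)].

(* Angles (of the image line) separating two consecutive cells. *)
Definition transition P p : set R :=
  [set t | exists L, [/\ pencil p L, exists i, L (P i)
                       & Phi P L = normal_line p t (qfun P p t)]].

Definition envelope P p t : R * R :=
  p + qfun P p t *: nvec t + derive1 (qfun P p) t *: tvec t.
Definition envelope_left P p t : R * R :=
  p + qfun P p t *: nvec t + left_deriv (qfun P p) t *: tvec t.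
Definition envelope_right P p t : R * R :=
  p + qfun P p t *: nvec t + right_deriv (qfun P p) t *: tvec t.

(* The completed transform ART_P(p), as the set of its parametrizations: u is
   the parameter, T u the angle, which increases by one period pi when u
   increases by 1, and lam u the position on the segment joining the one-sided
   envelope points when T stays at a transition angle.  Continuity of g makes
   it traverse the whole of each such segment. *)
Definition ART P p : set (R -> R * R) :=
  [set g : R -> R * R | continuous g /\ (forall u : R, g (u + 1) = g u) /\
    exists T lam : R -> R,
      [/\ continuous T, {homo T : u v / u <= v},
          (forall u, T (u + 1) = T u + pi),
          (forall u, 0 <= lam u <= 1) /\
          (forall u v, u <= v -> T u = T v -> lam u <= lam v)
        & forall u,
          (~ transition P p (T u) -> g u = envelope P p (T u)) /\
          (transition P p (T u) ->
             g u = envelope_left P p (T u) + lam u *: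
                   (envelope_right P p (T u) - envelope_left P p (T u)))]].

(* The oriented area of ART_P(p): the cells contribute the integral, and a
   segment from X^- to X^+ contributes the integral of det2 X dX along it, which
   is det2 X^- X^+.  The sum is finite: there are at most 2n transitions in a
   period. *)
Definition ART_area P p : R :=
  2^-1 * (\int[lebesgue_measure]_(t in `[0, pi])
            det2 (envelope P p t) (derive1 (envelope P p) t)
          + \sum_(t \in `[0, pi[ `&` transition P p)
              det2 (envelope_left P p t) (envelope_right P p t)).

Definition rho mu i (s : R) : R :=
  mu (i - 1) * s / (mu (i - 1) * s + mu (i + 1) * (1 - s)).

Definition Rpoint P mu i (s : R) : R * R := side_pt P (opp_idx i) (rho mu i s).

End Polygon.

(* Main.v *)
(* A chord of P through p with endpoints on the sides j and k, at parameters s and t,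
   and dividing ratio r, determines the corresponding point of the envelope: the normal
   velocities of the endpoints of the image chord give it as a weighted mean
   [env_pt j k s t r] of these endpoints.  After extension to adjacent sides this mean
   is continuous in (s, t, r), also when p reaches the boundary.

   Area.  With q = n.(X - p) and q' = tau.(X - p), integration by parts on each cell
   turns the oriented area into one half of the integral of q^2 - q'^2 over [0, pi]:
   the boundary terms at a transition cancel the contribution of its segment.  For p
   tending to a boundary point x, all envelope points tend to sigma x except for the
   angle normal to the side of x, so by dominated convergence the area tends to one
   half of the integral of (n.V)^2 - (tau.V)^2, with V = sigma x - x.  This integrand
   has the primitive - (n.V)(tau.V), which has period pi.

   Curves.  For p near x = P_i + s e_i the chords joining the sides i + 1 and i - 1 form
   exactly one cell, bounded by the transitions of P_i and P_(i+1).  Its envelope points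
   are close to R_i(x) and all the others are close to sigma x, so the completed front
   goes from sigma x to R_i(x) and back along the segments at these two transitions. *)
Require Import Defs.
From mathcomp Require Import all_boot all_order all_algebra.
From mathcomp Require Import all_classical all_reals all_analysis.
From mathcomp Require Import measurable_realfun ring lra.
Import Order.TTheory GRing.Theory Num.Theory.
Import numFieldNormedType.Exports.
Set Implicit Arguments.
Unset Strict Implicit.
Unset Printing Implicit Defensive.
Local Open Scope classical_set_scope.
Local Open Scope ring_scope.

(** * Plane vectors and angles *)

Section Plane.
Context {R : realType}.
Implicit Types (a b c u v x y z : R * R) (k s t th : R).

(** The angle belongs to the image line, and the chord with a given image angle is not given by an
    explicit formula. Chords are therefore handled as a relation [chord p th j k s t r], redundant
    at vertices and under exchange of the ends. Existence comes from the intermediate value theorem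
    along a half turn of a ray; uniqueness, for inner [p], from the fact that the shift by [n]
    preserves the cyclic order of the sides. Limits then rest on one compactness argument: the
    relation is closed and its parameters fill a cube, so near a limit position only the chords of
    that position matter. At the boundary uniqueness is lost, and the limit statements ask instead
    that all limit chords give the same envelope point. Inside a cell the envelope is a rational
    expression in [qfun], [cos] and [sin]. Continuity of [qfun] thus makes its derivative
    continuous, and this in turn gives the C1 envelope needed for the area. *)

Lemma fstD a b : (a + b).1 = a.1 + b.1. Proof. by []. Qed.
Lemma sndD a b : (a + b).2 = a.2 + b.2. Proof. by []. Qed.
Lemma fstN a : (- a).1 = - a.1. Proof. by []. Qed.
Lemma sndN a : (- a).2 = - a.2. Proof. by []. Qed.
Lemma fstZ k a : (k *: a).1 = k * a.1. Proof. by []. Qed.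
Lemma sndZ k a : (k *: a).2 = k * a.2. Proof. by []. Qed.

Definition coordE := (fstD, sndD, fstN, sndN, fstZ, sndZ).

Lemma eq_coord a b : a.1 = b.1 -> a.2 = b.2 -> a = b.
Proof. by case: a b => [? ?] [? ?] /= -> ->. Qed.

Lemma det2Dr u a b : det2 u (a + b) = det2 u a + det2 u b.
Proof. rewrite /det2 !coordE; ring. Qed.
Lemma det2Zr u k a : det2 u (k *: a) = k * det2 u a.
Proof. rewrite /det2 !coordE; ring. Qed.
Lemma det2Nr u a : det2 u (- a) = - det2 u a.
Proof. rewrite /det2 !coordE; ring. Qed.
Lemma det2Br u a b : det2 u (a - b) = det2 u a - det2 u b.
Proof. by rewrite det2Dr det2Nr. Qed.
Lemma det2C u a : det2 u a = - det2 a u.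
Proof. rewrite /det2; ring. Qed.
Lemma det2Dl u a b : det2 (a + b) u = det2 a u + det2 b u.
Proof. rewrite /det2 !coordE; ring. Qed.
Lemma det2Zl u k a : det2 (k *: a) u = k * det2 a u.
Proof. rewrite /det2 !coordE; ring. Qed.
Lemma det2Nl u a : det2 (- a) u = - det2 a u.
Proof. rewrite /det2 !coordE; ring. Qed.
Lemma det2xx a : det2 a a = 0.
Proof. rewrite /det2; ring. Qed.
Lemma det2x0 a : det2 a 0 = 0.
Proof. rewrite /det2 /=; ring. Qed.
Lemma det20x a : det2 0 a = 0.
Proof. rewrite /det2 /=; ring. Qed.

Definition det2E := (det2Dr, det2Dl, det2Nr, det2Nl, det2Zr, det2Zl, det2xx).

Lemma plucker e a b c :
  det2 e b * det2 a c = det2 e a * det2 b c + det2 e c * det2 a b.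
Proof. rewrite /det2; ring. Qed.

Lemma det2_neq0 a b : det2 a b != 0 -> a != 0 /\ b != 0.
Proof.
move=> h; split; apply/eqP => e0; move: h.
  by rewrite e0 det20x eqxx.
by rewrite e0 det2x0 eqxx.
Qed.

Lemma det2_col e v : e != 0 -> det2 e v = 0 -> exists k, v = k *: e.
Proof.
move=> e0 h.
have e2 : e.1 ^+ 2 + e.2 ^+ 2 != 0.
  apply: contra e0; rewrite paddr_eq0 ?sqr_ge0// !sqrf_eq0.
  by move=> /andP[/eqP h1 /eqP h2]; apply/eqP/eq_coord.
exists ((v.1 * e.1 + v.2 * e.2) / (e.1 ^+ 2 + e.2 ^+ 2)).
by move: h; rewrite /det2 => h; apply: eq_coord; rewrite !coordE;
  apply: (mulIf e2); rewrite mulrAC mulfVK//;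
  [ have -> : v.1 * (e.1 ^+ 2 + e.2 ^+ 2) =
      (v.1 * e.1 + v.2 * e.2) * e.1 - e.2 * (e.1 * v.2 - e.2 * v.1) by ring
  | have -> : v.2 * (e.1 ^+ 2 + e.2 ^+ 2) =
      (v.1 * e.1 + v.2 * e.2) * e.2 + e.1 * (e.1 * v.2 - e.2 * v.1) by ring ];
  rewrite h; ring.
Qed.

Lemma dot2Dr u a b : dot2 u (a + b) = dot2 u a + dot2 u b.
Proof. rewrite /dot2 !coordE; ring. Qed.
Lemma dot2Zr u k a : dot2 u (k *: a) = k * dot2 u a.
Proof. rewrite /dot2 !coordE; ring. Qed.
Lemma dot2Nr u a : dot2 u (- a) = - dot2 u a.
Proof. rewrite /dot2 !coordE; ring. Qed.
Lemma dot2Br u a b : dot2 u (a - b) = dot2 u a - dot2 u b.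
Proof. by rewrite dot2Dr dot2Nr. Qed.

Lemma cs1 th : cos th * cos th + sin th * sin th = 1 :> R.
Proof. by rewrite -!expr2 cos2Dsin2. Qed.

Lemma nvec_neq0 th : nvec th != 0.
Proof.
apply/eqP => /pair_equal_spec [h1 h2].
by have := cs1 th; rewrite h1 h2 !mul0r addr0 => /eqP; rewrite eq_sym oner_eq0.
Qed.

Lemma frame th v : v = dot2 (nvec th) v *: nvec th + dot2 (tvec th) v *: tvec th.
Proof.
apply: eq_coord; rewrite !coordE /dot2 /=; have h := cs1 th.
  by rewrite -[LHS]mul1r -h; ring.
by rewrite -[LHS]mul1r -h; ring.
Qed.

Lemma nvec_perp th v : dot2 (nvec th) v = 0 -> v = dot2 (tvec th) v *: tvec th.
Proof. by move=> h; rewrite [LHS](frame th) h scale0r add0r. Qed.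

Lemma nvec_perp_det2 th u v : dot2 (nvec th) u = 0 -> dot2 (nvec th) v = 0 -> det2 u v = 0.
Proof. by move=> /nvec_perp -> /nvec_perp ->; rewrite !det2E !mulr0. Qed.

Lemma det2_tvec u th : det2 u (tvec th) = dot2 (nvec th) u.
Proof. rewrite /det2 /dot2 /=; ring. Qed.

(** The product changes sign over a half turn, so it has a zero; a zero at the right end is moved to
    [a], which keeps the window half-open as in [nvec_perp_eq]. *)
Lemma exists_perp (a : R) v : exists2 th, a <= th < a + pi & dot2 (nvec th) v = 0.
Proof.
have pi0 := pi_gt0 R; have api : a <= a + pi by rewrite lerDl ltW.
have := @IVT R (fun th => dot2 (nvec th) v) a (a + pi) 0 api.
have c1 : {within `[a, a + pi], continuous fun th => dot2 (nvec th) v}.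
  apply: continuous_subspaceT => th; apply: cvgD; apply: cvgMl.
    exact: continuous_cos.
  exact: continuous_sin.
have e : dot2 (nvec (a + pi)) v = - dot2 (nvec a) v.
  by rewrite /dot2 /= cosDpi sinDpi; ring.
move=> /(_ c1); rewrite e => h.
have [|th] := h.
  rewrite ge_min le_max; case: (leP 0 (dot2 (nvec a) v)) => h'.
    by apply/andP; split; apply/orP; [right|left]; lra.
  by apply/andP; split; apply/orP; [left|right]; lra.
rewrite in_itv /= => /andP[h1 h2] h3.
have [th2|th2] := eqVneq th (a + pi).
  exists a; first by rewrite lexx ltrDl.
  by move: h3; rewrite th2 e => /eqP; rewrite oppr_eq0 => /eqP.
by exists th => //; rewrite h1 lt_neqAle th2.
Qed.

Lemma sin_eq0_small (x : R) : `|x| < pi -> sin x = 0 -> x = 0.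
Proof.
rewrite ltr_norml => /andP[h1 h2] h; case: (ltgtP x 0) => // x0; exfalso.
  have : 0 < sin (- x) by apply: sin_gt0_pi; rewrite oppr_gt0 x0 /= ltrNl.
  by rewrite sinN h oppr0 ltxx.
by have : 0 < sin x; [apply: sin_gt0_pi; rewrite x0 | rewrite h ltxx].
Qed.

Lemma nvec_perp_sin th th' v : v != 0 -> dot2 (nvec th) v = 0 -> dot2 (nvec th') v = 0 ->
  sin (th' - th) = 0.
Proof.
move=> v0 /nvec_perp vE h'; rewrite vE dot2Zr in h'; move/eqP: h'.
rewrite mulf_eq0 => /orP[/eqP e|/eqP <-].
  by move: v0; rewrite vE e scale0r eqxx.
by rewrite sinB /dot2 /=; ring.
Qed.

(** Two normal angles of one nonzero vector have a difference with zero sine; in a half-open window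
    of length [pi] this difference is 0. *)
Lemma nvec_perp_eq (a : R) th th' v : v != 0 -> a <= th < a + pi -> a <= th' < a + pi ->
  dot2 (nvec th) v = 0 -> dot2 (nvec th') v = 0 -> th' = th.
Proof.
move=> v0 h1 h2 e1 e2; apply: subr0_eq; apply: sin_eq0_small (nvec_perp_sin v0 e1 e2).
by rewrite ltr_norml; apply/andP; split; lra.
Qed.

Lemma line_thru_sym a b : line_thru a b = line_thru b a.
Proof.
have sub c d : line_thru c d `<=` line_thru d c.
  move=> z [t _ <-]; exists (1 - t) => //; apply: eq_coord; rewrite !coordE; ring.
by apply/seteqP; split; apply: sub.
Qed.

Lemma line_thru_l a b : line_thru a b a.
Proof. by exists 0 => //; rewrite scale0r addr0. Qed.

Lemma line_thru_r a b : line_thru a b b.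
Proof. by rewrite line_thru_sym; exact: line_thru_l. Qed.

Lemma line_normal p th (d : R) a b : a != b ->
  line_thru a b = normal_line p th d <->
  dot2 (nvec th) (a - b) = 0 /\ d = dot2 (nvec th) (a - p).
Proof.
move=> ab; split=> [E|[h ->]].
  have ha : normal_line p th d a by rewrite -E; exact: line_thru_l.
  have hb : normal_line p th d b by rewrite -E; exact: line_thru_r.
  move: ha hb; rewrite /normal_line /= => ha hb; split => //.
  have -> : a - b = (a - p) - (b - p) by apply: eq_coord; rewrite !coordE; ring.
  by rewrite dot2Br ha hb subrr.
have h2 := nvec_perp h; set w := dot2 (tvec th) (a - b) in h2.
have w0 : w != 0.
  by apply: contra ab => /eqP w0; rewrite -subr_eq0 h2 w0 scale0r.
apply/seteqP; split=> [z [t _ <-]|z].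
  rewrite /normal_line /=.
  have -> : a + t *: (b - a) - p = (a - p) - t *: (a - b) by apply: eq_coord; rewrite !coordE; ring.
  by rewrite [LHS]dot2Br dot2Zr h mulr0 subr0.
rewrite /normal_line /= => hz.
have hz0 : dot2 (nvec th) (z - a) = 0.
  have -> : z - a = (z - p) - (a - p) by apply: eq_coord; rewrite !coordE; ring.
  by rewrite dot2Br hz subrr.
have h3 := nvec_perp hz0; set v := dot2 (tvec th) (z - a) in h3.
exists (- (v / w)) => //.
have -> : b - a = - (a - b) by rewrite opprB.
by rewrite scalerN scaleNr opprK h2 scalerA divfK// -h3 addrC subrK.
Qed.

End Plane.

(** * Continuity *)

Section Continuity.
Context {R : realType} {T : topologicalType} (z : T).
Implicit Types (V W : normedModType R).

Lemma forD V (f g : T -> V) : {for z, continuous f} -> {for z, continuous g} ->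
  {for z, continuous (fun w => f w + g w)}.
Proof. exact: cvgD. Qed.
Lemma forN V (f : T -> V) : {for z, continuous f} -> {for z, continuous (fun w => - f w)}.
Proof. exact: cvgN. Qed.
Lemma forM (f g : T -> R) : {for z, continuous f} -> {for z, continuous g} ->
  {for z, continuous (fun w => f w * g w)}.
Proof. exact: cvgM. Qed.
Lemma forZ V (f : T -> R) (g : T -> V) : {for z, continuous f} -> {for z, continuous g} ->
  {for z, continuous (fun w => f w *: g w)}.
Proof. exact: cvgZ. Qed.
Lemma forV (f : T -> R) : f z != 0 -> {for z, continuous f} ->
  {for z, continuous (fun w => (f w)^-1)}.
Proof. exact: cvgV. Qed.
Lemma for_cst (U : topologicalType) (c : U) : {for z, continuous (fun _ : T => c)}.
Proof. exact: cvg_cst. Qed.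
Lemma for_at (U : topologicalType) (f : T -> U) : {for z, continuous f} -> continuous_at z f.
Proof. by []. Qed.
Lemma for_id : {for z, continuous (fun w : T => w)}.
Proof. exact: cvg_id. Qed.
Lemma for_comp (U U' : topologicalType) (g : U -> U') (f : T -> U) :
  continuous g -> {for z, continuous f} -> {for z, continuous (fun w => g (f w))}.
Proof. by move=> hg hf; apply: (continuous_comp hf); apply: hg. Qed.
Lemma for_fst (U V : topologicalType) (f : T -> U * V) :
  {for z, continuous f} -> {for z, continuous (fun w => (f w).1)}.
Proof. by apply: for_comp => w; exact: cvg_fst. Qed.
Lemma for_snd (U V : topologicalType) (f : T -> U * V) :
  {for z, continuous f} -> {for z, continuous (fun w => (f w).2)}.
Proof. by apply: for_comp => w; exact: cvg_snd. Qed.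
Lemma for_pair (U V : topologicalType) (f : T -> U) (g : T -> V) :
  {for z, continuous f} -> {for z, continuous g} -> {for z, continuous (fun w => (f w, g w))}.
Proof. exact: cvg_pair. Qed.
Lemma for_cos (f : T -> R) : {for z, continuous f} -> {for z, continuous (fun w => cos (f w))}.
Proof. by apply: for_comp => w; exact: continuous_cos. Qed.
Lemma for_sin (f : T -> R) : {for z, continuous f} -> {for z, continuous (fun w => sin (f w))}.
Proof. by apply: for_comp => w; exact: continuous_sin. Qed.
Lemma for_norm V (f : T -> V) : {for z, continuous f} -> {for z, continuous (fun w => `|f w|)}.
Proof. exact: cvg_norm. Qed.

Lemma for_det2 (f g : T -> R * R) : {for z, continuous f} -> {for z, continuous g} ->
  {for z, continuous (fun w => det2 (f w) (g w))}.
Proof.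
by move=> hf hg; rewrite /det2; apply: forD; [|apply: forN]; apply: forM;
  (apply: for_fst || apply: for_snd).
Qed.
Lemma for_dot2 (f g : T -> R * R) : {for z, continuous f} -> {for z, continuous g} ->
  {for z, continuous (fun w => dot2 (f w) (g w))}.
Proof.
by move=> hf hg; rewrite /dot2; apply: forD; apply: forM; (apply: for_fst || apply: for_snd).
Qed.
Lemma for_nvec (f : T -> R) : {for z, continuous f} -> {for z, continuous (fun w => nvec (f w))}.
Proof. by move=> hf; apply: for_pair; [apply: for_cos | apply: for_sin]. Qed.
Lemma for_tvec (f : T -> R) : {for z, continuous f} -> {for z, continuous (fun w => tvec (f w))}.
Proof. by move=> hf; apply: for_pair; [apply/forN/for_sin | apply: for_cos]. Qed.

Lemma for_neq0_near V (f : T -> V) : {for z, continuous f} -> f z != 0 ->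
  \forall w \near z, f w != 0.
Proof. by move=> hf; exact: (cvgr_neq0 _ hf). Qed.
Lemma for_gt0_near (f : T -> R) : {for z, continuous f} -> 0 < f z ->
  \forall w \near z, 0 < f w.
Proof. by move=> hf; exact: (cvgr_gt _ hf). Qed.
Lemma for_near_lt V (f : T -> V) (e : R) c : {for z, continuous f} -> 0 < e -> f z = c ->
  \forall w \near z, `|f w - c| < e.
Proof.
move=> hf e0 <-; have /cvgrPdist_lt /(_ _ e0) := hf.
by apply: filterS => w; rewrite distrC.
Qed.

End Continuity.

(** Continuity is proved by dispatch on the head symbol of the function body; [cont] closes the
    leaves by assumption and is extended below to the operations of the polygon. *)
Ltac cont1 :=
  lazymatch goal with
  | |- continuous_at _ _ => apply: for_at
  | |- prop_for _ (@inPhantom (continuous ?f)) =>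
    lazymatch f with
    | (fun _ => ?c) => exact: for_cst
    | (fun w => w) => exact: for_id
    | fst => exact: cvg_fst
    | snd => exact: cvg_snd
    | nvec => apply: (@for_nvec _ _ _ (fun w => w))
    | tvec => apply: (@for_tvec _ _ _ (fun w => w))
    | cos => exact: continuous_cos
    | sin => exact: continuous_sin
    | (fun w => nvec _) => apply: for_nvec
    | (fun w => tvec _) => apply: for_tvec
    | (fun w => det2 _ _) => apply: for_det2
    | (fun w => dot2 _ _) => apply: for_dot2
    | (fun w => fst _) => apply: for_fst
    | (fun w => snd _) => apply: for_snd
    | (fun w => (_ + _)%R) => apply: forD
    | (fun w => (- _)%R) => apply: forN
    | (fun w => (_ * _)%R) => apply: forM
    | (fun w => (_ *: _)%R) => apply: forZ
    | (fun w => cos _) => apply: for_cos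
    | (fun w => sin _) => apply: for_sin
    | (fun w => (`|_|)%R) => apply: for_norm
    | (fun w => (_, _)) => apply: for_pair
    end
  end.
Ltac cont := repeat (cont1 || assumption).

(** Compactness of [K] makes a local alternative uniform. Typically [C] is a closed condition and
    [G] an open one: if the limit objects satisfying [C] also satisfy [G], so do all objects close
    to the limit. *)
Lemma near_tube {T : topologicalType} (K : set T) (I : Type) (F : set_system I)
    (C G : I -> T -> Prop) : Filter F -> compact K ->
  (forall x, K x -> (\forall x' \near x & i \near F, ~ C i x') \/
                    (\forall x' \near x & i \near F, G i x')) ->
  \forall i \near F, forall x, K x -> C i x -> G i x.
Proof.
move=> FF /compact_near_coveringP cK h.
have := cK I F (fun i x => C i x -> G i x) FF.
have h' : forall x, K x -> \near x & F, C F x -> G F x.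
  by move=> x /h [] H; apply: filterS H => -[a b] /=.
by move=> /(_ h'); apply: filterS => i Hi x Kx; apply: Hi.
Qed.

Lemma near_forall (T : Type) (I : finType) (F : set_system T) {FF : Filter F} (f : I -> set T) :
  (forall i, \forall x \near F, f i x) -> \forall x \near F, forall i, f i x.
Proof. exact: filter_forall. Qed.

Lemma near_forall2 (T : Type) (I : finType) (F : set_system T) {FF : Filter F} (f : I -> I -> set T) :
  (forall i j, \forall x \near F, f i j x) -> \forall x \near F, forall i j, f i j x.
Proof. by move=> h; apply: filter_forall => i; apply: filter_forall => j; exact: h. Qed.

(** * Finite subdivisions of an interval *)

Section RealSets.
Context {R : realType}.
Implicit Types (S : set R) (Q : R -> R -> Prop) (a b c d : R).

(** Induction on a list that contains the cut points; entries outside the interval or outside [S]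
    are skipped. [Q] only has to hold between consecutive cuts and to be additive at a cut. *)
Lemma interval_ind S Q a b (l : seq R) : a < b ->
  (forall th, a < th < b -> S th -> th \in l) ->
  (forall c d, a <= c -> c < d -> d <= b -> (forall th, c < th < d -> ~ S th) -> Q c d) ->
  (forall c d e, a <= c -> c < d -> d < e -> e <= b -> S d -> Q c d -> Q d e -> Q c e) ->
  Q a b.
Proof.
move=> ab hl hbase hstep.
suff main c d : a <= c -> c < d -> d <= b -> (forall th, c < th < d -> S th -> th \in l) -> Q c d.
  exact: main.
move=> {ab hl}; elim: l c d => [|x l IH] c d ac cd db hl.
  by apply: hbase => // th h Sth; have := hl _ h Sth.
have [/andP[h1 h2]|hx] := boolP (c < x < d); last first.
  apply: IH => // th h Sth; have := hl _ h Sth; rewrite in_cons => /orP[/eqP e|//].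
  by move: hx; rewrite -e h.
have [Sx|nSx] := pselect (S x); last first.
  apply: IH => // th h Sth; have := hl _ h Sth; rewrite in_cons => /orP[/eqP e|//].
  by case: nSx; rewrite -e.
apply: (hstep c x d) => //; apply: IH => //.
- by apply: le_trans db; apply: ltW.
- move=> th /andP[h3 h4] Sth; have := hl th; rewrite h3 (lt_trans h4)// in_cons => /(_ isT Sth).
  by rewrite (lt_eqF h4).
- by apply: le_trans ac _; apply: ltW.
- move=> th /andP[h3 h4] Sth; have := hl th; rewrite h4 (lt_trans h1)// in_cons => /(_ isT Sth).
  by rewrite (gt_eqF h3).
Qed.

Lemma last_before S (lo c : R) (l : seq R) :
  (forall th, lo <= th < c -> S th -> th \in l) -> (exists2 th, lo <= th < c & S th) ->
  exists2 a, lo <= a < c & S a /\ forall th, a < th < c -> ~ S th.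
Proof.
have [m] := ubnP (size l); elim: m l lo => // m IH l lo.
rewrite ltnS => lm hl [th0 h0 S0].
(* Either [th0] is the last point, or the search restarts at a later [th1] with [th0] struck from
   the list. *)
have [[th1 /andP[h1 h1c] S1]|h1] := pselect (exists2 th, th0 < th < c & S th); last first.
  by exists th0 => //; split => // th h Sth; apply: h1; exists th.
have [|||a /andP[h2 h3] h4] := IH [seq x <- l | x != th0] th1.
- apply: leq_trans lm; rewrite size_filter ltn_neqAle count_size andbT.
  rewrite -all_count; apply/allPn; exists th0; first exact: hl.
  by rewrite /= eqxx.
- move=> th /andP[h2 h3] Sth; rewrite mem_filter /=; apply/andP; split.
    by rewrite gt_eqF// (lt_le_trans h1).
  apply: hl => //; rewrite h3 andbT; move/andP: h0 => [h0 _].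
  by apply: le_trans h0 _; apply: ltW; apply: lt_le_trans h2.
- by exists th1 => //; rewrite lexx.
exists a => //; rewrite h3 andbT; move/andP: h0 => [h0 _].
by apply: le_trans h0 _; apply: ltW; apply: lt_le_trans h2.
Qed.

Lemma first_after S (hi c : R) (l : seq R) :
  (forall th, c < th <= hi -> S th -> th \in l) -> (exists2 th, c < th <= hi & S th) ->
  exists2 a, c < a <= hi & S a /\ forall th, c < th < a -> ~ S th.
Proof.
move=> hl [th0 h0 S0].
have [||a h [h1 h2]] := @last_before [set x | S (- x)] (- hi) (- c) (map -%R l).
- move=> th h Sth; rewrite -[th]opprK map_f//; apply: hl => //.
  by move: h; rewrite lerNl ltrNr andbC.
- by exists (- th0); rewrite /= ?opprK// lerN2 ltrN2 andbC.
exists (- a); first by move: h; rewrite lerNl ltrNr andbC.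
split => // th hth Sth; apply: (h2 (- th)); rewrite /= ?opprK//.
by rewrite ltrNr ltrN2 andbC.
Qed.

End RealSets.

(** * Functions of class C0 and C1 *)

Section Derivatives.
Context {R : realType}.
Implicit Types (f g : R -> R) (x a b : R).

Lemma quotP {V : normedModType R} (f : R -> V) x (df : V) :
  is_derive x 1 f df <-> h^-1 *: (f (x + h) - f x) @[h --> 0^'] --> df.
Proof.
have E : (fun h : R => h^-1 *: ((f \o shift x) (h *: 1) - f x)) =
         (fun h : R => h^-1 *: (f (x + h) - f x)).
  apply/funext => h; congr (_ *: (_ - _)).
  by rewrite /= -[in RHS](mulr1 h) [x + _]addrC.
split=> [[h1 <-]|h].
  by move: h1; rewrite /derivable /derive E.
by split; rewrite /derivable /derive E; [apply/cvg_ex; exists df | apply: cvg_lim].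
Qed.

Lemma derive1_val {V : normedModType R} (f : R -> V) x (df : V) : is_derive x 1 f df -> derive1 f x = df.
Proof. by move=> [_ <-]; rewrite derive1E. Qed.

Lemma is_derive_near {V : normedModType R} (f g : R -> V) x (df : V) : (\forall y \near x, f y = g y) ->
  is_derive x 1 f df -> is_derive x 1 g df.
Proof.
move=> fg /quotP h; apply/quotP; move: h; apply: cvg_trans.
have fgx : f x = g x by apply: nbhs_singleton fg.
apply: near_eq_cvg; rewrite -fgx.
have c1 : {for 0, continuous (fun h : R => x + h)} by cont.
have : \forall h \near (0 : R), f (x + h) = g (x + h).
  by apply: (c1 (fun y => f y = g y)); rewrite addr0.
by move=> /nbhs_dnbhs; apply: filterS => h ->.
Qed.

Lemma cos_quot x : h^-1 * (cos (x + h) - cos x) @[h --> 0^'] --> - sin x.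
Proof. by have /quotP := is_derive_cos x. Qed.

Lemma sin_quot x : h^-1 * (sin (x + h) - sin x) @[h --> 0^'] --> cos x.
Proof. by have /quotP := is_derive_sin x. Qed.

(** The derivative is asked for only in the open interval, since at a transition [qfun] has mere
    one-sided derivatives; [f] and the candidate [g] are nevertheless continuous at the endpoints,
    from both sides. *)
Definition C1 a b f := exists g, [/\ forall x, a <= x <= b -> {for x, continuous f},
  forall x, a <= x <= b -> {for x, continuous g} & forall x, a < x < b -> is_derive x 1 f (g x)].

Definition C0 a b f := forall x, a <= x <= b -> {for x, continuous f}.

(** The closure properties common to [C0] and [C1]. The envelope of a cell is rational in [qfun],
    [cos] and [sin], so its regularity is derived once for both classes. *)
Record rational_class a b (A : (R -> R) -> Prop) : Prop := RationalClass {
  rc_cst : forall c, A (fun _ => c);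
  rc_add : forall f g, A f -> A g -> A (fun x => f x + g x);
  rc_mul : forall f g, A f -> A g -> A (fun x => f x * g x);
  rc_inv : forall f, (forall x, a <= x <= b -> f x != 0) -> A f -> A (fun x => (f x)^-1);
  rc_cos : A cos;
  rc_sin : A sin }.

Lemma C0_rational a b : rational_class a b (C0 a b).
Proof.
split.
- by move=> c x _; exact: for_cst.
- by move=> f g hf hg x hx; apply: forD; [exact: hf | exact: hg].
- by move=> f g hf hg x hx; apply: forM; [exact: hf | exact: hg].
- by move=> f f0 hf x hx; apply: forV; [exact: f0 | exact: hf].
- by move=> x _; exact: continuous_cos.
- by move=> x _; exact: continuous_sin.
Qed.

Lemma C1_rational a b : rational_class a b (C1 a b).
Proof.
have ioc x : a < x < b -> a <= x <= b by move=> /andP[? ?]; rewrite !ltW.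
split.
- move=> c; exists (fun _ => 0); split=> x _; first exact: for_cst.
    exact: for_cst.
  exact: is_derive_cst.
- move=> f g [f' [cf cf' hf]] [g' [cg cg' hg]]; exists (fun x => f' x + g' x); split=> x hx.
  + by apply: forD; [exact: cf | exact: cg].
  + by apply: forD; [exact: cf' | exact: cg'].
  + by apply: is_deriveD; [exact: hf | exact: hg].
- move=> f g [f' [cf cf' hf]] [g' [cg cg' hg]].
  exists (fun x => f x * g' x + g x * f' x); split=> x hx.
  + by apply: forM; [exact: cf | exact: cg].
  + by apply: forD; apply: forM; [exact: cf | exact: cg' | exact: cg | exact: cf'].
  + by apply: is_deriveM; [exact: hf | exact: hg].
- move=> f f0 [f' [cf cf' hf]]; exists (fun x => - ((f x * f x)^-1 * f' x)); split=> x hx.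
  + by apply: forV; [exact: f0 | exact: cf].
  + apply: forN; apply: forM; last exact: cf'.
    by apply: forV; [rewrite mulf_neq0 ?f0 | apply: forM; exact: cf].
  + apply: (is_derive_eq (is_deriveV (f0 _ (ioc _ hx)) (hf _ hx))).
    by rewrite /= -expr2 [LHS]mulNr.
- exists (fun x => - sin x); split=> x _; first exact: continuous_cos.
    by apply: forN; exact: continuous_sin.
  exact: is_derive_cos.
- exists cos; split=> x _; first exact: continuous_sin.
    exact: continuous_cos.
  exact: is_derive_sin.
Qed.

Section RationalClassTheory.
Context {a b : R} {A : (R -> R) -> Prop} (hA : rational_class a b A).

Lemma rc_opp f : A f -> A (fun x => - f x).
Proof.
move=> hf; have -> : (fun x => - f x) = (fun x => -1 * f x) by apply/funext => x; rewrite mulN1r.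
exact: (rc_mul hA (rc_cst hA (-1)) hf).
Qed.

Lemma rc_div f g : (forall x, a <= x <= b -> g x != 0) -> A f -> A g -> A (fun x => f x / g x).
Proof. by move=> g0 hf hg; exact: (rc_mul hA hf (rc_inv hA g0 hg)). Qed.

Definition vclass (F : R -> R * R) := A (fun x => (F x).1) /\ A (fun x => (F x).2).

Lemma vclass_cst c : vclass (fun _ => c).
Proof. by split; exact: (rc_cst hA). Qed.
Lemma vclass_add F G : vclass F -> vclass G -> vclass (fun x => F x + G x).
Proof. by move=> [? ?] [? ?]; split; exact: (rc_add hA). Qed.
Lemma vclass_scale f F : A f -> vclass F -> vclass (fun x => f x *: F x).
Proof. by move=> ? [? ?]; split; exact: (rc_mul hA). Qed.
Lemma class_dot2 F G : vclass F -> vclass G -> A (fun x => dot2 (F x) (G x)).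
Proof. by move=> [? ?] [? ?]; apply: (rc_add hA); exact: (rc_mul hA). Qed.
Lemma class_det2 F G : vclass F -> vclass G -> A (fun x => det2 (F x) (G x)).
Proof. by move=> [? ?] [? ?]; apply: (rc_add hA); [|apply: rc_opp]; exact: (rc_mul hA). Qed.
Lemma vclass_nvec : vclass nvec.
Proof. by split; [exact: (rc_cos hA) | exact: (rc_sin hA)]. Qed.
Lemma vclass_tvec : vclass tvec.
Proof. by split; [apply: rc_opp; exact: (rc_sin hA) | exact: (rc_cos hA)]. Qed.

End RationalClassTheory.

End Derivatives.

(** * Integrals *)

Section Integrals.
Context {R : realType}.
Implicit Types (f g F : R -> R) (a b c v w : R).
Local Notation mu := (@lebesgue_measure R).

(** Integrability is kept together with the value, so that integrals over consecutive cells can be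
    concatenated. *)
Definition has_int f a b v :=
  mu.-integrable `[a, b]%classic (EFin \o f) /\ \int[mu]_(x in `[a, b]) f x = v.

Lemma has_int_within f a b : C0 a b f -> {within `[a, b], continuous f}.
Proof.
move=> hf; apply: continuous_in_subspaceT => x; rewrite inE /= in_itv /= => hx.
exact: hf.
Qed.

Lemma has_int_C0 f a b : C0 a b f -> has_int f a b (\int[mu]_(x in `[a, b]) f x).
Proof.
move=> hf; split => //; apply: continuous_compact_integrable; first exact: segment_compact.
exact: has_int_within.
Qed.

Lemma has_int_FTC f F a b : a < b -> C0 a b f -> C0 a b F ->
  (forall x, a < x < b -> is_derive x 1 F (f x)) -> has_int f a b (F b - F a).
Proof.
move=> ab hf hF dF; have [h1 _] := has_int_C0 hf; split => //.
have ha : a <= a <= b by rewrite lexx ltW.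
have hb : a <= b <= b by rewrite lexx ltW.
rewrite /Rintegral (@continuous_FTC2 R f F a b ab)//.
- exact: has_int_within.
- split.
  + by move=> x; rewrite in_itv /= => hx; have [] := dF x hx.
  + by apply: cvg_at_right_filter; exact: hF.
  + by apply: cvg_at_left_filter; exact: hF.
- by move=> x; rewrite in_itv /= => hx; exact: derive1_val (dF x hx).
Qed.

(** The endpoints are negligible. Agreement is available only inside a cell: at its ends [envelope]
    is computed from a derivative that need not exist. *)
Lemma has_int_eq f g a b v : (forall x, a < x < b -> f x = g x) -> has_int f a b v -> has_int g a b v.
Proof.
move=> fg [h1 h2].
have mf : measurable_fun `]a, b[%classic (EFin \o f).
  apply: measurable_funS (measurable_int mu h1) => //.
  by apply: subset_itv_oo_cc.
have fg' : {in `]a, b[%classic, EFin \o f =1 EFin \o g}.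
  by move=> x; rewrite inE /= in_itv /= => hx; rewrite fg.
have mg : measurable_fun `]a, b[%classic (EFin \o g) by apply: eq_measurable_fun mf.
have mg' : measurable_fun `[a, b]%classic (EFin \o g) by exact: emeasurable_fun_itv_cc mg.
have [_ fin] := integrableP _ _ _ h1.
split.
  apply/integrableP; split => //; move: fin.
  rewrite !(@integral_itv_bndoo _ _ _ _ true false); last 2 first.
  - exact: measurableT_comp mg.
  - exact: measurableT_comp mf.
  congr (_ < _)%E; apply: eq_integral => x hx.
  by congr (`| _ |)%E; exact: fg'.
rewrite -h2 /Rintegral; congr fine.
rewrite !(@integral_itv_bndoo _ _ _ _ true false)//.
by apply: eq_integral => x hx; symmetry; exact: fg'.
Qed.

Lemma has_int_cat f a b c v w : a <= b -> b <= c ->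
  has_int f a b v -> has_int f b c w -> has_int f a c (v + w).
Proof.
move=> ab bc [h1 h2] [h3 h4].
have E : `[a, c]%classic = `[a, b[%classic `|` `[b, c]%classic :> set R.
  by rewrite -itv_bndbnd_setU ?bnd_simp.
have mab : measurable_fun `[a, b[%classic (EFin \o f).
  by apply: measurable_funS (measurable_int mu h1) => //; apply: subset_itvl; rewrite bnd_simp.
have mbc := measurable_int mu h3.
have mac : measurable_fun `[a, c]%classic (EFin \o f).
  by rewrite E; apply/measurable_funU.
have [_ f1] := integrableP _ _ _ h1; have [_ f3] := integrableP _ _ _ h3.
have h5 : mu.-integrable `[a, c]%classic (EFin \o f).
  apply/integrableP; split => //; rewrite E ge0_integral_setU//; last 2 first.
  - by rewrite -E; exact: measurableT_comp mac.
  - apply/disj_setPS => y [/=]; rewrite 2!in_itv/= => /andP[_ yb] /andP[].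
    by rewrite leNgt yb.
  rewrite integral_itv_bndo_bndc; last exact: measurableT_comp mab.
  by rewrite lte_add_pinfty.
split => //; rewrite -h2 -h4 E Rintegral_setU//; last 2 first.
- by rewrite -E.
- apply/disj_setPS => y [/=]; rewrite 2!in_itv/= => /andP[_ yb] /andP[].
  by rewrite leNgt yb.
congr (_ + _); apply: Rintegral_itv_bndo_bndc.
by apply: integrableS h1 => //; apply: subset_itvl; rewrite bnd_simp.
Qed.

Lemma has_int_add f g a b v w : has_int f a b v -> has_int g a b w ->
  has_int (fun x => f x + g x) a b (v + w).
Proof.
move=> [h1 h2] [h3 h4]; split; first exact: integrableD h1 h3.
by rewrite RintegralD// h2 h4.
Qed.

End Integrals.

Lemma countable_setU (T : Type) (A B : set T) : countable A -> countable B -> countable (A `|` B).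
Proof.
move=> hA hB; rewrite -bigcup2E; apply: bigcup_countable => // -[|[|i]] _ //=.
Qed.

(** * Dominated convergence outside a countable set *)

Section DominatedConvergence.
Context {R : realType}.
Local Notation mu := (@lebesgue_measure R).

Lemma Rintegral_cvg (f_ : nat -> R -> R) (f : R -> R) (a b M : R) (N : set R) : countable N ->
  (forall m, mu.-integrable `[a, b]%classic (EFin \o f_ m)) ->
  mu.-integrable `[a, b]%classic (EFin \o f) ->
  (forall m x, a <= x <= b -> ~ N x -> `|f_ m x| <= M) ->
  (forall x, a <= x <= b -> ~ N x -> f_ m x @[m --> \oo] --> f x) ->
  \int[mu]_(x in `[a, b]) f_ m x @[m --> \oo] --> \int[mu]_(x in `[a, b]) f x.
Proof.
move=> cN hf_ hf hM hcv.
have aeN (Q : R -> Prop) : (forall x, ~ N x -> Q x) -> {ae mu, forall x, Q x}.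
  move=> h; exists N; split.
  - by apply: countable_measurable => // t; exact: measurable_set1.
  - exact: countable_lebesgue_measure0.
  - by move=> x /= nQ; apply: contrapT => nN; apply: nQ; exact: h.
have iM : mu.-integrable `[a, b]%classic (EFin \o cst M).
  by have [|h _] := @has_int_C0 R (cst M) a b; first by move=> x _; exact: for_cst.
have [||||||_ _ h] := @dominated_convergence _ _ R mu `[a, b]%classic _ (fun m => EFin \o f_ m) (EFin \o f) (EFin \o cst M).
- by [].
- by move=> m; exact: (measurable_int mu (hf_ m)).
- exact: (measurable_int mu hf).
- apply: aeN => x nN; rewrite /= in_itv /= => hx; apply: cvg_EFin; last exact: hcv.
  by near=> m.
- exact: iM.
- by apply: aeN => x nN m; rewrite /= in_itv /= lee_fin => hx; exact: hM.
have hfin : (\int[mu]_(x in `[a, b]) (f x)%:E)%E \is a fin_num.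
  by apply: integrable_fin_num => //; exact: hf.
apply: fine_cvg; rewrite fineK//; exact: h.
Unshelve. all: by end_near. Qed.

End DominatedConvergence.

(** * Periodic extension *)

Section PeriodicExtension.
Context {R : realType}.
Implicit Types u : R.

Lemma for_min (T : topologicalType) (z : T) (f g : T -> R) : {for z, continuous f} ->
  {for z, continuous g} -> {for z, continuous (fun w => Num.min (f w) (g w))}.
Proof. by move=> hf hg; exact: (@continuous_min R T f g z hf hg). Qed.

Lemma for_max (T : topologicalType) (z : T) (f g : T -> R) : {for z, continuous f} ->
  {for z, continuous g} -> {for z, continuous (fun w => Num.max (f w) (g w))}.
Proof. by move=> hf hg; exact: (@continuous_max R T f g z hf hg). Qed.

Definition clamp (u : R) : R := Num.max 0 (Num.min u 1).

Lemma clamp_continuous : continuous clamp.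
Proof.
move=> u; suff : {for u, continuous (fun w : R => Num.max 0 (Num.min w 1))} by [].
by apply: for_max; [exact: for_cst | apply: for_min; [exact: for_id | exact: for_cst]].
Qed.

Lemma clamp_id u : 0 <= u <= 1 -> clamp u = u.
Proof. by move=> /andP[h1 h2]; rewrite /clamp (min_idPl h2); apply/max_idPr. Qed.

Lemma clamp_le0 u : u <= 0 -> clamp u = 0.
Proof. by move=> h; rewrite /clamp; apply/max_idPl; rewrite ge_min h. Qed.

Lemma clamp_ge1 u : 1 <= u -> clamp u = 1.
Proof. by move=> h; rewrite /clamp (min_idPr h); apply/max_idPr. Qed.

Lemma clamp_itv u : 0 <= clamp u <= 1.
Proof. by rewrite /clamp le_max lexx ge_max ler01 ge_min lexx orbT. Qed.

Definition frac (u : R) : R := u - (Num.floor u)%:~R.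

Lemma frac_itv u : 0 <= frac u < 1.
Proof.
have /andP[h1 h2] := floor_itv u; move: h2; rewrite /frac intrD => h2.
by apply/andP; split; lra.
Qed.

Lemma floorD1 u : Num.floor (u + 1) = Num.floor u + 1.
Proof. by rewrite floorDrz ?floor1// rpred1. Qed.

Lemma fracD1 u : frac (u + 1) = frac u.
Proof. by rewrite /frac floorD1 intrD; ring. Qed.

Lemma frac_id u : 0 <= u < 1 -> frac u = u.
Proof. by move=> h; rewrite /frac (@floor_def R u 0) ?subr0. Qed.

Lemma extension_continuous (V : normedModType R) (f : R -> V) (c : V) :
  continuous f -> f 1 = f 0 + c ->
  continuous (fun u : R => f (frac u) + (Num.floor u)%:~R *: c).
Proof.
move=> cf f1 u; pose m := Num.floor u.
(* A single formula valid on both sides of the integer [m]: to its right the second clamp is stuck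
   at 1, to its left the first is stuck at 0, and [f 1 = f 0 + c] makes both cases agree with the
   extension. *)
pose f2 (w : R) := f (clamp (w - m%:~R)) + f (clamp (w - m%:~R + 1)) - f 0 + (m%:~R - 1) *: c.
have c2 : {for u, continuous f2}.
  rewrite /f2; apply: forD; last exact: for_cst.
  apply: forD; last exact: for_cst.
  by apply: forD; apply: (for_comp cf); apply: (for_comp clamp_continuous); cont.
have /andP[m1 m2] := floor_itv u; rewrite intrD in m2.
have E : \forall w \near u, f2 w = f (frac w) + (Num.floor w)%:~R *: c.
  near=> w.
  have w1 : u - 1 < w by near: w; apply: lt_nbhsr; rewrite ltrBlDr ltrDl.
  have w2 : w < m%:~R + 1 by near: w; exact: lt_nbhsl.
  have [mw|mw] := leP m%:~R w.
    have -> : Num.floor w = m by apply: floor_def; rewrite intrD mw.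
    rewrite /f2 /frac (@floor_def R w m) ?intrD ?mw//.
    rewrite clamp_id; last by apply/andP; split; lra.
    rewrite clamp_ge1; last by lra.
    by rewrite f1 [f 0 + c]addrC addrA addrK -addrA -{1}[c]scale1r -scalerDl [1 + _]addrC subrK.
  have -> : Num.floor w = m - 1.
    by apply: floor_def; rewrite !intrD subrK mw andbT; lra.
  rewrite /f2 /frac (@floor_def R w (m - 1)); last first.
    by rewrite !intrD subrK mw andbT; lra.
  rewrite clamp_le0; last by lra.
  rewrite clamp_id; last by apply/andP; split; lra.
  by rewrite intrD; congr (_ + _); rewrite addrAC subrr add0r; congr f; ring.
rewrite /continuous_at -(nbhs_singleton E).
exact: (cvg_trans (near_eq_cvg E) c2).
Unshelve. all: by end_near. Qed.

Lemma periodic_int (T : Type) (f : R -> T) (a : R) (m : int) (u : R) :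
  (forall u, f (u + a) = f u) -> f (u + m%:~R * a) = f u.
Proof.
move=> h; have hn (k : nat) (v : R) : f (v + k%:R * a) = f v.
  elim: k v => [|k IH] v; first by rewrite mul0r addr0.
  by rewrite -addn1 natrD mulrDl mul1r addrA h.
case: m => k; first exact: hn.
by rewrite NegzE mulrNz mulNr -(hn k.+1 (u - _)) subrK.
Qed.

End PeriodicExtension.

(** * Convexity of the polygon *)

Section Indices.
Context {n : nat} (n1 : (1 < n)%N).
Implicit Types (i j : 'Z_(n.*2)) (m : nat).

Lemma double_gt1 : (1 < n.*2)%N.
Proof. by rewrite -addnn; apply: (leq_trans n1); rewrite leq_addr. Qed.

Lemma idx_eq0 m : ((m%:R : 'Z_(n.*2)) == 0) = (n.*2 %| m)%N.
Proof. by rewrite -val_eqE /= val_Zp_nat ?double_gt1// -/(dvdn _ _). Qed.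

Lemma idx_double : (n.*2)%:R = 0 :> 'Z_(n.*2).
Proof. by apply/eqP; rewrite idx_eq0. Qed.

Lemma idx_shift i j : exists2 m, (m < n.*2)%N & i = j + m%:R.
Proof.
exists (val (i - j)); last by rewrite natr_Zp addrC subrK.
by have := ltn_ord (i - j); rewrite [X in (_ < X)%N -> _]Zp_cast ?double_gt1.
Qed.

Lemma opp_idxK : involutive (@opp_idx n).
Proof. by move=> i; rewrite /opp_idx -addrA -natrD addnn idx_double addr0. Qed.

Lemma opp_idxD i j : opp_idx (i + j) = opp_idx i + j.
Proof. by rewrite /opp_idx addrAC. Qed.

(** Since 2n is at least 4, four consecutive sides are distinct. *)
Lemma idx_small m : (0 < m < 4)%N -> (m%:R : 'Z_(n.*2)) != 0.
Proof.
move=> /andP[m0 m4]; rewrite idx_eq0; apply/negP => /(dvdn_leq m0).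
rewrite leqNgt (leq_trans m4)//.
by rewrite -[4%N]/(2.*2)%N leq_double.
Qed.

Lemma idx_neqD i m : (0 < m < 4)%N -> i + m%:R != i.
Proof.
by move=> /idx_small; apply: contra => /eqP h; rewrite -[m%:R](addKr i) h addNr.
Qed.

End Indices.

Section Geometry.
Context {R : realType} {n : nat}.
Context (P : 'Z_(n.*2) -> R * R) (mu : 'Z_(n.*2) -> R) (hP : cppos P mu).
Implicit Types (i j : 'Z_(n.*2)) (m : nat) (x y z u v p : R * R) (s t r : R).

Let n1 := cppos_gt1 hP.

(** Up to the length of the side, the signed distance to the line of side [i]; the region is where
    all these affine functions are nonnegative. *)
Definition height i z : R := det2 (edge P i) (z - P i).

Lemma height_aff i z u s : height i (z + s *: (u - z)) = (1 - s) * height i z + s * height i u.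
Proof. rewrite /height /det2 !coordE; ring. Qed.

Lemma heightD i z u : height i (z + u) = height i z + det2 (edge P i) u.
Proof. rewrite /height /det2 !coordE; ring. Qed.

Lemma height_own i s : height i (side_pt P i s) = 0.
Proof. rewrite /height /side_pt /det2 !coordE; ring. Qed.

Lemma side_pt0 i : side_pt P i 0 = P i.
Proof. by rewrite /side_pt scale0r addr0. Qed.

Lemma side_pt1 i : side_pt P i 1 = P (i + 1).
Proof. by rewrite /side_pt scale1r /edge addrC subrK. Qed.

Lemma height_side i j s :
  height i (side_pt P j s) = (1 - s) * height i (P j) + s * height i (P (j + 1)).
Proof. by rewrite /side_pt height_aff. Qed.

Lemma height_P i : height i (P i) = 0.
Proof. by rewrite -side_pt0 height_own. Qed.

Lemma height_P1 i : height i (P (i + 1)) = 0.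
Proof. by rewrite -side_pt1 height_own. Qed.

Lemma edge_turn i : 0 < det2 (edge P i) (edge P (i + 1)).
Proof.
rewrite lt_neqAle eq_sym (cppos_vertex hP)/=.
have := cppos_convex hP i (i + 1 + 1); have := cppos_vertex hP i.
by rewrite /edge /det2 !coordE => _ h; apply: le_trans h _; rewrite le_eqVlt; apply/orP; left; apply/eqP; ring.
Qed.

Lemma edge_turnN i : 0 < det2 (edge P (i - 1)) (edge P i).
Proof. by have := edge_turn (i - 1); rewrite subrK. Qed.

Lemma edge_neq0 i : edge P i != 0.
Proof. by have := cppos_vertex hP i => /det2_neq0 []. Qed.

(** The inequalities of the two neighbouring sides cut the segment out of its line. *)
Lemma region_on_line i z : region P z -> height i z = 0 ->
  exists2 s, 0 <= s <= 1 & z = side_pt P i s.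
Proof.
move=> hz h0; have [s hs] := det2_col (edge_neq0 i) h0.
have zE : z = side_pt P i s by rewrite /side_pt -hs addrC subrK.
exists s => //; apply/andP; split.
  have := hz (i - 1); rewrite -/(height _ _) zE /side_pt heightD.
  have -> : height (i - 1) (P i) = 0 by have := height_P1 (i - 1); rewrite subrK.
  by rewrite add0r det2Zr pmulr_lge0// edge_turnN.
have := hz (i + 1); rewrite -/(height _ _) zE.
have -> : side_pt P i s = P (i + 1) + (s - 1) *: edge P i.
  by rewrite /side_pt /edge; apply: eq_coord; rewrite !coordE; ring.
rewrite heightD height_P add0r det2Zr det2C mulrN oppr_ge0 pmulr_lle0 ?edge_turn//.
by rewrite subr_le0.
Qed.

Lemma region_P j : region P (P j).
Proof. by move=> i; apply: cppos_convex hP i j. Qed.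

(** A vertex in the interior of side [i] would force each supporting line through it to contain that
    side. Applied to the lines of sides [j] and [j - 1], this makes two consecutive edges
    parallel. *)
Lemma height_P_eq0 i j : height i (P j) = 0 -> j = i \/ j = i + 1.
Proof.
move=> h0; have [s /andP[s0 s1] hs] := region_on_line (region_P j) h0.
have [e|sn0] := eqVneq s 0.
  by left; apply: (cppos_inj hP); rewrite hs e side_pt0.
have [e|sn1] := eqVneq s 1.
  by right; apply: (cppos_inj hP); rewrite hs e side_pt1.
have {}s0 : 0 < s by rewrite lt_neqAle eq_sym sn0.
have {}s1 : s < 1 by rewrite lt_neqAle sn1.
have par k : height k (P j) = 0 -> det2 (edge P k) (edge P i) = 0.
  move=> hk; have h1 := cppos_convex hP k i; have h2 := cppos_convex hP k (i + 1).
  rewrite -!/(height _ _) in h1 h2; move: hk; rewrite hs height_side => hk.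
  have hi : height k (P i) = 0.
    apply/eqP; rewrite eq_le h1 andbT leNgt; apply/negP => h3.
    by have := mulr_gt0 s0 h3; nra.
  have hi1 : height k (P (i + 1)) = 0 by move: hk; rewrite hi mulr0 add0r => /eqP; rewrite mulf_eq0 gt_eqF//= => /eqP.
  have : det2 (edge P k) (edge P i) = height k (P (i + 1)) - height k (P i).
    by rewrite /height /edge /det2 !coordE; ring.
  by rewrite hi hi1 subrr.
have h1 := par _ (height_P j).
have h2 : det2 (edge P (j - 1)) (edge P i) = 0.
  by apply: par; have := height_P1 (j - 1); rewrite subrK.
have := plucker (edge P (j - 1)) (edge P j) (edge P i) (edge P (j - 1)).
have [k1 e1] := det2_col (edge_neq0 i) (etrans (det2C _ _) (etrans (congr1 -%R h1) (oppr0 _))).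
have [k2 e2] := det2_col (edge_neq0 i) (etrans (det2C _ _) (etrans (congr1 -%R h2) (oppr0 _))).
by have := edge_turnN j; rewrite e1 e2 !det2E !mulr0 ltxx.
Qed.

Lemma height_P_ge0 i j : 0 <= height i (P j).
Proof. exact: cppos_convex hP i j. Qed.

Lemma region_side i s : 0 <= s <= 1 -> region P (side_pt P i s).
Proof.
move=> /andP[s0 s1] j; rewrite -/(height _ _) height_side.
by rewrite addr_ge0// mulr_ge0 ?height_P_ge0// subr_ge0.
Qed.

Lemma height_side_ge0 i j s : 0 <= s <= 1 -> 0 <= height i (side_pt P j s).
Proof. by move=> hs; apply: region_side. Qed.

Lemma height_side_eq0 i j s : 0 <= s <= 1 -> j != i -> height i (side_pt P j s) = 0 ->
  (j = i + 1 /\ s = 0) \/ (i = j + 1 /\ s = 1).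
Proof.
move=> /andP[s0 s1] ji; rewrite height_side => /eqP.
have s2 : 0 <= 1 - s by rewrite subr_ge0.
rewrite paddr_eq0 ?mulr_ge0 ?height_P_ge0//.
rewrite !mulf_eq0 => /andP[/orP[/eqP h1|/eqP h1] /orP[/eqP h2|/eqP h2]].
- by move: h1; rewrite h2 subr0 => /eqP; rewrite oner_eq0.
- have {}h1 : s = 1 by lra.
  right; split => //; case: (height_P_eq0 h2) => [//|/addIr e].
  by rewrite e eqxx in ji.
- left; split => //; case: (height_P_eq0 h1) => // e.
  by rewrite e eqxx in ji.
- case: (height_P_eq0 h1) => e1; first by rewrite e1 eqxx in ji.
  case: (height_P_eq0 h2) => [e2|/addIr e2]; last by rewrite e2 eqxx in ji.
  by have := @idx_neqD _ n1 i 2 isT; rewrite -[2%:R]/(1 + 1) addrA -e1 e2 eqxx.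
Qed.

Lemma side_pt_inj i s t : side_pt P i s = side_pt P i t -> s = t.
Proof.
rewrite /side_pt => /addrI /eqP; rewrite -subr_eq0 -scalerBl scaler_eq0 (negbTE (edge_neq0 i)) orbF.
by rewrite subr_eq0 => /eqP.
Qed.

(** This is why [sigma] is well defined: only vertices have two representations, as the end of one
    side and the start of the next, and the shift by [n] respects succession. *)
Lemma side_pt_opp i j s t : 0 <= s <= 1 -> 0 <= t <= 1 ->
  side_pt P i s = side_pt P j t -> side_pt P (opp_idx i) s = side_pt P (opp_idx j) t.
Proof.
move=> hs ht e; have [ij|ij] := eqVneq i j.
  by move: e; rewrite ij => /side_pt_inj ->.
have h0 : height j (side_pt P i s) = 0 by rewrite e height_own.
case: (height_side_eq0 hs ij h0) => -[e1 e2]; subst.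
  have -> : t = 1 by apply: (@side_pt_inj j); rewrite -e side_pt0 side_pt1.
  by rewrite side_pt0 side_pt1 opp_idxD.
have -> : t = 0 by apply: (@side_pt_inj (i + 1)); rewrite -e side_pt0 side_pt1.
by rewrite side_pt0 side_pt1 opp_idxD.
Qed.

Lemma side_pt_opp_inj i j s t : 0 <= s <= 1 -> 0 <= t <= 1 ->
  side_pt P (opp_idx i) s = side_pt P (opp_idx j) t -> side_pt P i s = side_pt P j t.
Proof. by move=> hs ht /(side_pt_opp hs ht); rewrite !(opp_idxK n1). Qed.

Lemma sigmaE i s : 0 <= s <= 1 -> sigma P (side_pt P i s) = side_pt P (opp_idx i) s.
Proof.
move=> hs; rewrite /sigma; apply: xget_unique; first by exists i, s.
by move=> y [j [t [ht e ->]]]; rewrite (side_pt_opp hs ht e).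
Qed.

Definition inner p := forall i, 0 < height i p.

(** Edges come in opposite pairs, so if no determinant were negative all would vanish, and [u] would
    be parallel to two independent edges. It expresses that the region is bounded. *)
Lemma edge_positive u : u != 0 -> exists i, det2 (edge P i) u < 0.
Proof.
move=> u0; apply: contrapT => h.
have h1 i : 0 <= det2 (edge P i) u by rewrite leNgt; apply/negP => hi; apply: h; exists i.
have h2 i : det2 (edge P i) u = 0.
  apply/eqP; rewrite eq_le h1 andbT.
  by have := h1 (opp_idx i); rewrite (cppos_edge hP) det2Nl det2Zl oppr_ge0 pmulr_rle0 ?(cppos_mu_gt0 hP).
have [k e] := det2_col (edge_neq0 0) (h2 0).
have := h2 (0 + 1); rewrite e det2Zr det2C => /eqP; rewrite mulrN oppr_eq0 mulf_eq0.
rewrite (gt_eqF (edge_turn 0)) orbF => /eqP k0.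
by move: u0; rewrite e k0 scale0r eqxx.
Qed.

(** The exit time is the smallest of the times at which the ray meets the lines of the sides it
    approaches. *)
Lemma ray_exists p u : inner p -> u != 0 ->
  exists i s r, [/\ 0 <= s <= 1, 0 < r & side_pt P i s = p + r *: u].
Proof.
move=> hp u0; have [i0 hi0] := edge_positive u0.
pose rt i := height i p / - det2 (edge P i) u.
have [i hi hmin] := @arg_minP _ _ _ i0 (fun i => det2 (edge P i) u < 0) rt hi0.
have r0 : 0 < rt i by rewrite divr_gt0// oppr_gt0.
have hr : region P (p + rt i *: u).
  move=> j; rewrite -/(height _ _) heightD det2Zr.
  have [hj|hj] := ltP (det2 (edge P j) u) 0; last first.
    by apply: addr_ge0; [exact: ltW | apply: mulr_ge0 => //; exact: ltW].
  have := hmin j hj; rewrite /rt; set a := _ / _ => h.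
  by have := h; rewrite ler_pdivlMr ?oppr_gt0// mulrN; lra.
have h0 : height i (p + rt i *: u) = 0.
  by rewrite heightD det2Zr /rt invrN mulrN mulNr divfK ?subrr ?lt_eqF.
by have [s hs e] := region_on_line hr h0; exists i, s, (rt i).
Qed.

Lemma inner_between p z s : inner p -> region P z -> 0 <= s < 1 -> inner (p + s *: (z - p)).
Proof.
move=> hp hz /andP[s0 s1] i; rewrite height_aff; apply: ltr_pwDl.
  by apply: mulr_gt0; [rewrite subr_gt0 | exact: hp].
by apply: mulr_ge0 => //; exact: hz.
Qed.

Lemma inner_side i s : ~ inner (side_pt P i s).
Proof. by move/(_ i); rewrite height_own ltxx. Qed.

(** Of two boundary points on the ray, the nearer one would lie strictly between an inner point and
    a point of the region, hence be inner. *)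
Lemma ray_unique p u i j s t r1 r2 : inner p ->
  0 <= s <= 1 -> 0 <= t <= 1 -> 0 < r1 -> 0 < r2 ->
  side_pt P i s = p + r1 *: u -> side_pt P j t = p + r2 *: u -> r1 = r2.
Proof.
move=> hp.
have main i' j' s' t' r r' : 0 <= s' <= 1 -> 0 <= t' <= 1 -> 0 < r -> 0 < r' ->
  side_pt P i' s' = p + r *: u -> side_pt P j' t' = p + r' *: u -> ~ r < r'.
  move=> hs ht r0 r0' e1 e2 rr.
  apply: (@inner_side i' s'); rewrite e1.
  have -> : p + r *: u = p + (r / r') *: (side_pt P j' t' - p).
    by rewrite e2 addrAC subrr add0r scalerA divfK ?gt_eqF.
  apply: inner_between => //; first exact: region_side.
  by rewrite divr_ge0 ?ltW//= ltr_pdivrMr// mul1r.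
move=> hs ht r10 r20 e1 e2; case: (ltgtP r1 r2) => // h.
  by case: (main _ _ _ _ _ _ hs ht r10 r20 e1 e2).
by case: (main _ _ _ _ _ _ ht hs r20 r10 e2 e1).
Qed.

Implicit Types (k l : 'Z_(n.*2)).

(** Induction on [m2]: the Plucker relation with the edge at [i] writes the new determinant, times a
    positive factor, as a sum of nonnegative products. The factor vanishes only for [m2 = 1], and
    then the two vertices compared in the previous step coincide. *)
Lemma orient_ge0 i m1 m2 : (m1 <= m2 <= n.*2)%N ->
  0 <= det2 (P (i + m1%:R) - P i) (P (i + m2%:R) - P i).
Proof.
case: m1 => [|m1]; first by rewrite addr0 subrr det20x.
move=> /andP[m12 m2n]; elim: m2 m12 m2n => // m2 IH m12 m2n.
move: m12; rewrite leq_eqVlt => /orP[/eqP ->|m12]; first by rewrite det2xx.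
have m2n' : (m2 <= n.*2)%N by apply: leq_trans m2n.
have {}IH := IH m12 m2n'.
set a := P (i + m1.+1%:R) - P i in IH *.
set b := P (i + m2%:R) - P i in IH *.
set c := P (i + m2.+1%:R) - P i.
have e0 d : 0 <= det2 (edge P i) (P d - P i) := cppos_convex hP i d.
have bc : 0 <= det2 b c.
  have := cppos_convex hP (i + m2%:R) i; rewrite /edge -addrA -(natrD _ m2 1) addn1.
  by rewrite /b /c /det2 !coordE => h; apply: le_trans h _; rewrite le_eqVlt; apply/orP; left; apply/eqP; ring.
have [b0|] := ltP 0 (det2 (edge P i) b).
  rewrite -(pmulr_rge0 _ b0) plucker.
  by apply: addr_ge0; apply: mulr_ge0 => //; exact: e0.
move=> b0; have b0' : height i (P (i + m2%:R)) = 0 by apply/eqP; rewrite eq_le b0; exact: e0.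
have [e|e] := height_P_eq0 b0'.
  have : (m2%:R : 'Z_(n.*2)) == 0 by rewrite -(addKr i m2%:R) e addNr.
  rewrite (idx_eq0 n1) => /(dvdn_leq (leq_trans (ltn0Sn m1) (m12 : (m1.+1 <= m2)%N))).
  by rewrite leqNgt m2n.
have e1 : (m2%:R : 'Z_(n.*2)) = 1 by move/addrI: e.
have m21 : m2 = 1%N.
  case: m2 m12 m2n e1 {IH b c bc b0 b0' m2n' e} => // m2 m12 m2n /eqP.
  rewrite -subr_eq0 -(natrB _ (isT : (1 <= m2.+1)%N)) subn1 /= (idx_eq0 n1).
  case: m2 m12 m2n => // m2 _ m2n /(dvdn_leq (ltn0Sn m2)).
  by rewrite leqNgt (ltn_trans _ m2n).
have m1E : m1.+1 = m2 by move: m12; rewrite m21; case: (m1).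
by move: bc; rewrite /b -m1E.
Qed.

Lemma orient3_ge0 i m1 m2 k a : (a <= m1 <= m2)%N -> (m2 <= n.*2 + a)%N -> k = i + a%:R ->
  0 <= det2 (P (i + m1%:R) - P k) (P (i + m2%:R) - P k).
Proof.
move=> /andP[am1 m12] m2a ->.
have e m : (a <= m)%N -> i + m%:R = (i + a%:R) + (m - a)%:R.
  by move=> h; rewrite -addrA -natrD subnKC.
rewrite (e m1)// (e m2) ?(leq_trans am1)//; apply: orient_ge0.
by rewrite leq_sub2r//= leq_subLR addnC.
Qed.

(** The orientation of three points is affine in each of them, so it is a convex combination of the
    orientations of eight triples of vertices, all in cyclic order. *)
Lemma orient_sides i m1 m2 s t r : (0 < m1 < m2)%N -> (m2 < n.*2)%N ->
  0 <= s <= 1 -> 0 <= t <= 1 -> 0 <= r <= 1 ->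
  0 <= det2 (side_pt P (i + m1%:R) t - side_pt P i s) (side_pt P (i + m2%:R) r - side_pt P i s).
Proof.
move=> /andP[m10 m12] m2n /andP[s0 s1] /andP[t0 t1] /andP[r0 r1].
have o a b c : (a <= b <= c)%N -> (c <= n.*2 + a)%N ->
    0 <= det2 (P (i + b%:R) - P (i + a%:R)) (P (i + c%:R) - P (i + a%:R)).
  by move=> h1 h2; apply: orient3_ge0 h1 h2 _.
have h m : i + m%:R + 1 = i + m.+1%:R by rewrite -addrA -(natrD _ m 1) addn1.
have o000 := o 0%N m1 m2; have o001 := o 0%N m1 m2.+1.
have o010 := o 0%N m1.+1 m2; have o011 := o 0%N m1.+1 m2.+1.
have o100 := o 1%N m1 m2; have o101 := o 1%N m1 m2.+1.
have o110 := o 1%N m1.+1 m2; have o111 := o 1%N m1.+1 m2.+1.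
have l1 : (m1 <= m2.+1)%N by rewrite ltnW// ltnS ltnW.
have l2 : (m1 <= m2)%N by rewrite ltnW.
have l3 : (m2 <= n.*2)%N by rewrite ltnW.
have l4 : (m1 < m2.+1)%N by rewrite ltnS ltnW.
have l5 : (m2 <= n.*2 + 1)%N by rewrite addn1 ltnW.
have l6 : (m2 < n.*2 + 1)%N by rewrite addn1 ltnS.
rewrite /= ?addn0 ?l1 ?l2 ?l3 ?m10 ?m12 ?m2n ?l4 ?l5 ?l6 ?addr0 in o000 o001 o010 o011 o100 o101 o110 o111.
move: (o000 isT isT) (o001 isT isT) (o010 isT isT) (o011 isT isT) (o100 isT isT) (o101 isT isT) (o110 isT isT) (o111 isT isT).
move=> {o000 o001 o010 o011 o100 o101 o110 o111 o}.
rewrite /side_pt /edge !h.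
move: (P i) (P (i + 1)) (P (i + m1%:R)) (P (i + m1.+1%:R)) (P (i + m2%:R)) (P (i + m2.+1%:R)) => A A' B B' C C'.
move=> o000 o001 o010 o011 o100 o101 o110 o111.
have -> : det2 (B + t *: (B' - B) - (A + s *: (A' - A))) (C + r *: (C' - C) - (A + s *: (A' - A))) =
  (1 - s) * ((1 - t) * ((1 - r) * det2 (B - A) (C - A) + r * det2 (B - A) (C' - A)) +
             t * ((1 - r) * det2 (B' - A) (C - A) + r * det2 (B' - A) (C' - A))) +
  s * ((1 - t) * ((1 - r) * det2 (B - A') (C - A') + r * det2 (B - A') (C' - A')) +
             t * ((1 - r) * det2 (B' - A') (C - A') + r * det2 (B' - A') (C' - A'))).
  by rewrite /det2 !coordE; ring.
have s2 : 0 <= 1 - s by rewrite subr_ge0.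
have t2 : 0 <= 1 - t by rewrite subr_ge0.
have r2 : 0 <= 1 - r by rewrite subr_ge0.
have mix c a b : 0 <= c -> 0 <= 1 - c -> 0 <= a -> 0 <= b -> 0 <= (1 - c) * a + c * b :> R.
  by move=> *; apply: addr_ge0; apply: mulr_ge0.
apply: (mix s) => //; apply: (mix t) => //; exact: (mix r).
Qed.

(* The chord from [(j, s)] to [(k, t)] and its image leave the boundary point
   [(l, v)] and its image on the same side, weakly. *)
Lemma same_side j k l s t (v : R) : j != k ->
  0 <= s <= 1 -> 0 <= t <= 1 -> 0 <= v <= 1 ->
  let x := side_pt P j s in let y := side_pt P k t in let z := side_pt P l v in
  let x' := side_pt P (opp_idx j) s in let y' := side_pt P (opp_idx k) t in
  let z' := side_pt P (opp_idx l) v in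
  (det2 (y - x) (z - x) <= 0 /\ det2 (y' - x') (z' - x') <= 0) \/
  (0 <= det2 (y - x) (z - x) /\ 0 <= det2 (y' - x') (z' - x')).
Proof.
move=> jk hs ht hv /=.
have [d dn kE] := idx_shift n1 k j; have [m mn lE] := idx_shift n1 l j.
have d0 : (0 < d)%N.
  by rewrite lt0n; apply: contra jk => /eqP d0; rewrite kE d0 addr0.
rewrite kE lE !opp_idxD.
case: m mn {lE} => [|m] mn.
  have e j' : det2 (side_pt P (j' + d%:R) t - side_pt P j' s) (side_pt P (j' + 0%:R) v - side_pt P j' s) =
    - ((v - s) * height j' (side_pt P (j' + d%:R) t)).
    by rewrite addr0 /height /side_pt /det2 !coordE; ring.
  rewrite !e !oppr_le0 !oppr_ge0; have h1 := height_side_ge0 j (j + d%:R) ht.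
  have h2 := height_side_ge0 (opp_idx j) (opp_idx j + d%:R) ht.
  have [vs|vs] := leP s v.
    have vs' : 0 <= v - s by rewrite subr_ge0.
    by left; split; apply: mulr_ge0.
  have vs' : v - s <= 0 by rewrite subr_le0 ltW.
  by right; split; apply: mulr_le0_ge0.
(* The sign depends only on the cyclic order of the three sides, which the shift by [n]
   preserves. *)
case: (ltngtP m.+1 d) => md.
- left; split; rewrite det2C oppr_le0; apply: orient_sides => //; exact/andP.
- right; split; apply: orient_sides => //; exact/andP.
have e j' : det2 (side_pt P (j' + d%:R) t - side_pt P j' s) (side_pt P (j' + m.+1%:R) v - side_pt P j' s) =
    (v - t) * height (j' + d%:R) (side_pt P j' s).
  by rewrite md /height /side_pt /det2 !coordE; ring.
rewrite !e; have h1 := height_side_ge0 (j + d%:R) j hs.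
have h2 := height_side_ge0 (opp_idx j + d%:R) (opp_idx j) hs.
have [vs|vs] := leP t v.
  have vs' : 0 <= v - t by rewrite subr_ge0.
  by right; split; apply: mulr_ge0.
have vs' : v - t <= 0 by rewrite subr_le0 ltW.
by left; split; apply: mulr_le0_ge0.
Qed.

(** * Chords *)

Let cls0 : (0 : R) <= 0 <= (1 : R). Proof. by rewrite lexx ler01. Qed.
Let cls1 : (0 : R) <= 1 <= (1 : R). Proof. by rewrite lexx ler01. Qed.

(** A relation and not a function: a vertex has two representations, and exchanging the ends gives
    the same chord. *)
Definition through p j k s t r : Prop :=
  [/\ 0 <= s <= 1, 0 <= t <= 1, 0 <= r <= 1 &
      p = side_pt P j s + r *: (side_pt P k t - side_pt P j s)].

Definition imgvec j k s t : R * R := side_pt P (opp_idx j) s - side_pt P (opp_idx k) t.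

(* [th] is the normal angle of the image of the segment, as in [qfun]. *)
Definition chord p th j k s t r : Prop :=
  through p j k s t r /\ dot2 (nvec th) (imgvec j k s t) = 0.

Lemma through_sym p j k s t r : through p j k s t r -> through p k j t s (1 - r).
Proof.
move=> [hs ht /andP[r0 r1] ->]; split=> //; first by apply/andP; split; lra.
by apply: eq_coord; rewrite !coordE; ring.
Qed.

Lemma chord_sym p th j k s t r : chord p th j k s t r -> chord p th k j t s (1 - r).
Proof.
move=> [/through_sym h e]; split => //.
by move: e; rewrite /imgvec !dot2Br => e; rewrite -opprB e oppr0.
Qed.

Section Inner.
Context {p : R * R} (hp : inner p).

Lemma through_r j k s t r : through p j k s t r -> 0 < r < 1.
Proof.
move=> [hs ht /andP[r0 r1] e]; rewrite !lt_neqAle r0 r1 !andbT eq_sym.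
apply/andP; split; apply/eqP => rE.
  by apply: (@inner_side j s); rewrite rE scale0r addr0 in e; rewrite -e.
by apply: (@inner_side k t); rewrite rE scale1r addrC subrK in e; rewrite -e.
Qed.

Lemma not_common_side i j k s t r : through p j k s t r ->
  height i (side_pt P j s) = 0 -> height i (side_pt P k t) = 0 -> False.
Proof.
move=> [_ _ _ e] h1 h2; have := hp i.
by rewrite e height_aff h1 h2 !mulr0 addr0 ltxx.
Qed.

Lemma through_neq j k s t r : through p j k s t r -> j != k.
Proof.
move=> h; apply/eqP => jk; subst k.
by apply: (not_common_side h (height_own j s)); rewrite height_own.
Qed.

Lemma through_ends j k s t r : through p j k s t r -> side_pt P j s != side_pt P k t.
Proof.
move=> h; apply/eqP => e.
by apply: (not_common_side h (height_own j s)); rewrite -e height_own.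
Qed.

Lemma through_img j k s t r : through p j k s t r -> imgvec j k s t != 0.
Proof.
move=> h; have := through_ends h; apply: contra.
rewrite subr_eq0 => /eqP e; apply/eqP.
by case: h => hs ht _ _; apply: side_pt_opp_inj e.
Qed.

(** The ends of the chord lie on opposite rays from [p], and each ray meets the boundary only
    once. *)
Lemma two_points j k s t r l (v : R) : through p j k s t r -> 0 <= v <= 1 ->
  det2 (side_pt P k t - side_pt P j s) (side_pt P l v - side_pt P j s) = 0 ->
  side_pt P l v = side_pt P j s \/ side_pt P l v = side_pt P k t.
Proof.
move=> h hv e; have := through_ends h; rewrite eq_sym -subr_eq0 => d0.
have /andP[r0 r1] := through_r h; case: (h) => hs ht hr pE.
have [c cE] := det2_col d0 e; set d := side_pt P k t - side_pt P j s in d0 e cE pE.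
have zE : side_pt P l v = p + (c - r) *: d.
  rewrite pE -[LHS](subrK (side_pt P j s)) cE; apply: eq_coord; rewrite !coordE; ring.
have yE : side_pt P k t = p + (1 - r) *: d.
  by rewrite pE /d; apply: eq_coord; rewrite !coordE; ring.
have xE : side_pt P j s = p + r *: (- d).
  by rewrite pE /d; apply: eq_coord; rewrite !coordE; ring.
case: (ltgtP c r) => cr.
- left; have : r - c = r; last by move=> h'; rewrite zE xE -{2}h' scalerN -scaleNr opprB.
  apply: (@ray_unique p (- d) l j v s _ _ hp hv hs _ r0 _ xE); first by rewrite subr_gt0.
  by rewrite zE scalerN -scaleNr opprB.
- right; have : c - r = 1 - r; last by rewrite zE yE => ->.
  by apply: (@ray_unique p d l k v t _ _ hp hv ht _ _ zE yE); rewrite subr_gt0.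
- by case: (@inner_side l v); rewrite zE cr subrr scale0r addr0.
Qed.

(** Otherwise both ends of the image lie on one side; pulled back by [sigma], both ends of the chord
    lie on the opposite side, and so does [p]. Hence [two_points] also applies to image chords. *)
Lemma img_inner j k s t r : through p j k s t r ->
  inner (side_pt P (opp_idx j) s + 2^-1 *: (side_pt P (opp_idx k) t - side_pt P (opp_idx j) s)).
Proof.
move=> h i; case: (h) => hs ht _ _; rewrite height_aff.
have h1 := height_side_ge0 i (opp_idx j) hs; have h2 := height_side_ge0 i (opp_idx k) ht.
have [h1'|h1'] := eqVneq (height i (side_pt P (opp_idx j) s)) 0; last first.
  have : 0 < height i (side_pt P (opp_idx j) s) by rewrite lt_neqAle eq_sym h1'.
  by lra.
have [h2'|h2'] := eqVneq (height i (side_pt P (opp_idx k) t)) 0; last first.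
  have : 0 < height i (side_pt P (opp_idx k) t) by rewrite lt_neqAle eq_sym h2'.
  by lra.
have [a ha ea] := region_on_line (region_side _ hs) h1'.
have [b hb eb] := region_on_line (region_side _ ht) h2'.
have {}ea := side_pt_opp hs ha ea; have {}eb := side_pt_opp ht hb eb.
rewrite !(opp_idxK n1) in ea eb.
by case: (@not_common_side (opp_idx i) _ _ _ _ _ h); rewrite ?ea ?eb height_own.
Qed.

End Inner.

(** Two different chords cross at [p], so the ends of the second are on opposite sides of the first.
    The images are parallel, so there both ends of the second lie on the same side of the first. By
    [same_side] this is possible only if the image lines coincide, and then so do the ends. *)
Lemma chord_unique p th j k s t r j2 k2 s2 t2 r2 :
  inner p -> chord p th j k s t r -> chord p th j2 k2 s2 t2 r2 ->
  (side_pt P j2 s2 = side_pt P j s /\ side_pt P k2 t2 = side_pt P k t) \/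
  (side_pt P j2 s2 = side_pt P k t /\ side_pt P k2 t2 = side_pt P j s).
Proof.
move=> hp [h hn] [h2 hn2].
have jk := through_neq hp h; have /andP[r0 r1] := through_r hp h.
have /andP[r20 r21] := through_r hp h2.
case: (h) (h2) => hs ht hr pE [hs2 ht2 hr2 pE2].
have nx2 := through_ends hp h2.
have pd : det2 (side_pt P k t - side_pt P j s) (p - side_pt P j s) = 0.
  by rewrite pE /det2 !coordE; ring.
have pd2 : (1 - r2) * det2 (side_pt P k t - side_pt P j s) (side_pt P j2 s2 - side_pt P j s)
   + r2 * det2 (side_pt P k t - side_pt P j s) (side_pt P k2 t2 - side_pt P j s) = 0.
  rewrite -pd pE2 /det2 !coordE; ring.
have [e|e] := eqVneq (det2 (side_pt P k t - side_pt P j s) (side_pt P j2 s2 - side_pt P j s)) 0.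
  have e2 : det2 (side_pt P k t - side_pt P j s) (side_pt P k2 t2 - side_pt P j s) = 0.
    by move: pd2; rewrite e mulr0 add0r => /eqP; rewrite mulf_eq0 gt_eqF//= => /eqP.
  have := two_points hp h ht2 e2; have := two_points hp h hs2 e.
  by case=> e3 [] e4; rewrite e3 e4 ?eqxx in nx2 *; [|left|right|].
have D : det2 (side_pt P (opp_idx k) t - side_pt P (opp_idx j) s)
              (side_pt P (opp_idx j2) s2 - side_pt P (opp_idx j) s)
       = det2 (side_pt P (opp_idx k) t - side_pt P (opp_idx j) s)
              (side_pt P (opp_idx k2) t2 - side_pt P (opp_idx j) s).
  have := nvec_perp_det2 hn hn2; rewrite /imgvec.
  by rewrite /det2 !coordE => h3; apply: subr0_eq; rewrite -[RHS]oppr0 -h3; ring.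
have h1' := same_side j2 jk hs ht hs2; have h2' := same_side k2 jk hs ht ht2.
rewrite /= D in h1'; rewrite /= in h2'.
have E0 : det2 (side_pt P (opp_idx k) t - side_pt P (opp_idx j) s)
              (side_pt P (opp_idx k2) t2 - side_pt P (opp_idx j) s) = 0.
  move: pd2 e h1' h2'; set A := det2 _ _; set B := det2 _ _; set C := det2 _ _.
  move=> pd2 /eqP A0 h1' h2'; apply/eqP; rewrite eq_le.
  (* [p] lies strictly between the ends of the second chord and on the line of the first. *)
  have sg : (A < 0 /\ 0 < B) \/ (0 < A /\ B < 0).
    case: (ltgtP A 0) => Az; [left|right|by []]; split => //.
      rewrite ltNge; apply/negP => Bz; have : (1 - r2) * A < 0 by rewrite pmulr_rlt0// subr_gt0.
      have : r2 * B <= 0 by rewrite pmulr_rle0.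
      lra.
    rewrite ltNge; apply/negP => Bz; have : 0 < (1 - r2) * A by rewrite pmulr_rgt0// subr_gt0.
    have : 0 <= r2 * B by rewrite pmulr_rge0.
    lra.
  by apply/andP; lra.
have h3 : through (side_pt P (opp_idx j) s + 2^-1 *: (side_pt P (opp_idx k) t - side_pt P (opp_idx j) s))
   (opp_idx j) (opp_idx k) s t 2^-1.
  by split => //; apply/andP; split; lra.
exfalso; move/eqP: e; apply.
have hp' := img_inner hp h.
case: (two_points hp' h3 hs2 (etrans D E0)) => /side_pt_opp_inj ->//.
  by rewrite subrr det2x0.
by rewrite det2xx.
Qed.

Lemma det2_line (x y : R * R) (q : R) : det2 (y - x) (x + q *: (y - x) - x) = 0.
Proof. rewrite /det2 !coordE; ring. Qed.

Lemma nvecDpi th : nvec (th + pi) = - nvec th :> R * R.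
Proof. by apply: eq_coord => /=; rewrite ?cosDpi ?sinDpi. Qed.

Lemma tvecDpi th : tvec (th + pi) = - tvec th :> R * R.
Proof. by apply: eq_coord => /=; rewrite ?cosDpi ?sinDpi. Qed.

Lemma line_thru_eq x y z u : line_thru x y z -> line_thru x y u -> z != u ->
  line_thru z u = line_thru x y.
Proof.
move=> [a _ <-] [b _ <-] zu.
have ab : b - a != 0.
  by apply: contra zu; rewrite subr_eq0 => /eqP ->.
apply/seteqP; split=> w [c _ <-].
  by exists (a + c * (b - a)) => //; apply: eq_coord; rewrite !coordE; ring.
exists ((c - a) / (b - a)) => //.
have -> : x + b *: (y - x) - (x + a *: (y - x)) = (b - a) *: (y - x).
  by apply: eq_coord; rewrite !coordE; ring.
by rewrite scalerA divfK//; apply: eq_coord; rewrite !coordE; ring.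
Qed.

Lemma through_rays p u j k s t (r1 r2 : R) : 0 <= s <= 1 -> 0 <= t <= 1 -> 0 < r1 -> 0 < r2 ->
  side_pt P j s = p + r1 *: u -> side_pt P k t = p - r2 *: u ->
  through p j k s t (r1 / (r1 + r2)).
Proof.
move=> hs ht r10 r20 e1 e2; have r12 : 0 < r1 + r2 by rewrite addr_gt0.
split => //.
  apply/andP; split; first by apply: divr_ge0; apply: ltW.
  by rewrite ler_pdivrMr// mul1r lerDl ltW.
rewrite e1 e2.
have -> : p - r2 *: u - (p + r1 *: u) = - (r1 + r2) *: u.
  by apply: eq_coord; rewrite !coordE; ring.
by rewrite scalerA mulrN divfK ?gt_eqF// scaleNr addrK.
Qed.

(** The two opposite rays from [p] supply the ends of the chord, and by [two_points] the line has no
    other boundary points, so the set defining [Phi] is one line. *)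
Lemma pencil_through p L : inner p -> pencil p L ->
  exists j k s t r, [/\ through p j k s t r, L = line_thru (side_pt P j s) (side_pt P k t)
    & Phi P L = line_thru (side_pt P (opp_idx j) s) (side_pt P (opp_idx k) t)].
Proof.
move=> hp [a [b [ab LE Lp]]]; have [c _ pE] : line_thru a b p by rewrite -LE.
have u0 : b - a != 0 by rewrite subr_eq0 eq_sym.
have u0' : - (b - a) != 0 by rewrite oppr_eq0.
have [j [s [r1 [hs r10 e1]]]] := ray_exists hp u0.
have [k [t [r2 [ht r20 e2]]]] := ray_exists hp u0'.
rewrite scalerN in e2.
have h := through_rays hs ht r10 r20 e1 e2.
exists j, k, s, t, (r1 / (r1 + r2)).
have LE' : L = line_thru (side_pt P j s) (side_pt P k t).
  rewrite LE; symmetry; apply: line_thru_eq (through_ends hp h).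
    by exists (c + r1) => //; rewrite e1 -pE scalerDl addrA.
  by exists (c - r2) => //; rewrite e2 -pE scalerBl addrA.
split => //; apply/seteqP; split=> z.
  move=> [x [y [xy [Lx bx] [Ly byy] hz]]].
  have ends w : L w -> boundary P w -> w = side_pt P j s \/ w = side_pt P k t.
    rewrite LE' => -[q _ wE] [l [v [hv wE']]]; rewrite wE'; apply: (two_points hp h) => //.
    by rewrite -wE' -wE det2_line.
  case: (ends _ Lx bx) (ends _ Ly byy) xy hz => -> [] ->; rewrite ?eqxx// => _.
    by rewrite !sigmaE.
  by rewrite !sigmaE// line_thru_sym.
move=> hz; exists (side_pt P j s), (side_pt P k t); rewrite !sigmaE//; split => //.
- by have := through_ends hp h.
- split; first by rewrite LE'; exact: line_thru_l.
  by exists j, s.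
- split; first by rewrite LE'; exact: line_thru_r.
  by exists k, t.
Qed.

Lemma chord_line p th j k s t r (c : R) : inner p -> through p j k s t r ->
  line_thru (side_pt P (opp_idx j) s) (side_pt P (opp_idx k) t) = normal_line p th c <->
  chord p th j k s t r /\ c = dot2 (nvec th) (side_pt P (opp_idx j) s - p).
Proof.
move=> hp h; rewrite line_normal; first by split=> [[h1 h2]|[[_ h1] h2]].
by have := through_img hp h; rewrite /imgvec subr_eq0.
Qed.

Lemma chord_pencil p th j k s t r : inner p -> chord p th j k s t r ->
  let L := line_thru (side_pt P j s) (side_pt P k t) in
  pencil p L /\ Phi P L = normal_line p th (dot2 (nvec th) (side_pt P (opp_idx j) s - p)).
Proof.
move=> hp h /=; have ht := h.1; have := through_ends hp ht; set L := line_thru _ _ => ne.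
have hL : pencil p L.
  exists (side_pt P j s), (side_pt P k t); split => //.
  by case: ht => _ _ _ ->; exists r.
split => //; have [j2 [k2 [s2 [t2 [r2 [h2 LE ->]]]]]] := pencil_through hp hL.
have e l (w : R) : 0 <= w <= 1 -> L (side_pt P l w) ->
    side_pt P l w = side_pt P j s \/ side_pt P l w = side_pt P k t.
  move=> hw [q _ wE]; apply: (two_points hp ht) => //.
  by rewrite -wE det2_line.
have := through_ends hp h2.
case: (h2) (ht) => hs2 ht2 _ _ [hs htt _ _].
have := e j2 _ hs2; have := e k2 _ ht2.
rewrite LE => /(_ (line_thru_r _ _)) e1 /(_ (line_thru_l _ _)) e2.
case: e1 e2 => e1 [] e2; rewrite e1 e2 ?eqxx// => _.
  rewrite (side_pt_opp hs2 htt e2) (side_pt_opp ht2 hs e1) line_thru_sym.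
  exact/(chord_line _ _ hp ht).
rewrite (side_pt_opp hs2 hs e2) (side_pt_opp ht2 htt e1).
exact/(chord_line _ _ hp ht).
Qed.

Lemma chord_level p th j k s t r j2 k2 s2 t2 r2 : inner p ->
  chord p th j k s t r -> chord p th j2 k2 s2 t2 r2 ->
  dot2 (nvec th) (side_pt P (opp_idx j2) s2 - p) = dot2 (nvec th) (side_pt P (opp_idx j) s - p).
Proof.
move=> hp h h2; have := chord_unique hp h h2.
case: (h) (h2) => [[hs ht _ _] e] [[hs2 ht2 _ _] _].
case=> -[e1 _]; first by rewrite (side_pt_opp hs2 hs e1).
by rewrite (side_pt_opp hs2 ht e1); move: e; rewrite /imgvec !dot2Br; lra.
Qed.

(** Uniqueness of the chord makes the set in the definition of [qfun] a singleton, so the default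
    value is never taken. *)
Lemma qfunE p th j k s t r : inner p -> chord p th j k s t r ->
  qfun P p th = dot2 (nvec th) (side_pt P (opp_idx j) s - p).
Proof.
move=> hp h; have [hL hPhi] := chord_pencil hp h.
rewrite /qfun; apply: xget_unique; first by exists (line_thru (side_pt P j s) (side_pt P k t)).
move=> c [L pL e]; have [j2 [k2 [s2 [t2 [r2 [h2 _ e2]]]]]] := pencil_through hp pL.
move: e; rewrite e2 => /(chord_line _ _ hp h2) [h3 ->].
exact: chord_level hp h h3.
Qed.

Lemma transitionE p th : inner p ->
  transition P p th <-> exists i k t r, chord p th i k 0 t r.
Proof.
move=> hp; split.
  move=> [L [pL [i Li] e]]; have [j [k [s [t [r [h LE e2]]]]]] := pencil_through hp pL.
  have := (chord_line th (qfun P p th) hp h); rewrite -e2 => /iffLR /(_ e) [hc _].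
  have hi : side_pt P i 0 = side_pt P j s \/ side_pt P i 0 = side_pt P k t.
    apply: (two_points hp h) => //.
    move: Li; rewrite LE side_pt0 => -[q _ <-].
    by rewrite det2_line.
  have [[hs ht hr pE] hn] := hc.
  case: hi => hi; [exists i, k, t, r | exists i, j, s, (1 - r)].
    split; first by split => //; rewrite hi.
    by rewrite /imgvec (side_pt_opp cls0 hs hi).
  have [[? ? ? pE'] hn'] := chord_sym hc.
  split; first by split => //; rewrite hi.
  by rewrite /imgvec (side_pt_opp cls0 ht hi).
move=> [i [k [t [r h]]]]; have [hL hPhi] := chord_pencil hp h.
exists (line_thru (side_pt P i 0) (side_pt P k t)); split => //.
  by exists i; rewrite side_pt0; exact: line_thru_l.
by rewrite (qfunE hp h).
Qed.

(** * Continuity of chords in the angle *)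

Let K1 : set R := `[0, 1]%classic.
Let compactK1 : compact K1. Proof. exact: segment_compact. Qed.
Let inK1 s : K1 s = (0 <= s <= 1) :> Prop.
Proof. by rewrite /K1 /= in_itv. Qed.

Lemma for_side (T : topologicalType) (z : T) i (f : T -> R) :
  {for z, continuous f} -> {for z, continuous (fun w => side_pt P i (f w))}.
Proof. by move=> hf; rewrite /side_pt; cont. Qed.

Lemma for_height (T : topologicalType) (z : T) i (f : T -> R * R) :
  {for z, continuous f} -> {for z, continuous (fun w => height i (f w))}.
Proof. by move=> hf; rewrite /height; cont. Qed.

Ltac cont2 :=
  lazymatch goal with
  | |- prop_for _ (@inPhantom (continuous ?f)) =>
    lazymatch f with
    | (fun w => side_pt _ _ _) => apply: for_side
    | (fun w => height _ _) => apply: for_height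
    end
  end.
Ltac cont ::= repeat (cont2 || cont1 || assumption).

(** [S] is [sigma] of the exit point of the ray, given by a relation so that the choice of side at a
    vertex is immaterial. Being on the closed ray is a closed condition on the parameter in [0, 1],
    and for the limit direction it determines the image. *)
Lemma ray_img_continuous p (S : R -> R * R) : inner p ->
  (forall phi, exists i s, [/\ 0 <= s <= 1, S phi = side_pt P (opp_idx i) s &
     exists2 r, 0 < r & side_pt P i s = p + r *: nvec phi]) -> continuous S.
Proof.
move=> hp hS; suff key (phi0 : R) (e : R) : 0 < e -> \forall phi \near phi0, `|S phi0 - S phi| < e.
  by move=> phi0; apply/cvgrPdist_lt => e; exact: key.
move=> e0.
have [i0 [s0 [hs0 SE [r0 r00 e00]]]] := hS phi0.
suff H i : \forall phi \near phi0, forall s, K1 s ->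
    det2 (nvec phi) (side_pt P i s - p) = 0 /\ 0 <= dot2 (nvec phi) (side_pt P i s - p) ->
    `|side_pt P (opp_idx i) s - S phi0| < e.
  apply: (filterS _ (near_forall H)) => phi h; have [i [s [hs -> [r r0' e']]]] := hS phi.
  rewrite distrC; apply: h; first by rewrite inK1.
  rewrite e' [p + _]addrC addrK det2Zr det2xx mulr0; split => //.
  rewrite dot2Zr; apply: mulr_ge0; first exact: ltW.
  by rewrite /dot2 /= cs1.
apply: (@near_tube _ _ _ (nbhs phi0)
  (fun phi s => det2 (nvec phi) (side_pt P i s - p) = 0 /\ 0 <= dot2 (nvec phi) (side_pt P i s - p))
  (fun phi s => `|side_pt P (opp_idx i) s - S phi0| < e) _ compactK1) => s; rewrite inK1 => hs.
have [d0|d0] := eqVneq (det2 (nvec phi0) (side_pt P i s - p)) 0; last first.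
  left; have : \forall w \near (s, phi0), det2 (nvec w.2) (side_pt P i w.1 - p) != 0.
    by apply: for_neq0_near; [cont | exact: d0].
  by apply: filterS => -[a b] /= /eqP h [].
have [d1|d1] := ltP (dot2 (nvec phi0) (side_pt P i s - p)) 0.
  left; have : \forall w \near (s, phi0), 0 < - dot2 (nvec w.2) (side_pt P i w.1 - p).
    by apply: for_gt0_near; [cont | rewrite oppr_gt0].
  by apply: filterS => -[a b] /=; rewrite oppr_gt0 => h [_]; rewrite leNgt h.
right; have : \forall w \near (s, phi0), `|side_pt P (opp_idx i) w.1 - S phi0| < e.
  apply: for_near_lt => //; first by cont.
  have [c cE] := det2_col (nvec_neq0 phi0) d0.
  have c0 : 0 <= c by move: d1; rewrite cE dot2Zr /dot2 /= cs1 mulr1.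
  have zE : side_pt P i s = p + c *: nvec phi0 by rewrite -cE addrC subrK.
  have c1 : 0 < c.
    rewrite lt_neqAle c0 andbT eq_sym; apply/eqP => c00.
    by apply: (@inner_side i s); rewrite zE c00 scale0r addr0.
  have cr := ray_unique hp hs hs0 c1 r00 zE e00.
  by rewrite SE /=; apply: side_pt_opp => //; rewrite zE cr -e00.
by apply: filterS => -[a b].
Qed.

(** The normal component of [S phi - S (phi + pi)] is reversed when [phi] advances by [pi]; at a
    zero the chord in direction [phi] has an image normal to [nvec th]. *)
Lemma chord_exists p th : inner p -> exists j k s t r, chord p th j k s t r.
Proof.
move=> hp; have [f hf] := choice (fun phi => ray_exists hp (nvec_neq0 phi)).
have [g hg] := choice hf; have [q hq] := choice hg.
pose S phi := side_pt P (opp_idx (f phi)) (g phi).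
have cS : continuous S.
  apply: (ray_img_continuous hp) => phi; exists (f phi), (g phi).
  by case: (hq phi) => h1 h2 h3; split => //; exists (q phi).
have S2 : S (pi + pi) = S 0.
  rewrite /S; case: (hq (pi + pi)) => h1 h2 h3; case: (hq 0) => h1' h2' h3'.
  have E : nvec (pi + pi) = nvec 0 :> R * R.
    by rewrite -[pi + pi]add0r addrA !nvecDpi opprK.
  rewrite E in h3; apply: side_pt_opp => //.
  by rewrite h3 h3' (ray_unique hp h1 h1' h2 h2' h3 h3').
have := @IVT R (fun phi => dot2 (nvec th) (S phi - S (phi + pi))) 0 pi 0 (pi_ge0 R).
have c1 : {within `[0, (pi : R)], continuous fun phi => dot2 (nvec th) (S phi - S (phi + pi))}.
  apply: continuous_subspaceT => phi.
  have h1 : {for phi, continuous S} by exact: cS.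
  have h2 : {for phi, continuous (fun w => S (w + pi))}.
    by apply: (for_comp cS); cont.
  by cont.
move=> /(_ c1); rewrite add0r S2 => h.
have [|phi _ e] := h.
  rewrite ge_min le_max !dot2Br; case: (leP (dot2 (nvec th) (S 0)) (dot2 (nvec th) (S pi))) => h'.
    by apply/andP; split; apply/orP; [left|right]; lra.
  by apply/andP; split; apply/orP; [right|left]; lra.
have [h1 h2 h3] := hq phi; have [h1' h2' h3'] := hq (phi + pi).
rewrite nvecDpi scalerN in h3'.
exists (f phi), (f (phi + pi)), (g phi), (g (phi + pi)), (q phi / (q phi + q (phi + pi))).
by split => //; exact: through_rays h1 h1' h2 h2' h3 h3'.
Qed.

Lemma for_chord1 j k (w : (R * R * R) * ((R * R) * R)) : {for w, continuous (fun w : (R * R * R) * ((R * R) * R) =>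
  w.2.1 - (side_pt P j w.1.1.1 + w.1.2 *: (side_pt P k w.1.1.2 - side_pt P j w.1.1.1)))}.
Proof.
by cont.
Qed.

Lemma for_chord2 j k (w : (R * R * R) * ((R * R) * R)) : {for w, continuous (fun w : (R * R * R) * ((R * R) * R) =>
  dot2 (nvec w.2.2) (imgvec j k w.1.1.1 w.1.1.2))}.
Proof.
by rewrite /imgvec; cont.
Qed.

Let K3 : set (R * R * R) := (K1 `*` K1) `*` K1.
Let compactK3 : compact K3.
Proof. by apply: compact_setX => //; apply: compact_setX. Qed.

(** The chord relation is closed and its parameters range over a compact cube, so [G] has to be
    checked only around chords of the limit position. This includes [p0] on the boundary, where the
    limits of the theorem are taken. *)
Lemma chord_tube p0 th0 j k (G : (R * R) * R -> R * R * R -> Prop) :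
  (forall s t r, chord p0 th0 j k s t r ->
     \forall a \near ((s, t, r) : R * R * R) & z \near (p0, th0), G z a) ->
  \forall z \near (p0, th0), forall s t r, chord z.1 z.2 j k s t r -> G z (s, t, r).
Proof.
move=> hG.
have : \forall z \near (p0, th0), forall a, K3 a -> chord z.1 z.2 j k a.1.1 a.1.2 a.2 -> G z a.
  apply: (@near_tube _ K3 _ (nbhs (p0, th0))
    (fun z : (R * R) * R => fun a => chord z.1 z.2 j k a.1.1 a.1.2 a.2) G
    _ compactK3) => -[[s t] r] [[/= ]]; rewrite !inK1 => hs ht hr.
  set D1 := p0 - (side_pt P j s + r *: (side_pt P k t - side_pt P j s)).
  have [d1|d1] := eqVneq D1 0; last first.
    left; have := for_neq0_near (@for_chord1 j k ((s, t, r), (p0, th0))) d1.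
    by apply: filterS => -[[[a b] c] [z1 z2]] /= /eqP h [[_ _ _ e] _]; apply: h; rewrite -e subrr.
  have [d2|d2] := eqVneq (dot2 (nvec th0) (imgvec j k s t)) 0; last first.
    left; have := for_neq0_near (@for_chord2 j k ((s, t, r), (p0, th0))) d2.
    by apply: filterS => -[[[a b] c] [z1 z2]] /= /eqP h [].
  right; apply: hG; split=> //; split=> //.
  by apply: subr0_eq.
apply: filterS => z h s t r hc; apply: (h (s, t, r)) => //.
by case: hc => -[hs ht hr _] _; split; [split|]; rewrite /= inK1.
Qed.

Lemma through_tube p0 j k (G : R * R -> R * R * R -> Prop) :
  (forall s t r, through p0 j k s t r ->
     \forall a \near ((s, t, r) : R * R * R) & z \near p0, G z a) ->
  \forall z \near p0, forall s t r, through z j k s t r -> G z (s, t, r).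
Proof.
move=> hG.
have : \forall z \near p0, forall a, K3 a -> through z j k a.1.1 a.1.2 a.2 -> G z a.
  apply: (@near_tube _ K3 _ (nbhs p0) (fun (z : R * R) a => through z j k a.1.1 a.1.2 a.2) G
    _ compactK3) => -[[s t] r] [[/= ]]; rewrite !inK1 => hs ht hr.
  set D1 := p0 - (side_pt P j s + r *: (side_pt P k t - side_pt P j s)).
  have [d1|d1] := eqVneq D1 0; last first.
    left; have c1 : {for ((s, t, r), p0), continuous (fun w : (R * R * R) * (R * R) =>
        w.2 - (side_pt P j w.1.1.1 + w.1.2 *: (side_pt P k w.1.1.2 - side_pt P j w.1.1.1)))}.
      by cont.
    have := for_neq0_near c1 d1.
    by apply: filterS => -[[[a b] c] z1] /= /eqP h [_ _ _ e]; apply: h; rewrite -e subrr.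
  right; apply: hG; split=> //.
  by apply: subr0_eq.
apply: filterS => z h s t r hc; apply: (h (s, t, r)) => //.
by case: hc => hs ht hr _; split; [split|]; rewrite /= inK1.
Qed.

Lemma chord_tube_th p th0 j k (G : R -> R * R * R -> Prop) :
  (forall s t r, chord p th0 j k s t r ->
     \forall a \near ((s, t, r) : R * R * R) & th \near th0, G th a) ->
  \forall th \near th0, forall s t r, chord p th j k s t r -> G th (s, t, r).
Proof.
move=> hG; have := @chord_tube p th0 j k (fun z : (R * R) * R => G z.2).
have h1 : forall s t r, chord p th0 j k s t r ->
    \forall a \near ((s, t, r) : R * R * R) & z \near (p, th0), G z.2 a.
  move=> s t r /hG h.
  have c1 : {for ((s, t, r), (p, th0)), continuous (fun w : (R * R * R) * ((R * R) * R) => (w.1, w.2.2))}.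
    by cont.
  exact: (c1 _ h).
move=> /(_ h1) h2.
have c2 : {for th0, continuous (fun th : R => (p, th))} by cont.
exact: (c2 _ h2).
Qed.

Lemma qfun_continuous p : inner p -> continuous (qfun P p).
Proof.
move=> hp; suff key (th0 : R) (e : R) : 0 < e ->
    \forall th \near th0, `|qfun P p th0 - qfun P p th| < e.
  by move=> th0; apply/cvgrPdist_lt => e; exact: key.
move=> e0.
have H j k : \forall th \near th0, forall s t r, chord p th j k s t r ->
    `|dot2 (nvec th) (side_pt P (opp_idx j) s - p) - qfun P p th0| < e.
  apply: (@chord_tube_th p th0 j k (fun th a => `|dot2 (nvec th) (side_pt P (opp_idx j) a.1.1 - p) - qfun P p th0| < e)).
  move=> s t r h.
  have c1 : {for ((s, t, r), th0), continuous (fun w : (R * R * R) * R =>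
      dot2 (nvec w.2) (side_pt P (opp_idx j) w.1.1.1 - p))} by cont.
  have := for_near_lt c1 e0 (esym (qfunE hp h)).
  by apply: filterS => -[].
apply: (filterS _ (near_forall2 H)) => th h.
have [j [k [s [t [r hc]]]]] := chord_exists th hp.
by rewrite distrC (qfunE hp hc); exact: h hc.
Qed.

Lemma chord_reindex p th j k s t r j' s' : 0 <= s' <= 1 -> side_pt P j' s' = side_pt P j s ->
  chord p th j k s t r -> chord p th j' k s' t r.
Proof.
move=> hs' e [[hs ht hr pE] hn]; split; first by split=> //; rewrite e.
by rewrite /imgvec (side_pt_opp hs' hs e).
Qed.

Lemma side_pt_interior j j2 s s2 : 0 < s < 1 -> 0 <= s2 <= 1 ->
  side_pt P j2 s2 = side_pt P j s -> j2 = j /\ s2 = s.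
Proof.
move=> /andP[s0 s1] hs2 e; have [jj|jj] := eqVneq j2 j.
  by move: e; rewrite jj => /side_pt_inj ->.
have hs : 0 <= s <= 1 by rewrite !ltW.
have h0 : height j2 (side_pt P j s) = 0 by rewrite -e height_own.
have jj' : j != j2 by rewrite eq_sym.
by case: (height_side_eq0 hs jj' h0) => -[_ sE]; move: s0 s1; rewrite sE ltxx.
Qed.

(** * Cells and transitions of the pencil at an inner point *)

Section InnerAngles.
Context {p : R * R} (hp : inner p).

Lemma chord_open th j k s t r : ~ transition P p th -> chord p th j k s t r ->
  0 < s < 1 /\ 0 < t < 1.
Proof.
move=> nt.
suff main j' k' s' t' r' : chord p th j' k' s' t' r' -> 0 < s' < 1.
  by move=> h; split; [exact: main h | exact: (main _ _ _ _ _ (chord_sym h))].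
move=> h; have [[/andP[s0 s1] _ _ _] _] := h.
rewrite !lt_neqAle s0 s1 !andbT eq_sym; apply/andP; split; apply/eqP => sE; apply: nt.
  by apply/(transitionE _ hp); exists j', k', t', r'; rewrite -sE.
apply/(transitionE _ hp); exists (j' + 1), k', t', r'.
by apply: chord_reindex h => //; rewrite sE side_pt0 side_pt1.
Qed.

Lemma chord_sides th j k s t r j2 k2 s2 t2 r2 : 0 < s < 1 -> 0 < t < 1 ->
  chord p th j k s t r -> chord p th j2 k2 s2 t2 r2 ->
  (j2 = j /\ k2 = k) \/ (j2 = k /\ k2 = j).
Proof.
move=> hs ht h h2; have [[hs2 ht2 _ _] _] := h2.
case: (chord_unique hp h h2) => -[e1 e2].
  by left; have [] := side_pt_interior hs hs2 e1; have [] := side_pt_interior ht ht2 e2.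
by right; have [] := side_pt_interior ht hs2 e1; have [] := side_pt_interior hs ht2 e2.
Qed.

Lemma chord_not_transition th j k s t r : 0 < s < 1 -> 0 < t < 1 ->
  chord p th j k s t r -> ~ transition P p th.
Proof.
move=> hs ht h /(transitionE _ hp) [i [k2 [t2 [r2 h2]]]].
have [[hs2 ht2 _ _] _] := h2.
case: (chord_unique hp h h2) => -[e1 e2].
  by have [_ sE] := side_pt_interior hs hs2 e1; rewrite -sE ltxx in hs.
by have [_ sE] := side_pt_interior ht hs2 e1; rewrite -sE ltxx in ht.
Qed.

(** A closed cell: the sides include their ends, so several pairs of sides share a transition
    angle. *)
Definition cell j k : set R := [set th | exists s t r, chord p th j k s t r].

Lemma cell_sym j k th : cell j k th -> cell k j th.
Proof. by move=> [s [t [r h]]]; exists t, s, (1 - r); exact: chord_sym. Qed.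

Lemma cell_closed j k : closed (cell j k).
Proof.
rewrite -openC openE => th0 /= h.
have H : \forall th \near th0, forall s t r, chord p th j k s t r -> False.
  by apply: (@chord_tube_th p th0 j k (fun _ _ => False)) => s t r hc; case: h; exists s, t, r.
by rewrite /interior /=; apply: filterS H => th /= h' [s [t [r hc]]]; exact: h' hc.
Qed.

(** Away from transitions every chord at [th0] joins the same two sides at points inside them; by
    compactness this pair of sides persists nearby. *)
Lemma cell_near j k th0 : ~ transition P p th0 -> cell j k th0 -> \forall th \near th0, cell j k th.
Proof.
move=> nt [s [t [r h]]]; have [hs ht] := chord_open nt h.
have H l (m : 'Z_(n.*2)) : \forall th \near th0, forall s' t' r', chord p th l m s' t' r' ->
    (l = j /\ m = k) \/ (l = k /\ m = j).
  apply: (@chord_tube_th p th0 l m (fun _ _ => (l = j /\ m = k) \/ (l = k /\ m = j))) => s' t' r' h'.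
  by apply: filterE => _; exact: (chord_sides hs ht h h').
apply: (filterS _ (near_forall2 H)) => th h'.
have [l [m [s' [t' [r' hc]]]]] := chord_exists th hp.
case: (h' _ _ _ _ _ hc) => -[e1 e2]; subst; first by exists s', t', r'.
by apply: cell_sym; exists s', t', r'.
Qed.

(** Between transitions a cell is both open and closed, so it fills the interval by connectedness;
    its ends follow by closedness. *)
Lemma cell_interval (a b c : R) j k : a < c < b ->
  (forall th, a < th < b -> ~ transition P p th) -> cell j k c ->
  forall th, a <= th <= b -> cell j k th.
Proof.
move=> /andP[ac cb] nt hc.
have hI : `]a, b[%classic `&` cell j k = `]a, b[%classic.
  have : connected (`]a, b[%classic : set R) by apply/connected_intervalP/interval_is_interval.
  apply.
  - by exists c; split => //=; rewrite in_itv /= ac.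
  - exists (cell j k)°; first exact: open_interior.
    apply/seteqP; split=> th [h1 h2]; split => //.
      by apply: cell_near => //; apply: nt; move: h1; rewrite /= in_itv.
    exact: interior_subset h2.
  - by exists (cell j k) => //; exact: cell_closed.
have hin th : a < th < b -> cell j k th.
  by move=> h; have [] : (`]a, b[%classic `&` cell j k) th by rewrite hI /= in_itv.
move=> th /andP[]; rewrite le_eqVlt => /orP[/eqP <- _|ath].
  apply: cell_closed => B /nbhs_ballP [e /= e0 he].
  have m0 : 0 < Num.min (e / 2) (c - a) by rewrite lt_min divr_gt0// subr_gt0.
  exists (a + Num.min (e / 2) (c - a)); split.
    apply: hin; rewrite ltrDl m0 /=; apply: le_lt_trans cb.
    by rewrite -lerBrDl ge_min lexx orbT.
  apply: he; rewrite /ball /= opprD addNKr normrN gtr0_norm// gt_min; apply/orP; left.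
  by rewrite ltr_pdivrMr// ltr_pMr// ltr1n.
rewrite le_eqVlt => /orP[/eqP ->|thb]; last by apply: hin; rewrite ath.
apply: cell_closed => B /nbhs_ballP [e /= e0 he].
have m0 : 0 < Num.min (e / 2) (b - c) by rewrite lt_min divr_gt0// subr_gt0.
exists (b - Num.min (e / 2) (b - c)); split.
  apply: hin; rewrite ltrBlDr ltrDl m0 andbT; apply: lt_le_trans ac _.
  by rewrite lerBrDr -lerBrDl ge_min lexx orbT.
apply: he; rewrite /ball /= opprB addrCA subrr addr0 gtr0_norm// gt_min; apply/orP; left.
by rewrite ltr_pdivrMr// ltr_pMr// ltr1n.
Qed.

Lemma chordDpi th j k s t r : chord p (th + pi) j k s t r <-> chord p th j k s t r.
Proof.
rewrite /chord nvecDpi.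
have -> : dot2 (- nvec th) (imgvec j k s t) = - dot2 (nvec th) (imgvec j k s t).
  by rewrite /dot2 !coordE; ring.
split=> -[h e]; split => //; last by rewrite e oppr0.
by rewrite -[LHS]opprK e oppr0.
Qed.

Lemma transitionDpi th : transition P p (th + pi) <-> transition P p th.
Proof.
split=> /(transitionE _ hp) [i [k [t [r h]]]]; apply/(transitionE _ hp); exists i, k, t, r.
  exact/chordDpi.
exact/chordDpi.
Qed.

Lemma qfunDpi th : qfun P p (th + pi) = - qfun P p th.
Proof.
have [j [k [s [t [r h]]]]] := chord_exists th hp.
rewrite (qfunE hp h); have /chordDpi h2 := h; rewrite (qfunE hp h2) nvecDpi.
by rewrite /dot2 !coordE; ring.
Qed.

End InnerAngles.

Section InnerTransitions.
Context {p : R * R} (hp : inner p).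

Definition vertex_chord i th := exists k t r, chord p th i k 0 t r.

Lemma transition_vertex th : transition P p th <-> exists i, vertex_chord i th.
Proof. by rewrite (transitionE th hp); split=> -[i [k [t [r h]]]]; exists i; exists k, t, r. Qed.

(** The vertex and [p] determine the chord, hence its image, so all angles of the same vertex are
    normal to one vector. *)
Lemma vertex_chord_line i th th' k t r : chord p th i k 0 t r -> vertex_chord i th' ->
  dot2 (nvec th') (imgvec i k 0 t) = 0.
Proof.
move=> [h _] [k' [t' [r' [h' e']]]].
have [_ ht _ pE] := h; have [_ ht' _ pE'] := h'.
have /andP[r0 _] := through_r hp h; have /andP[r0' _] := through_r hp h'.
have col : det2 (side_pt P k t - side_pt P i 0) (side_pt P k' t' - side_pt P i 0) = 0.
  have E : r' *: (side_pt P k' t' - side_pt P i 0) = r *: (side_pt P k t - side_pt P i 0).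
    by apply: (addrI (side_pt P i 0)); rewrite -pE -pE'.
  have := congr1 (det2 (side_pt P k t - side_pt P i 0)) E.
  by rewrite !det2Zr det2xx mulr0 => /eqP; rewrite mulf_eq0 gt_eqF//= => /eqP.
have [e|e] := two_points hp h ht' col.
  by have := through_ends hp h'; rewrite e eqxx.
by move: e'; rewrite /imgvec (side_pt_opp ht' ht e).
Qed.

Lemma vertex_chord_eq i (a th th' : R) : a <= th < a + pi -> a <= th' < a + pi ->
  vertex_chord i th -> vertex_chord i th' -> th' = th.
Proof.
move=> h h' [k [t [r hc]]] hv; have [h1 h2] := hc.
exact: nvec_perp_eq (through_img hp h1) h h' h2 (vertex_chord_line hc hv).
Qed.

Lemma vertex_chord_exists i (a : R) : exists2 th, a <= th < a + pi & vertex_chord i th.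
Proof.
have u0 : p - P i != 0.
  rewrite subr_eq0; apply/eqP => e.
  by apply: (@inner_side i 0); rewrite side_pt0 -e.
have [k [t [r [ht r0 e]]]] := ray_exists hp u0.
have h : through p i k 0 t (1 / (1 + r)).
  apply: (@through_rays p (P i - p)) => //; first by rewrite side_pt0 scale1r addrC subrK.
  by rewrite e -scalerN opprB.
have [th hth e'] := exists_perp a (imgvec i k 0 t).
by exists th => //; exists k, t, (1 / (1 + r)).
Qed.

(** Within a period each vertex yields one transition, so one angle per index exhausts them. *)
Lemma transition_seq (a : R) : exists l : seq R,
  forall th, a <= th < a + pi -> transition P p th -> th \in l.
Proof.
pose F i := xget 0 [set th | a <= th < a + pi /\ vertex_chord i th].
exists (codom F).
move=> th h /transition_vertex [i hi]; have <- : F i = th; last exact: codom_f.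
by apply: xget_unique => //= th' [h1 h2]; exact: vertex_chord_eq h h1 hi h2.
Qed.

End InnerTransitions.

(** * The envelope inside a cell *)

(* Weights locating the envelope point on the image chord: the normal velocities
   of its two endpoints, up to a common factor. *)
Definition wgt1 j k s t r := (1 - r) * height j (side_pt P k t) * height (opp_idx k) (side_pt P (opp_idx j) s).
Definition wgt2 j k s t r := r * height k (side_pt P j s) * height (opp_idx j) (side_pt P (opp_idx k) t).
Definition env_pt j k s t r :=
  (wgt1 j k s t r + wgt2 j k s t r)^-1 *:
    (wgt1 j k s t r *: side_pt P (opp_idx j) s + wgt2 j k s t r *: side_pt P (opp_idx k) t).

Section CellEnvelope.
Context {p : R * R} (hp : inner p).

Lemma through_heights j k s t r : through p j k s t r ->
  0 < height j (side_pt P k t) /\ 0 < height (opp_idx j) (side_pt P (opp_idx k) t).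
Proof.
move=> h; have /andP[r0 r1] := through_r hp h; split.
  have := hp j; case: h => _ _ _ ->; rewrite height_aff height_own mulr0 add0r.
  by rewrite pmulr_rgt0.
have := img_inner hp h (opp_idx j); rewrite height_aff height_own mulr0 add0r.
by rewrite pmulr_rgt0.
Qed.

Lemma weights_gt0 j k s t r : through p j k s t r -> 0 < wgt1 j k s t r /\ 0 < wgt2 j k s t r.
Proof.
move=> h; have /andP[r0 r1] := through_r hp h.
have [h1 h2] := through_heights h; have [h3 h4] := through_heights (through_sym h).
by split; rewrite /wgt1 /wgt2; repeat (apply: mulr_gt0 => //); rewrite subr_gt0.
Qed.

(** The image vector is [w *: tvec th], so the height of each image end over the side of the other
    is, up to sign, [w] times the normal component of that side. The factor [w] is common to both
    weights of [env_pt] and cancels there. *)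
Lemma chord_heights th j k s t r : chord p th j k s t r ->
  let w := dot2 (tvec th) (imgvec j k s t) in
  [/\ w != 0, height (opp_idx k) (side_pt P (opp_idx j) s) = w * dot2 (nvec th) (edge P (opp_idx k))
  & height (opp_idx j) (side_pt P (opp_idx k) t) = - (w * dot2 (nvec th) (edge P (opp_idx j)))].
Proof.
move=> [h hn] w; have := nvec_perp hn; rewrite -/w => e; split.
- by apply: contra (through_img hp h) => /eqP w0; rewrite e w0 scale0r.
- rewrite -det2_tvec -det2Zr -e /imgvec -[LHS]subr0 -[X in _ - X](height_own (opp_idx k) t).
  by rewrite /height /det2 !coordE; ring.
rewrite -det2_tvec -det2Zr -e /imgvec -[LHS]subr0 -[X in _ - X](height_own (opp_idx j) s).
by rewrite /height /det2 !coordE; ring.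
Qed.

Lemma chord_dot_neq0 th j k s t r : chord p th j k s t r ->
  dot2 (nvec th) (edge P (opp_idx j)) != 0.
Proof.
move=> h; have [w0 _ e] := chord_heights h; have [_ h2] := through_heights h.1.
by apply/eqP => e'; move: h2; rewrite e e' mulr0 oppr0 ltxx.
Qed.

(** The parameter at which the image line of angle [th] meets the line of the opposite of side [j];
    it makes the end of the chord explicit in terms of [qfun]. *)
Definition sfun j th : R :=
  (qfun P p th - dot2 (nvec th) (P (opp_idx j) - p)) / dot2 (nvec th) (edge P (opp_idx j)).

Lemma sfunE th j k s t r : chord p th j k s t r -> sfun j th = s.
Proof.
move=> h; have d0 := chord_dot_neq0 h; apply: (mulIf d0).
by rewrite /sfun divfK// (qfunE hp h) /side_pt /dot2 !coordE; ring.
Qed.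

(** The weights divided by the common factor [w], with [r] eliminated through the heights of [p]:
    what remains depends on the angle alone. *)
Definition cwgt1 j k th :=
  (height j (side_pt P k (sfun k th)) - height j p) * dot2 (nvec th) (edge P (opp_idx k)).
Definition cwgt2 j k th :=
  - ((height k (side_pt P j (sfun j th)) - height k p) * dot2 (nvec th) (edge P (opp_idx j))).
Definition cell_env j k th : R * R :=
  (cwgt1 j k th + cwgt2 j k th)^-1 *:
    (cwgt1 j k th *: side_pt P (opp_idx j) (sfun j th) + cwgt2 j k th *: side_pt P (opp_idx k) (sfun k th)).

Lemma chord_weights th j k s t r : chord p th j k s t r ->
  exists2 w : R, w != 0 & wgt1 j k s t r = w * cwgt1 j k th /\ wgt2 j k s t r = w * cwgt2 j k th.
Proof.
move=> h; have [w0 e1 e2] := chord_heights h; exists (dot2 (tvec th) (imgvec j k s t)) => //.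
have [[_ _ _ pE] _] := h.
have hj : height j p = r * height j (side_pt P k t).
  by rewrite pE height_aff height_own mulr0 add0r.
have hk : height k p = (1 - r) * height k (side_pt P j s).
  by rewrite pE height_aff height_own mulr0 addr0.
rewrite /cwgt1 /cwgt2 (sfunE h) (sfunE (chord_sym h)) /wgt1 /wgt2 e1 e2 hj hk.
by split; ring.
Qed.

Lemma cwgt_neq0 th j k : cell (p:=p) j k th -> cwgt1 j k th + cwgt2 j k th != 0.
Proof.
move=> [s [t [r h]]]; have [w w0 [e1 e2]] := chord_weights h.
have [h1 h2] := weights_gt0 h.1.
apply/eqP => e; have := addr_gt0 h1 h2.
by rewrite e1 e2 -mulrDr e mulr0 ltxx.
Qed.

Lemma cell_envE th j k s t r : chord p th j k s t r -> cell_env j k th = env_pt j k s t r.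
Proof.
move=> h; have [w w0 [e1 e2]] := chord_weights h.
rewrite /cell_env /env_pt (sfunE h) (sfunE (chord_sym h)) e1 e2 -mulrDr invfM.
have E (u v a b : R) (x y : R * R) : u != 0 ->
    v *: (a *: x + b *: y) = (u^-1 * v) *: ((u * a) *: x + (u * b) *: y).
  move=> u0; rewrite -!(scalerA u) -scalerDr scalerA -mulrA [v * u]mulrC mulrA mulVf//.
  by rewrite mul1r.
exact: E.
Qed.

Lemma cell_env_level th j k : cell (p:=p) j k th -> dot2 (nvec th) (cell_env j k th - p) = qfun P p th.
Proof.
move=> hc; have c0 := cwgt_neq0 hc; case: hc => s [t [r h]].
rewrite dot2Br /cell_env dot2Zr dot2Dr !dot2Zr (sfunE h) (sfunE (chord_sym h)).
have h1 := qfunE hp h; have h2 := qfunE hp (chord_sym h).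
rewrite dot2Br in h1; rewrite dot2Br in h2.
have -> : dot2 (nvec th) (side_pt P (opp_idx j) s) = qfun P p th + dot2 (nvec th) p by rewrite h1 subrK.
have -> : dot2 (nvec th) (side_pt P (opp_idx k) t) = qfun P p th + dot2 (nvec th) p by rewrite h2 subrK.
by rewrite -mulrDl mulKf// addrK.
Qed.

(* Letting [th] tend to [th0] gives the derivative of [qfun]: the weights [a] and [b]
   depend continuously on [th]. *)
Lemma secant th0 th j k s0 t0 r0 s t r :
  chord p th0 j k s0 t0 r0 -> chord p th j k s t r ->
  let a := (height j (side_pt P k t) - height j p) * dot2 (nvec th) (edge P (opp_idx k)) in
  let b := - ((height k (side_pt P j s0) - height k p) * dot2 (nvec th) (edge P (opp_idx j))) in
  (a + b) * (qfun P p th - qfun P p th0) =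
    a * dot2 (nvec th - nvec th0) (side_pt P (opp_idx j) s0 - p) +
    b * dot2 (nvec th - nvec th0) (side_pt P (opp_idx k) t0 - p).
Proof.
move=> h0 h a b.
have collinear s' t' r' : through p j k s' t' r' ->
    det2 (side_pt P j s' - p) (side_pt P k t' - p) = 0.
  by move=> [_ _ _ ->]; rewrite /det2 !coordE; ring.
have c0 := collinear _ _ _ h0.1; have c1 := collinear _ _ _ h.1.
have h01 := qfunE hp h0; have h02 := qfunE hp (chord_sym h0).
have h11 := qfunE hp h; have h12 := qfunE hp (chord_sym h).
have -> : (a + b) * (qfun P p th - qfun P p th0) =
  a * (dot2 (nvec th) (side_pt P (opp_idx j) s - p) - dot2 (nvec th0) (side_pt P (opp_idx j) s0 - p)) +
  b * (dot2 (nvec th) (side_pt P (opp_idx k) t - p) - dot2 (nvec th0) (side_pt P (opp_idx k) t0 - p)).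
  by rewrite -h01 -h02 -h11 -h12; ring.
have dz : det2 (side_pt P j s - p) (side_pt P k t - p) - det2 (side_pt P j s0 - p) (side_pt P k t0 - p) = 0.
  by rewrite c0 c1 subrr.
apply: subr0_eq.
(* The two sides differ by the product of the normal components times the difference of two
   collinearity determinants, both zero. *)
have -> : 0 = dot2 (nvec th) (edge P (opp_idx j)) * dot2 (nvec th) (edge P (opp_idx k)) *
  (det2 (side_pt P j s - p) (side_pt P k t - p) - det2 (side_pt P j s0 - p) (side_pt P k t0 - p)) :> R.
  by rewrite dz mulr0.
rewrite /a /b /height /side_pt /dot2 /det2 !coordE; ring.
Qed.

Lemma sfun_continuous th j k : cell (p:=p) j k th -> {for th, continuous (sfun j)}.
Proof.
move=> [s [t [r h]]]; have d0 := chord_dot_neq0 h.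
have hq : {for th, continuous (qfun P p)} by exact: qfun_continuous hp _.
rewrite /sfun; apply: forM; first by cont.
by apply: forV; [exact: d0 | cont].
Qed.

(** The filter is left arbitrary so that one proof serves the derivative inside a cell and the two
    one-sided derivatives at its ends. *)
Lemma qfun_quot th j k (F : set_system R) {FF : ProperFilter F} :
  cell (p:=p) j k th -> F `=>` (0 : R)^' -> (\forall h \near F, cell (p:=p) j k (th + h)) ->
  h^-1 * (qfun P p (th + h) - qfun P p th) @[h --> F] --> dot2 (tvec th) (cell_env j k th - p).
Proof.
move=> hc F0 hF; have cn0 := cwgt_neq0 hc; have [s0 [t0 [r0 h0]]] := hc.
pose a h := cwgt1 j k (th + h).
(* The height stays at the old parameter [s0] while the normal moves: these are the weights for
   which the secant identity is exact. *)
pose gb (x : R) := - ((height k (side_pt P j s0) - height k p) * dot2 (nvec x) (edge P (opp_idx j))).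
pose b h := gb (th + h).
have shift_cvg (f : R -> R) : {for th, continuous f} -> f (th + h) @[h --> F] --> f th.
  move=> cf; have c1 : {for 0, continuous (fun h : R => th + h)} by cont.
  have c2 : f (th + h) @[h --> (0 : R)] --> f th.
    apply: (@cvg_comp _ _ _ (fun h => th + h) f _ (nbhs th)); last exact: cf.
    by have := c1; rewrite /prop_for /continuous_at addr0.
  by apply: cvg_trans c2; apply: cvg_app => B hB; apply: F0; exact: (@nbhs_dnbhs _ (0 : R) B hB).
have hsk := sfun_continuous (cell_sym hc).
have a_cvg : a h @[h --> F] --> cwgt1 j k th.
  by have := shift_cvg (cwgt1 j k); apply; rewrite /cwgt1; cont.
have b_cvg : b h @[h --> F] --> cwgt2 j k th.
  rewrite /cwgt2 (sfunE h0).
  by have := shift_cvg gb; apply; rewrite /gb; cont.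
have n_cvg u : h^-1 * dot2 (nvec (th + h) - nvec th) u @[h --> F] --> dot2 (tvec th) u.
  have -> : (fun h => h^-1 * dot2 (nvec (th + h) - nvec th) u) =
      (fun h => (h^-1 * (cos (th + h) - cos th)) * u.1 + (h^-1 * (sin (th + h) - sin th)) * u.2).
    by apply/funext => h; rewrite /dot2 /= ; ring.
  rewrite /dot2 /=; apply: cvgD; apply: cvgM; try exact: cvg_cst.
    by apply: cvg_trans (@cos_quot R th); exact: cvg_app.
  by apply: cvg_trans (@sin_quot R th); exact: cvg_app.
have lim1 : (a h + b h)^-1 * (a h * (h^-1 * dot2 (nvec (th + h) - nvec th) (side_pt P (opp_idx j) s0 - p)) +
    b h * (h^-1 * dot2 (nvec (th + h) - nvec th) (side_pt P (opp_idx k) t0 - p))) @[h --> F] -->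
   (cwgt1 j k th + cwgt2 j k th)^-1 * (cwgt1 j k th * dot2 (tvec th) (side_pt P (opp_idx j) s0 - p) +
    cwgt2 j k th * dot2 (tvec th) (side_pt P (opp_idx k) t0 - p)).
  apply: cvgM; first by apply: cvgV => //; exact: cvgD.
  by apply: cvgD; apply: cvgM.
have -> : dot2 (tvec th) (cell_env j k th - p) =
   (cwgt1 j k th + cwgt2 j k th)^-1 * (cwgt1 j k th * dot2 (tvec th) (side_pt P (opp_idx j) s0 - p) +
    cwgt2 j k th * dot2 (tvec th) (side_pt P (opp_idx k) t0 - p)).
  rewrite /cell_env (sfunE h0) (sfunE (chord_sym h0)); move: cn0.
  move: (cwgt1 _ _ _) (cwgt2 _ _ _) => u v uv; rewrite /dot2 !coordE.
  by field.
apply: cvg_trans lim1; apply: near_eq_cvg.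
have ab0 : \forall h \near F, a h + b h != 0.
  by apply: cvgr_neq0; first exact: (cvgD a_cvg b_cvg).
near=> h.
have hn0 : a h + b h != 0 by near: h.
have [s [t [r hh]]] : cell (p:=p) j k (th + h) by near: h.
have e : (a h + b h) * (qfun P p (th + h) - qfun P p th) =
    a h * dot2 (nvec (th + h) - nvec th) (side_pt P (opp_idx j) s0 - p) +
    b h * dot2 (nvec (th + h) - nvec th) (side_pt P (opp_idx k) t0 - p).
  by have := secant h0 hh; rewrite /a /cwgt1 (sfunE (chord_sym hh)) /b /gb.
apply: (mulfI hn0); rewrite mulrA mulfV// mul1r.
by rewrite [RHS]mulrCA e; ring.
Unshelve. all: by end_near.
Qed.

End CellEnvelope.

Section CellFacts.
Context {p : R * R} (hp : inner p).
Local Notation q := (qfun P p).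
Local Notation cell := (cell (p := p)).
Local Notation cell_env := (cell_env (p := p)).

Lemma interval_cell (a b : R) : a < b -> (forall th, a < th < b -> ~ transition P p th) ->
  exists j k, forall th, a <= th <= b -> cell j k th.
Proof.
move=> ab nt; have [j [k [s [t [r h]]]]] := chord_exists ((a + b) / 2) hp.
exists j, k; apply: (cell_interval hp _ nt) (_ : cell j k ((a + b) / 2)).
  by apply/andP; split; lra.
by exists s, t, r.
Qed.

Lemma cell_env_class (a b : R) j k (A : (R -> R) -> Prop) : rational_class a b A -> A q ->
  (forall th, a <= th <= b -> cell j k th) -> vclass (A := A) (cell_env j k).
Proof.
move=> hA hq hc.
have sA l (m : 'Z_(n.*2)) : (forall th, a <= th <= b -> cell l m th) -> A (sfun (p := p) l).
  move=> hl; apply: (rc_div hA) => [th /hl [s [t [r h]]]||].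
  - exact: (chord_dot_neq0 hp h).
  - apply: (rc_add hA) => //; apply: (rc_opp hA).
    exact: (class_dot2 hA (vclass_nvec hA) (vclass_cst hA _)).
  - exact: (class_dot2 hA (vclass_nvec hA) (vclass_cst hA _)).
have sj := sA j k hc; have sk := sA k j (fun th h => cell_sym (hc th h)).
have side i (f : R -> R) : A f -> vclass (A := A) (fun th => side_pt P i (f th)).
  move=> hf; apply: (vclass_add hA (vclass_cst hA _)).
  exact: (vclass_scale hA hf (vclass_cst hA _)).
have wA i l (f : R -> R) (m : 'Z_(n.*2)) : A f ->
    A (fun th => (height i (side_pt P l (f th)) - height i p) * dot2 (nvec th) (edge P m)).
  move=> hf; apply: (rc_mul hA); last exact: (class_dot2 hA (vclass_nvec hA) (vclass_cst hA _)).
  apply: (rc_add hA); last exact: rc_cst hA _.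
  apply: (class_det2 hA (vclass_cst hA _)).
  by apply: (vclass_add hA); [exact: side | exact: vclass_cst hA _].
have w1 : A (cwgt1 (p := p) j k) by exact: wA.
have w2 : A (cwgt2 (p := p) j k) by apply: (rc_opp hA); exact: wA.
apply: (vclass_scale hA).
  apply: (rc_inv hA); last exact: (rc_add hA w1 w2).
  by move=> th /hc; exact: cwgt_neq0.
by apply: (vclass_add hA); apply: (vclass_scale hA) => //; exact: side.
Qed.

Lemma qfun_C0 (a b : R) : C0 a b q.
Proof. by move=> x _; exact: qfun_continuous. Qed.

Lemma level_env (th : R) X (d : R) : dot2 (nvec th) (X - p) = q th -> d = dot2 (tvec th) (X - p) ->
  p + q th *: nvec th + d *: tvec th = X.
Proof. by move=> <- ->; rewrite -addrA -frame addrC subrK. Qed.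

Lemma envelopeE th j k : ~ transition P p th -> cell j k th ->
  envelope P p th = cell_env j k th /\
  is_derive th 1 q (dot2 (tvec th) (cell_env j k th - p)).
Proof.
move=> nt hc.
have hd : is_derive th 1 q (dot2 (tvec th) (cell_env j k th - p)).
  apply/quotP; apply: (qfun_quot hp hc) => //.
  have c1 : {for 0, continuous (fun h : R => th + h)} by cont.
  have : \forall h \near (0 : R), cell j k (th + h).
    by apply: (c1 (cell j k)); rewrite addr0; exact: cell_near.
  exact: nbhs_dnbhs.
split => //; rewrite /envelope (derive1_val hd).
by apply: level_env => //; exact: cell_env_level.
Qed.

Lemma right_dnbhs : (0 : R)^'+ `=>` (0 : R)^'.
Proof.
move=> B; rewrite /at_right /dnbhs /within /=; apply: filterS => y hy y0.
by apply: hy; rewrite gt_eqF.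
Qed.

Lemma left_dnbhs : (0 : R)^'- `=>` (0 : R)^'.
Proof.
move=> B; rewrite /at_left /dnbhs /within /=; apply: filterS => y hy y0.
by apply: hy; rewrite lt_eqF.
Qed.

Lemma envelope_rightE (th b : R) j k : th < b -> (forall x : R, th <= x <= b -> cell j k x) ->
  envelope_right P p th = cell_env j k th.
Proof.
move=> tb hc; have hth : cell j k th by apply: hc; rewrite lexx ltW.
rewrite /envelope_right; apply: level_env; first exact: cell_env_level.
apply: cvg_lim => //; apply: (qfun_quot hp hth); first exact: right_dnbhs.
near=> h; have h0 : 0 < h by near: h; exact: nbhs_right_gt.
have hb : h < b - th by near: h; apply: nbhs_right_lt; rewrite subr_gt0.
by apply: hc; apply/andP; split; lra.
Unshelve. all: by end_near. Qed.

Lemma envelope_leftE (a th : R) j k : a < th -> (forall x : R, a <= x <= th -> cell j k x) ->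
  envelope_left P p th = cell_env j k th.
Proof.
move=> tb hc; have hth : cell j k th by apply: hc; rewrite lexx ltW.
rewrite /envelope_left; apply: level_env; first exact: cell_env_level.
apply: cvg_lim => //; apply: (qfun_quot hp hth); first exact: left_dnbhs.
near=> h; have h0 : h < 0 by near: h; exact: nbhs_left_lt.
have hb : a - th < h by near: h; apply: nbhs_left_gt; rewrite subr_lt0.
by apply: hc; apply/andP; split; lra.
Unshelve. all: by end_near. Qed.

Lemma cell_env_C0 (a b : R) j k : (forall th, a <= th <= b -> cell j k th) ->
  vclass (A := C0 a b) (cell_env j k).
Proof. by apply: cell_env_class; [exact: C0_rational | exact: qfun_C0]. Qed.

(** A bootstrap: continuity of [qfun] makes [cell_env] continuous, [cell_env] gives the derivative
    of [qfun], and [cell_env_C1] then feeds this back into the same rational expression. *)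
Lemma qfun_C1 (a b : R) j k : (forall th, a < th < b -> ~ transition P p th) ->
  (forall th, a <= th <= b -> cell j k th) -> C1 a b q.
Proof.
move=> nt hc; exists (fun th => dot2 (tvec th) (cell_env j k th - p)); split.
- exact: qfun_C0.
- have hA := C0_rational a b; apply: (class_dot2 hA (vclass_tvec hA)).
  by apply: (vclass_add hA); [exact: cell_env_C0 | exact: vclass_cst hA _].
- move=> th hth; have [|_ //] := @envelopeE th j k (nt _ hth).
  by apply: hc; move/andP: hth => [? ?]; rewrite !ltW.
Qed.

Lemma cell_env_C1 (a b : R) j k : (forall th, a < th < b -> ~ transition P p th) ->
  (forall th, a <= th <= b -> cell j k th) -> vclass (A := C1 a b) (cell_env j k).
Proof. by move=> nt hc; apply: (cell_env_class (C1_rational a b)) => //; exact: qfun_C1 nt hc. Qed.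

(* A primitive of [det2 X X' - (q ^+ 2 - q' ^+ 2)], where [X] is the envelope. *)
Definition area_prim th (Z : R * R) : R :=
  (q th + dot2 (nvec th) p) * dot2 (tvec th) (Z - p) - q th * dot2 (tvec th) p.

Definition area_density th : R :=
  dot2 (nvec th) (envelope P p th - p) ^+ 2 - dot2 (tvec th) (envelope P p th - p) ^+ 2.

(** Integration by parts on a cell; the one-sided envelope points enter as the end values of the
    continuous [cell_env]. The integral of the density is returned as [v] so that cells can be added
    up. *)
Lemma cell_area (a b : R) : a < b -> (forall th, a < th < b -> ~ transition P p th) ->
  exists v : R, has_int area_density a b v /\
    has_int (fun th => det2 (envelope P p th) (derive1 (envelope P p) th)) a b
      (v + (area_prim b (envelope_left P p b) - area_prim a (envelope_right P p a))).
Proof.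
move=> ab nt; have [j [k hc]] := interval_cell ab nt.
have ioc (x : R) : a < x < b -> a <= x <= b by move=> /andP[? ?]; rewrite !ltW.
have he th : a < th < b -> envelope P p th = cell_env j k th.
  by move=> hth; have [] := envelopeE (nt _ hth) (hc _ (ioc _ hth)).
have hr := envelope_rightE ab hc; have hl := envelope_leftE ab hc.
have level th : a <= th <= b -> dot2 (nvec th) (cell_env j k th - p) = q th.
  by move=> /hc; exact: cell_env_level.
have dq th : a < th < b -> is_derive th 1 q (dot2 (tvec th) (cell_env j k th - p)).
  by move=> hth; have [] := envelopeE (nt _ hth) (hc _ (ioc _ hth)).
have [[x1 [cX1 cx1 dX1]] [x2 [cX2 cx2 dX2]]] := cell_env_C1 nt hc.
set X := cell_env j k in he hr hl level dq cX1 dX1 cX2 dX2; clearbody X.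
have hA := C0_rational a b.
have vX : vclass (A := C0 a b) X by split.
have vX' : vclass (A := C0 a b) (fun th => (x1 th, x2 th)) by split.
have vn := vclass_nvec hA; have vt := vclass_tvec hA.
have cq : C0 a b q := @qfun_C0 a b.
have vXp : vclass (A := C0 a b) (fun th => X th - p).
  by apply: (vclass_add hA) => //; exact: vclass_cst hA _.
pose f th := (dot2 (nvec th) (X th - p) * dot2 (nvec th) (X th - p)) + - (dot2 (tvec th) (X th - p) * dot2 (tvec th) (X th - p)).
have cf : C0 a b f.
  by apply: (rc_add hA); [|apply: (rc_opp hA)]; apply: (rc_mul hA); exact: (class_dot2 hA).
pose F th := area_prim th (X th).
have cF : C0 a b F.
  apply: (rc_add hA); [|apply: (rc_opp hA)]; apply: (rc_mul hA) => //.
  - by apply: (rc_add hA) => //; apply: (class_dot2 hA vn); exact: vclass_cst hA _.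
  - exact: (class_dot2 hA).
  - by apply: (class_dot2 hA vt); exact: vclass_cst hA _.
pose g th := det2 (X th) (x1 th, x2 th) + - f th.
have cg : C0 a b g.
  by apply: (rc_add hA); [exact: (class_det2 hA) | exact: (rc_opp hA)].
(* Differentiating the level identity and comparing with the known derivative of [qfun] leaves no
   normal component: the envelope moves along its line. *)
have perp th : a < th < b -> dot2 (nvec th) (x1 th, x2 th) = 0.
  move=> hth.
  have d1 : is_derive th 1 (fun y : R => dot2 (nvec y) (X y - p))
      (dot2 (tvec th) (X th - p) + dot2 (nvec th) (x1 th, x2 th)).
    have dX1' := dX1 _ hth; have dX2' := dX2 _ hth.
    rewrite /dot2 /=; apply: is_derive_eq.
    rewrite /GRing.scale /=; ring.
  have d2 := dq _ hth.
  have near_eq : \forall y \near th, dot2 (nvec y) (X y - p) = q y.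
    have : \forall y \near th, y \in `]a, b[ by apply: near_in_itvoo; rewrite in_itv.
    by apply: filterS => y; rewrite in_itv /= => hy; apply: level; exact: ioc.
  have [_ e1] := is_derive_near near_eq d1; have [_ e2] := d2.
  by move: e1; rewrite e2 => e; apply: (addrI (dot2 (tvec th) (X th - p))); rewrite addr0.
have dF th : a < th < b -> is_derive th 1 F (g th).
  move=> hth; have dX1' := dX1 _ hth; have dX2' := dX2 _ hth; have dq' := dq _ hth.
  rewrite /F /area_prim /dot2 /=; apply: is_derive_eq.
  have hl' := level _ (ioc _ hth); have hp1 := nvec_perp (perp _ hth).
  set W := dot2 (tvec th) (X th - p); set lam := dot2 (tvec th) (x1 th, x2 th) in hp1.
  have XE : X th = p + (q th *: nvec th + W *: tvec th) by rewrite -hl' -frame addrC subrK.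
  have -> : g th = det2 (X th) (x1 th, x2 th) + - (q th * q th + - (W * W)) by rewrite /g /f hl'.
  have e1 : x1 th = lam * - sin th by move: hp1 => [].
  have e2 : x2 th = lam * cos th by move: hp1 => [].
  rewrite XE e1 e2 /det2 !coordE /GRing.scale /=.
  apply: subr0_eq.
  transitivity ((cos th * cos th + sin th * sin th - 1) *
    ((q th + (cos th * p.1 + sin th * p.2)) * (lam - q th) +
     W * (W + (- sin th * p.1 + cos th * p.2)) - lam * q th)).
    ring.
  by rewrite cs1 subrr mul0r.
exists (\int[lebesgue_measure]_(x in `[a, b]) f x); split.
  apply: has_int_eq (has_int_C0 cf) => th hth.
  by rewrite /area_density he// !expr2.
have -> : area_prim b (envelope_left P p b) - area_prim a (envelope_right P p a) = F b - F a.
  by rewrite hl hr.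
apply: has_int_eq (has_int_add (has_int_C0 cf) (has_int_FTC ab cg cF dF)) => th hth.
rewrite /g addrC subrK he//; congr (det2 _ _); symmetry.
have hX : is_derive th 1 X (x1 th, x2 th).
  apply/quotP.
  have /quotP h1 := dX1 _ hth; have /quotP h2 := dX2 _ hth.
  exact: (cvg_pair h1 h2).
apply: derive1_val; apply: is_derive_near hX.
have : \forall y \near th, y \in `]a, b[ by apply: near_in_itvoo; rewrite in_itv.
by apply: filterS => y; rewrite in_itv /= => hy; rewrite he.
Qed.

End CellFacts.

(** * The area as an integral *)

Section AreaFormula.
Context {p : R * R} (hp : inner p).
Local Notation q := (qfun P p).
Local Notation cell := (cell (p := p)).
Local Notation cell_env := (cell_env (p := p)).
Local Notation area_prim := (area_prim (p := p)).
Local Notation area_density := (area_density (p := p)).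

Lemma prev_transition (th : R) : exists2 a, th - pi <= a < th &
  transition P p a /\ forall x : R, a < x < th -> ~ transition P p x.
Proof.
have [l hl] := transition_seq hp (th - pi); rewrite subrK in hl.
apply: (last_before hl); have [x hx hv] := vertex_chord_exists hp 0 (th - pi).
by rewrite subrK in hx; exists x => //; apply/(transition_vertex hp); exists 0.
Qed.

Lemma next_transition (th : R) : exists2 b, th < b <= th + pi &
  transition P p b /\ forall x : R, th < x < b -> ~ transition P p x.
Proof.
have [l hl] := transition_seq hp th.
apply: (@first_after _ (transition P p) (th + pi) th ((th + pi) :: l)).
  move=> x /andP[h1 h2] hx; rewrite in_cons; have [//|ne] := eqVneq x (th + pi).
  by apply: hl => //; rewrite ltW//= lt_neqAle ne.
have [x /andP[hx1 hx2] hv] := vertex_chord_exists hp 0 th.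
have [e|ne] := eqVneq x th; last first.
  exists x; last by apply/(transition_vertex hp); exists 0.
  by rewrite ltW// andbT lt_neqAle eq_sym ne.
exists (th + pi); first by rewrite lexx ltrDl pi_gt0.
by apply/(transitionDpi hp)/(transition_vertex hp); exists 0; rewrite -e.
Qed.

Lemma cellDpi j k th : cell j k (th + pi) <-> cell j k th.
Proof. by split=> -[s [t [r h]]]; exists s, t, r; exact/chordDpi. Qed.

Lemma cell_envDpi j k th : cell j k th -> cell_env j k (th + pi) = cell_env j k th.
Proof.
move=> [s [t [r h]]]; rewrite (cell_envE hp h).
by have /chordDpi h' := h; rewrite (cell_envE hp h').
Qed.

Lemma cell_left (th : R) : exists a j k, [/\ a < th, th - pi <= a,
  forall x : R, a < x < th -> ~ transition P p x & forall x : R, a <= x <= th -> cell j k x].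
Proof.
have [a /andP[a1 a2] [_ nt]] := prev_transition th.
by have [j [k hc]] := interval_cell hp a2 nt; exists a, j, k.
Qed.

Lemma cell_right (th : R) : exists b j k, [/\ th < b, b <= th + pi,
  forall x : R, th < x < b -> ~ transition P p x & forall x : R, th <= x <= b -> cell j k x].
Proof.
have [b /andP[b1 b2] [_ nt]] := next_transition th.
by have [j [k hc]] := interval_cell hp b1 nt; exists b, j, k.
Qed.

Lemma envelope_leftDpi th : envelope_left P p (th + pi) = envelope_left P p th.
Proof.
have [a [j [k [ath _ _ hc]]]] := cell_left th.
rewrite (envelope_leftE hp ath hc).
have hc' (x : R) : a + pi <= x <= th + pi -> cell j k x.
  by move=> hx; rewrite -[x](subrK pi); apply/cellDpi; apply: hc; lra.
have ath' : a + pi < th + pi by rewrite ltrD2r.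
rewrite (envelope_leftE hp ath' hc'); apply: cell_envDpi; apply: hc.
by rewrite lexx ltW.
Qed.

Lemma envelope_rightDpi th : envelope_right P p (th + pi) = envelope_right P p th.
Proof.
have [b [j [k [thb _ _ hc]]]] := cell_right th.
rewrite (envelope_rightE hp thb hc).
have hc' (x : R) : th + pi <= x <= b + pi -> cell j k x.
  by move=> hx; rewrite -[x](subrK pi); apply/cellDpi; apply: hc; lra.
have thb' : th + pi < b + pi by rewrite ltrD2r.
rewrite (envelope_rightE hp thb' hc'); apply: cell_envDpi; apply: hc.
by rewrite lexx ltW.
Qed.

Lemma envelope_sides th : ~ transition P p th ->
  envelope_left P p th = envelope P p th /\ envelope_right P p th = envelope P p th.
Proof.
move=> nt; have [a [_ [_ [ath _ nta _]]]] := cell_left th.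
have [b [_ [_ [thb _ ntb _]]]] := cell_right th.
have ntab (x : R) : a < x < b -> ~ transition P p x.
  move=> /andP[h1 h2]; case: (ltgtP x th) => h; [apply: nta|apply: ntb|by rewrite h].
    by rewrite h1.
  by rewrite h2 h.
have [j [k hc]] := interval_cell hp (lt_trans ath thb) ntab.
have hcl (x : R) : a <= x <= th -> cell j k x by move=> hx; apply: hc; lra.
have hcr (x : R) : th <= x <= b -> cell j k x by move=> hx; apply: hc; lra.
rewrite (envelope_leftE hp ath hcl) (envelope_rightE hp thb hcr).
have hth : cell j k th by apply: hc; rewrite !ltW.
by have [-> _] := envelopeE hp nt hth.
Qed.

(** Both points have the same level on the line of normal [nvec th] and differ along [tvec th] only,
    so the identity reduces to cos^2 + sin^2 = 1. *)
Lemma area_prim_jump th : area_prim th (envelope_right P p th) - area_prim th (envelope_left P p th) =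
  det2 (envelope_left P p th) (envelope_right P p th).
Proof.
rewrite /area_prim /envelope_left /envelope_right.
move: (right_deriv _ _) (left_deriv _ _) => r l.
apply: subr0_eq; rewrite /det2 /dot2 !coordE /=.
transitivity ((cos th * cos th + sin th * sin th - 1) * (cos th * p.1 + sin th * p.2) * (r - l)).
  ring.
by rewrite cs1 subrr !mul0r.
Qed.

Definition jump th : R := det2 (envelope_left P p th) (envelope_right P p th).

Lemma transition_finite (a b : R) : b <= a + pi -> finite_set (`]a, b[%classic `&` transition P p).
Proof.
move=> hab; have [l hl] := transition_seq hp a.
apply: sub_finite_set (finite_seq l) => x [/=]; rewrite in_itv /= => /andP[h1 h2] hx.
by apply: hl => //; rewrite ltW//= (lt_le_trans h2).
Qed.

(** The jumps are summed over the open interval, with one-sided points at its ends. When two pieces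
    meet at [d], the boundary terms left over are exactly the jump at [d]. *)
Lemma area_pieces : exists v : R, has_int area_density 0 pi v /\
  has_int (fun th => det2 (envelope P p th) (derive1 (envelope P p) th)) 0 pi
    (v + (area_prim pi (envelope_left P p pi) - area_prim 0 (envelope_right P p 0))
       - \sum_(t \in `]0, pi[%classic `&` transition P p) jump t).
Proof.
have [l hl] := transition_seq hp 0; rewrite add0r in hl.
pose Q (a b : R) := exists v : R, has_int area_density a b v /\
  has_int (fun th => det2 (envelope P p th) (derive1 (envelope P p) th)) a b
    (v + (area_prim b (envelope_left P p b) - area_prim a (envelope_right P p a))
       - \sum_(t \in `]a, b[%classic `&` transition P p) jump t).
apply: (@interval_ind _ (transition P p) Q 0 pi l (pi_gt0 R)).
- by move=> th /andP[h1 h2]; apply: hl; rewrite ltW.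
- move=> a b _ ab _ nt; have [v [h1 h2]] := cell_area hp ab nt.
  exists v; split => //.
  have -> : `]a, b[%classic `&` transition P p = set0.
    by apply/seteqP; split=> x // [/=]; rewrite in_itv /= => /nt.
  by rewrite fsbig_set0 subr0.
move=> a d b a0 ad db bpi Sd [v [h1 h2]] [w [h3 h4]].
exists (v + w); split; first exact: has_int_cat (ltW ad) (ltW db) h1 h3.
have := has_int_cat (ltW ad) (ltW db) h2 h4; congr has_int.
have -> : `]a, b[%classic `&` transition P p =
    (`]a, d[%classic `&` transition P p) `|` ([set d] `|` (`]d, b[%classic `&` transition P p)).
  apply/seteqP; split=> x /=; rewrite !in_itv /=.
    move=> [/andP[h5 h6] h7]; case: (ltgtP x d) => h; first by left; rewrite h5.
      by right; right; rewrite h6.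
    by right; left.
  move=> [[/andP[h5 h6] h7]|[->|[/andP[h5 h6] h7]]]; split => //.
  - by rewrite h5 (lt_trans h6).
  - by rewrite ad.
  - by rewrite h6 (lt_trans ad).
have f1 : finite_set (`]a, d[%classic `&` transition P p) by apply: transition_finite; lra.
have f2 : finite_set (`]d, b[%classic `&` transition P p) by apply: transition_finite; lra.
rewrite fsbigU//; last 2 first.
- by rewrite finite_setU; split => //; exact: finite_set1.
- move=> x [[/=]]; rewrite !in_itv /= => /andP[h5 h6] _ [e|[/andP[h7 _] _]].
    by move: h6; rewrite e ltxx.
  by move: h6; rewrite ltNge (ltW h7).
rewrite fsbigU//; last by move=> x [/= ->]; rewrite in_itv /= ltxx => -[].
by rewrite fsbig_set1 /= /jump -area_prim_jump; ring.
Qed.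

Lemma area_formula :
  has_int area_density 0 pi (\int[lebesgue_measure]_(x in `[0, pi]) area_density x) /\
  ART_area P p = 2^-1 * \int[lebesgue_measure]_(x in `[0, pi]) area_density x.
Proof.
have [v [h1 h2]] := area_pieces; case: (h1) => _ h1v; rewrite h1v; split => //.
rewrite /ART_area; case: h2 => _ ->; congr (_ * _).
(* [qfun], [nvec] and [tvec] change sign over a half turn while the envelope point returns; every
   term of [area_prim] has two such factors. *)
have per : area_prim pi (envelope_left P p pi) = area_prim 0 (envelope_left P p 0).
  have := envelope_leftDpi 0; rewrite add0r => ->.
  rewrite /area_prim -[X in q X](add0r pi) (qfunDpi hp) -[X in nvec X](add0r pi) nvecDpi.
  rewrite -[X in tvec X](add0r pi) tvecDpi.
  by rewrite /dot2 !coordE; ring.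
rewrite per.
have f0 : finite_set (`]0, (pi : R)[%classic `&` transition P p) by apply: transition_finite; rewrite add0r.
(* The sum in [ART_area] counts a transition at 0 and not at [pi]. If 0 is one, the remaining
   boundary terms are its jump; otherwise the one-sided points agree and these terms cancel. *)
have [S0|nS0] := pselect (transition P p 0).
  have -> : `[0, (pi : R)[%classic `&` transition P p = [set 0] `|` (`]0, (pi : R)[%classic `&` transition P p).
    apply/seteqP; split=> x /=; rewrite !in_itv /=.
      move=> [/andP[]]; rewrite le_eqVlt => /orP[/eqP <-|h] h3 h4; [by left|right].
      by rewrite h h3.
    move=> [->|[/andP[h3 h4] h5]]; first by rewrite lexx pi_gt0.
    by rewrite ltW.
  rewrite fsbigU//; last by move=> x [/= ->]; rewrite in_itv /= ltxx => -[].
  by rewrite fsbig_set1 /= /jump -area_prim_jump; ring.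
have -> : `[0, (pi : R)[%classic `&` transition P p = `]0, (pi : R)[%classic `&` transition P p.
  apply/seteqP; split=> x /=; rewrite !in_itv /=.
    move=> [/andP[]]; rewrite le_eqVlt => /orP[/eqP <- //|h] h3 h4.
    by rewrite h h3.
  by move=> [/andP[h3 h4] h5]; rewrite ltW.
by have [-> ->] := envelope_sides nS0; rewrite /jump; ring.
Qed.

End AreaFormula.

(** * Envelope points near the boundary *)

Definition adjacent j k := (k == j + 1) || (j == k + 1).

Lemma adjacent_sym j k : adjacent j k = adjacent k j.
Proof. by rewrite /adjacent orbC. Qed.

Lemma adjacent_opp j k : adjacent (opp_idx j) (opp_idx k) = adjacent j k.
Proof. by rewrite /adjacent -!opp_idxD !(inj_eq (inv_inj (opp_idxK n1))). Qed.

(* On two adjacent sides [sigma] is affine, so all image lines of a pencil meet at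
   the image of its centre; this extends [env_pt] to chords whose weights vanish. *)
Definition env_lim j k s t r : R * R :=
  if adjacent j k
  then side_pt P (opp_idx j) s + r *: (side_pt P (opp_idx k) t - side_pt P (opp_idx j) s)
  else env_pt j k s t r.

Lemma height_side_gt0 j k t : j != k -> ~~ adjacent j k -> 0 <= t <= 1 -> 0 < height j (side_pt P k t).
Proof.
move=> jk adj ht; rewrite lt_neqAle height_side_ge0// andbT eq_sym; apply/eqP => h0.
have kj : k != j by rewrite eq_sym.
by move: adj; rewrite /adjacent; case: (height_side_eq0 ht kj h0) => -[-> _]; rewrite eqxx ?orbT.
Qed.

Lemma env_pt_sym j k s t r : env_pt k j t s (1 - r) = env_pt j k s t r.
Proof.
have w1 : wgt1 k j t s (1 - r) = wgt2 j k s t r by rewrite /wgt1 /wgt2; ring.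
have w2 : wgt2 k j t s (1 - r) = wgt1 j k s t r by rewrite /wgt1 /wgt2; ring.
by rewrite /env_pt w1 w2 [wgt2 _ _ _ _ _ + _]addrC [wgt2 _ _ _ _ _ *: _ + _]addrC.
Qed.

Lemma env_lim_sym j k s t r : env_lim k j t s (1 - r) = env_lim j k s t r.
Proof.
rewrite /env_lim adjacent_sym; case: ifP => _; last exact: env_pt_sym.
by apply: eq_coord; rewrite !coordE; ring.
Qed.

(** On consecutive sides both weights contain the factor t (1 - s) times two determinants of edges.
    It vanishes at the ends that give indeterminate weights; dividing it out leaves 1 - r and r. *)
Lemma env_pt_adjacent p j s t r : inner p -> through p j (j + 1) s t r ->
  env_pt j (j + 1) s t r = side_pt P (opp_idx j) s +
    r *: (side_pt P (opp_idx (j + 1)) t - side_pt P (opp_idx j) s).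
Proof.
move=> hp h; have [h1 h2] := weights_gt0 hp h.
have hj i t' : height i (side_pt P (i + 1) t') = t' * det2 (edge P i) (edge P (i + 1)).
  by rewrite /side_pt heightD height_P1 add0r det2Zr.
have hk i s' : height (i + 1) (side_pt P i s') = (1 - s') * det2 (edge P i) (edge P (i + 1)).
  have -> : side_pt P i s' = P (i + 1) + (s' - 1) *: edge P i.
    by rewrite /side_pt /edge; apply: eq_coord; rewrite !coordE; ring.
  by rewrite heightD height_P det2Zr det2C; ring.
have e1 : wgt1 j (j + 1) s t r = (1 - r) * (t * (1 - s) * det2 (edge P j) (edge P (j + 1)) *
    det2 (edge P (opp_idx j)) (edge P (opp_idx j + 1))).
  by rewrite /wgt1 opp_idxD hj hk; ring.
have e2 : wgt2 j (j + 1) s t r = r * (t * (1 - s) * det2 (edge P j) (edge P (j + 1)) *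
    det2 (edge P (opp_idx j)) (edge P (opp_idx j + 1))).
  by rewrite /wgt2 opp_idxD hj hk; ring.
rewrite /env_pt e1 e2; move: h1 h2; rewrite e1 e2; set W := (_ * _ * _ * _) => h1 h2.
have W0 : W != 0 by apply/eqP => W0; move: h1; rewrite W0 mulr0 ltxx.
have -> : (1 - r) * W + r * W = W by ring.
rewrite scalerDr !scalerA ![W^-1 * _]mulrC !mulfK//.
by apply: eq_coord; rewrite !coordE; ring.
Qed.

Lemma env_limE p j k s t r : inner p -> through p j k s t r -> env_lim j k s t r = env_pt j k s t r.
Proof.
move=> hp h; rewrite /env_lim; case: ifP => // /orP[/eqP e|/eqP e]; subst.
  by rewrite (env_pt_adjacent hp h).
rewrite -env_pt_sym (env_pt_adjacent hp (through_sym h)).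
by apply: eq_coord; rewrite !coordE; ring.
Qed.

Lemma weights_nonadjacent j k s t r : j != k -> ~~ adjacent j k ->
  0 <= s <= 1 -> 0 <= t <= 1 -> 0 <= r <= 1 ->
  exists a b : R, [/\ 0 < a, 0 < b, wgt1 j k s t r = (1 - r) * a & wgt2 j k s t r = r * b].
Proof.
move=> jk adj hs ht /andP[r0 r1].
have jk' : k != j by rewrite eq_sym.
have ojk : opp_idx j != opp_idx k by rewrite (inj_eq (inv_inj (opp_idxK n1))).
have okj : opp_idx k != opp_idx j by rewrite eq_sym.
exists (height j (side_pt P k t) * height (opp_idx k) (side_pt P (opp_idx j) s)).
exists (height k (side_pt P j s) * height (opp_idx j) (side_pt P (opp_idx k) t)).
split; last 2 first.
- by rewrite /wgt1 mulrA.
- by rewrite /wgt2 mulrA.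
- by apply: mulr_gt0; apply: height_side_gt0; rewrite // adjacent_opp adjacent_sym.
- by apply: mulr_gt0; apply: height_side_gt0; rewrite // ?adjacent_opp // adjacent_sym.
Qed.

(** For nonadjacent sides the denominator is (1 - r) a + r b with positive a and b, so it does not
    vanish anywhere on the closed cube. *)
Lemma env_lim_continuous j k s t r : j != k -> 0 <= s <= 1 -> 0 <= t <= 1 -> 0 <= r <= 1 ->
  {for ((s, t, r) : R * R * R), continuous (fun a : R * R * R => env_lim j k a.1.1 a.1.2 a.2)}.
Proof.
move=> jk hs ht hr; rewrite /env_lim; case adj: (adjacent j k); first by cont.
have [a [b [a0 b0 e1 e2]]] := weights_nonadjacent jk (negbT adj) hs ht hr.
have c1 : {for ((s, t, r) : R * R * R), continuous (fun a : R * R * R => wgt1 j k a.1.1 a.1.2 a.2)}.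
  by rewrite /wgt1; cont.
have c2 : {for ((s, t, r) : R * R * R), continuous (fun a : R * R * R => wgt2 j k a.1.1 a.1.2 a.2)}.
  by rewrite /wgt2; cont.
rewrite /env_pt; apply: forZ; last by cont.
apply: forV; last by cont.
rewrite /= e1 e2 gt_eqF//; move/andP: hr => [r0 r1].
have [r00|r00] := eqVneq r 0; first by rewrite r00 subr0 mul1r mul0r addr0.
apply: ltr_wpDl; first by apply: mulr_ge0; [rewrite subr_ge0 | exact: ltW].
by apply: mulr_gt0 => //; rewrite lt_neqAle eq_sym r00.
Qed.

(* A segment between two distinct sides through a boundary point [p0] either ends
   at [p0] or runs along the side of [p0]; the only exception to
   [env_lim = sigma p0] is the side joining its two neighbouring sides. *)
Lemma boundary_chord i (v : R) j k s t r : j != k -> 0 <= v <= 1 ->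
  through (side_pt P i v) j k s t r ->
  env_lim j k s t r = side_pt P (opp_idx i) v \/
  [/\ ~~ adjacent j k, 0 < r < 1 &
     (j = i + 1 /\ s = 0) /\ (i = k + 1 /\ t = 1) /\ v = 1 - r \/
     (k = i + 1 /\ t = 0) /\ (i = j + 1 /\ s = 1) /\ v = r].
Proof.
move=> jk hv h; have [hs ht /andP[r0 r1] pE] := h.
have ends0 j' k' s' t' : j' != k' -> through (side_pt P i v) j' k' s' t' 0 ->
    env_lim j' k' s' t' 0 = side_pt P (opp_idx i) v.
  move=> jk' [hs' ht' hr' pE']; rewrite scale0r addr0 in pE'.
  rewrite (side_pt_opp hv hs' pE') /env_lim; case: ifP => adj; first by rewrite scale0r addr0.
  have [a [b [a0 b0 e1 e2]]] := weights_nonadjacent jk' (negbT adj) hs' ht' hr'.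
  rewrite /env_pt e1 e2 subr0 mul1r mul0r addr0 scale0r addr0 scalerA mulVf ?scale1r//.
  by rewrite gt_eqF.
have [r00|r00] := eqVneq r 0; first by left; move: h; rewrite r00; exact: ends0.
have [r10|r10] := eqVneq r 1.
  left; rewrite -env_lim_sym; move: (through_sym h); rewrite r10 subrr.
  by apply: ends0; rewrite eq_sym.
have {}r0 : 0 < r by rewrite lt_neqAle eq_sym r00.
have {}r1 : r < 1 by rewrite lt_neqAle r10.
(* The height over side [i] vanishes at an interior point of the segment and is nonnegative at its
   ends, so both ends lie on side [i]. *)
have /eqP : height i (side_pt P i v) = 0 by rewrite height_own.
have hx := height_side_ge0 i j hs; have hy := height_side_ge0 i k ht.
have m1 : 0 <= (1 - r) * height i (side_pt P j s).
  by apply: mulr_ge0 => //; rewrite subr_ge0 ltW.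
have m2 : 0 <= r * height i (side_pt P k t) by apply: mulr_ge0 => //; exact: ltW.
rewrite pE height_aff paddr_eq0//.
rewrite !mulf_eq0 (gt_eqF r0) /= subr_eq0 (gt_eqF r1) /= => /andP[/eqP hx0 /eqP hy0].
have [a ha ea] := region_on_line (region_side _ hs) hx0.
have [b hb eb] := region_on_line (region_side _ ht) hy0.
have vE : v = a + r * (b - a).
  apply: (@side_pt_inj i); rewrite pE ea eb /side_pt; apply: eq_coord; rewrite !coordE; ring.
rewrite /env_lim; case: ifP => adj.
  (* On side [i] the map [sigma] is affine, so the dividing ratio of the segment is that of its
     image. *)
  left; rewrite (side_pt_opp hs ha ea) (side_pt_opp ht hb eb) vE /side_pt.
  by apply: eq_coord; rewrite !coordE; ring.
right; split => //; first by rewrite r0.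
have adjF := negbT adj.
have kj : k != j by rewrite eq_sym.
have ji : j != i.
  apply/eqP => e; have := height_side_gt0 jk adjF ht.
  by rewrite e hy0 ltxx.
have ki : k != i.
  apply/eqP => e; have := @height_side_gt0 k j s kj; rewrite adjacent_sym => /(_ adjF hs).
  by rewrite e hx0 ltxx.
have aE : side_pt P i a = side_pt P j s by [].
have bE : side_pt P i b = side_pt P k t by [].
case: (height_side_eq0 hs ji hx0) (height_side_eq0 ht ki hy0) => -[e1 e2] [] [e3 e4].
- by move: jk; rewrite e1 e3 eqxx.
- left; split => //; split => //.
  have -> : v = a + r * (b - a) by [].
  have -> : a = 1 by apply: (@side_pt_inj i); rewrite -ea e1 e2 side_pt0 side_pt1.
  have -> : b = 0 by apply: (@side_pt_inj i); rewrite -eb e3 e4 side_pt1 side_pt0.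
  ring.
- right; split => //; split => //.
  have -> : v = a + r * (b - a) by [].
  have -> : a = 0 by apply: (@side_pt_inj i); rewrite -ea e1 e2 side_pt1 side_pt0.
  have -> : b = 1 by apply: (@side_pt_inj i); rewrite -eb e3 e4 side_pt0 side_pt1.
  ring.
- by move: jk; rewrite -(inj_eq (addIr 1)) -e1 -e3 eqxx.
Qed.

(** The origin of [rho]. The heights are determinants of consecutive edges, and those on the
    opposite sides are rescaled by [mu i] and by the factor of one neighbour. Up to the common
    factor [W] the weights are mu_(i-1) v and mu_(i+1) (1 - v). *)
Lemma env_pt_opposite_neighbours i (v : R) : 0 < v < 1 ->
  env_pt (i + 1) (i - 1) 0 1 (1 - v) = Rpoint P mu i v.
Proof.
move=> /andP[v0 v1].
have m1 := cppos_mu_gt0 hP (i - 1); have m2 := cppos_mu_gt0 hP (i + 1); have m0 := cppos_mu_gt0 hP i.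
have oedge j : edge P (opp_idx j) = - (mu j *: edge P j) := cppos_edge hP j.
have t1 := edge_turnN i; have t2 := edge_turn i.
have side1 j : side_pt P (j - 1) 1 = P j by rewrite side_pt1 subrK.
have h1 j : height (j + 1) (P j) = det2 (edge P j) (edge P (j + 1)).
  have -> : P j = P (j + 1) + (-1) *: edge P j.
    by rewrite /edge; apply: eq_coord; rewrite !coordE; ring.
  by rewrite heightD height_P det2Zr det2C; ring.
have h2 j : height (j - 1) (P (j + 1)) = det2 (edge P (j - 1)) (edge P j).
  have -> : P (j + 1) = P j + edge P j by rewrite /edge [RHS]addrC subrK.
  by rewrite heightD -[X in height _ (P X)](subrK 1 j) height_P1 add0r.
have o1 : opp_idx (i + 1) = opp_idx i + 1 by rewrite opp_idxD.
have o2 : opp_idx (i - 1) = opp_idx i - 1 by rewrite opp_idxD.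
have det_opp a b : det2 (edge P (opp_idx a)) (edge P (opp_idx b)) = mu a * mu b * det2 (edge P a) (edge P b).
  by rewrite !oedge !det2E; ring.
have e1 : wgt1 (i + 1) (i - 1) 0 1 (1 - v) =
    (det2 (edge P i) (edge P (i + 1)) * det2 (edge P (i - 1)) (edge P i) * mu i) * (mu (i - 1) * v).
  rewrite /wgt1 o1 o2 side1 side_pt0 h1 h2 -o2 det_opp; ring.
have e2 : wgt2 (i + 1) (i - 1) 0 1 (1 - v) =
    (det2 (edge P i) (edge P (i + 1)) * det2 (edge P (i - 1)) (edge P i) * mu i) * (mu (i + 1) * (1 - v)).
  rewrite /wgt2 o1 o2 side1 side_pt0 h1 h2 -o1 det_opp; ring.
rewrite /env_pt e1 e2 /Rpoint /rho o1 o2 side_pt0 side1 /side_pt.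
set W := _ * _ * mu i.
have W0 : W != 0 by rewrite /W !mulf_neq0 // gt_eqF.
have -> : P (opp_idx i + 1) = P (opp_idx i) + edge P (opp_idx i) by rewrite /edge [RHS]addrC subrK.
have d0 : mu (i - 1) * v + mu (i + 1) * (1 - v) != 0.
  by rewrite gt_eqF// addr_gt0// mulr_gt0// subr_gt0.
move: d0; move: (mu (i - 1) * v) (mu (i + 1) * (1 - v)) => A B d0.
have dW : W * A + W * B != 0 by rewrite -mulrDr mulf_neq0.
by apply: eq_coord; rewrite !coordE; field; rewrite ?d0 ?dW.
Qed.

(** * Limits of the area *)

Definition bound : R := \sum_i (`|P i| + `|edge P i|).

Lemma bound_ge i : `|P i| + `|edge P i| <= bound.
Proof.
rewrite /bound (bigD1 i)//= lerDl; apply: sumr_ge0 => j _.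
by rewrite addr_ge0.
Qed.

Lemma side_pt_bound i (s : R) : 0 <= s <= 1 -> `|side_pt P i s| <= bound.
Proof.
move=> /andP[s0 s1]; apply: le_trans (bound_ge i).
apply: le_trans (ler_normD _ _) _; rewrite lerD2l normrZ ger0_norm//.
by rewrite -[leRHS]mul1r ler_wpM2r.
Qed.

Lemma convex_bound (a b B : R) (x y : R * R) : 0 <= a -> 0 <= b -> a + b = 1 ->
  `|x| <= B -> `|y| <= B -> `|a *: x + b *: y| <= B.
Proof.
move=> a0 b0 ab hx hy; apply: le_trans (ler_normD _ _) _; rewrite !normrZ !ger0_norm//.
by rewrite -[B]mul1r -ab mulrDl lerD// ler_wpM2l.
Qed.

Lemma through_bound p j k s t r : through p j k s t r -> `|p| <= bound.
Proof.
move=> [hs ht /andP[r0 r1] ->].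
have -> : side_pt P j s + r *: (side_pt P k t - side_pt P j s) = (1 - r) *: side_pt P j s + r *: side_pt P k t.
  by apply: eq_coord; rewrite !coordE; ring.
by apply: convex_bound; rewrite ?side_pt_bound ?subr_ge0 ?subrK.
Qed.

Lemma env_pt_bound p j k s t r : inner p -> through p j k s t r -> `|env_pt j k s t r| <= bound.
Proof.
move=> hp h; have [w1 w2] := weights_gt0 hp h; have [hs ht _ _] := h.
have w : 0 < wgt1 j k s t r + wgt2 j k s t r by rewrite addr_gt0.
rewrite /env_pt scalerDr !scalerA; apply: convex_bound; rewrite ?side_pt_bound//.
- by rewrite mulr_ge0// ?invr_ge0 ltW.
- by rewrite mulr_ge0// ?invr_ge0 ltW.
- by rewrite -mulrDr mulVf// gt_eqF.
Qed.

(** The density with the envelope point as an argument, so that it has a meaning for [p] on the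
    boundary and a prescribed limit point. *)
Definition dens p (th : R) (X : R * R) : R :=
  dot2 (nvec th) (X - p) * dot2 (nvec th) (X - p) - dot2 (tvec th) (X - p) * dot2 (tvec th) (X - p).

Lemma area_densityE p (th : R) : area_density (p := p) th = dens p th (envelope P p th).
Proof. by rewrite /area_density !expr2. Qed.

(** The norm of the plane is the maximum norm: both coordinates of [X - p] are at most [2 * bound],
    so the squares of its two components in the rotated frame add up to at most [8 * bound ^+ 2]. *)
Lemma dens_bound p (th : R) (X : R * R) : `|p| <= bound -> `|X| <= bound ->
  `|dens p th X| <= 8 * bound ^+ 2.
Proof.
move=> hp hX.
have : `|X - p| <= 2 * bound.
  by apply: le_trans (ler_normB _ _) _; rewrite mulr_natl mulr2n lerD.
rewrite /dens prod_normE ge_max; move: (X - p) => [x y] /=.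
rewrite !ler_norml => /andP[/andP[h1 h2] /andP[h3 h4]].
have E : dot2 (nvec th) (x, y) * dot2 (nvec th) (x, y) + dot2 (tvec th) (x, y) * dot2 (tvec th) (x, y) = x ^+ 2 + y ^+ 2.
  rewrite /dot2 /=; transitivity ((cos th * cos th + sin th * sin th) * (x ^+ 2 + y ^+ 2)); first by ring.
  by rewrite cs1 mul1r.
have x2 : x ^+ 2 <= (2 * bound) ^+ 2 by nra.
have y2 : y ^+ 2 <= (2 * bound) ^+ 2 by nra.
move: (dot2 (nvec th) _) (dot2 (tvec th) _) E => A B E.
have A2 : 0 <= A * A by rewrite -expr2 sqr_ge0.
have B2 : 0 <= B * B by rewrite -expr2 sqr_ge0.
have : 8 * bound ^+ 2 = (2 * bound) ^+ 2 + (2 * bound) ^+ 2 by ring.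
by lra.
Qed.

Lemma area_density_chord p (th : R) : inner p -> ~ transition P p th ->
  exists j k s t r, [/\ j != k, chord p th j k s t r &
    area_density (p := p) th = dens p th (env_lim j k s t r)].
Proof.
move=> hp nt; have [j [k [s [t [r h]]]]] := chord_exists th hp.
have hc : cell (p := p) j k th by exists s, t, r.
exists j, k, s, t, r; split => //; first by case: h => /(through_neq hp).
rewrite area_densityE; have [-> _] := envelopeE hp nt hc.
by rewrite (cell_envE hp h) (env_limE hp (proj1 h)).
Qed.

Lemma area_density_near p0 (th : R) (X0 : R * R) (e : R) : 0 < e ->
  (forall j k s t r, j != k -> chord p0 th j k s t r -> env_lim j k s t r = X0) ->
  \forall p \near p0, inner p -> ~ transition P p th ->
    `|area_density (p := p) th - dens p0 th X0| < e.
Proof.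
move=> e0 hX.
have H j k : \forall z \near (p0, th), j != k -> forall s t r, chord z.1 z.2 j k s t r ->
    `|dens z.1 z.2 (env_lim j k s t r) - dens p0 th X0| < e.
  have [->|jk] := eqVneq j k; first by apply: (filterS _ filterT) => z _ /eqP.
  have := @chord_tube p0 th j k (fun (z : (R * R) * R) a => `|dens z.1 z.2 (env_lim j k a.1.1 a.1.2 a.2) - dens p0 th X0| < e).
  move=> H0; apply: (filterS _ (H0 _)) => [z h _|]; first exact: h.
  move=> s t r h; have [[hs ht hr _] _] := h.
  have c1 : {for ((s, t, r), (p0, th)), continuous (fun w : (R * R * R) * ((R * R) * R) =>
      env_lim j k w.1.1.1 w.1.1.2 w.1.2)}.
    apply: (continuous_comp (f := fst) (g := fun a : R * R * R => env_lim j k a.1.1 a.1.2 a.2)).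
      exact: cvg_fst.
    exact: env_lim_continuous.
  have c2 : {for ((s, t, r), (p0, th)), continuous (fun w : (R * R * R) * ((R * R) * R) =>
      dens w.2.1 w.2.2 (env_lim j k w.1.1.1 w.1.1.2 w.1.2))}.
    by rewrite /dens; cont.
  have := for_near_lt c2 e0 (c := dens p0 th X0).
  rewrite /= (hX _ _ _ _ _ jk h) => /(_ erefl).
  by apply: filterS => -[[[a b] c] [z1 z2]].
have cp : {for p0, continuous (fun p : R * R => (p, th))} by cont.
have H2 : \forall p \near p0, forall j k, j != k -> forall s t r, chord p th j k s t r ->
    `|dens p th (env_lim j k s t r) - dens p0 th X0| < e.
  exact: cp _ (near_forall2 H).
apply: filterS H2 => p h hp nt.
have [j [k [s [t [r [jk hc ->]]]]]] := area_density_chord hp nt.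
exact: h jk _ _ _ hc.
Qed.

(** Dominated convergence is applied along a sequence of inner points that would violate the limit.
    The transitions of all its terms form a countable set; at every other angle outside [N0] the
    hypothesis and [area_density_near] give pointwise convergence. *)
Lemma ART_area_limit p0 (f0 : R -> R) (N0 : set R) : countable N0 ->
  lebesgue_measure.-integrable `[0, pi]%classic (EFin \o f0) ->
  (forall th, 0 <= th <= pi -> ~ N0 th -> exists X0, f0 th = dens p0 th X0 /\
     forall j k s t r, j != k -> chord p0 th j k s t r -> env_lim j k s t r = X0) ->
  ART_area P p @[p --> within inner (nbhs p0)] -->
    2^-1 * \int[lebesgue_measure]_(x in `[0, pi]) f0 x.
Proof.
move=> cN hf0 hN; set l := 2^-1 * _; apply/cvgrPdist_lt => e e0.
apply: contrapT => nnear.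
have /choice[p_ hp_] : forall m : nat, exists p,
    [/\ ball p0 m.+1%:R^-1 p, inner p & ~ (`|l - ART_area P p| < e)].
  move=> m; apply: contrapT => nex; apply: nnear.
  rewrite near_withinE; near=> p => hp; apply: contrapT => nlt.
  by apply: nex; exists p; split => //; near: p; exact: nbhsx_ballx.
have cp : p_ m @[m --> \oo] --> p0.
  apply/cvg_ballP => d d0; near=> m; have [h _ _] := hp_ m.
  apply: le_ball h; apply: ltW; near: m.
  exact: near_infty_natSinv_lt (PosNum d0).
(* [transition_finite] concerns open intervals, so 0 and [pi] are put into the exceptional set
   separately. *)
pose N := N0 `|` (\bigcup_m (`]0, (pi : R)[%classic `&` transition P (p_ m)) `|` [set 0; pi]).
have cN' : countable N.
  apply: countable_setU => //; apply: countable_setU; last by apply: finite_set_countable; exact: finite_set2.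
  apply: bigcup_countable => // m _; apply: finite_set_countable.
  by have [_ h _] := hp_ m; apply: (transition_finite h); rewrite add0r.
have nN (th : R) m : 0 <= th <= pi -> ~ N th -> ~ transition P (p_ m) th.
  move=> /andP[h1 h2] hn ht; apply: hn; right.
  have [->|n0] := eqVneq th 0; first by right; left.
  have [->|np] := eqVneq th pi; first by right; right.
  left; exists m => //; split => //=; rewrite in_itv /=.
  by rewrite !lt_neqAle h1 h2 np eq_sym n0.
have int m := area_formula (let: And3 _ h _ := hp_ m in h).
have hcv : ART_area P (p_ m) @[m --> \oo] --> l.
  have -> : (fun m => ART_area P (p_ m)) = (fun m => 2^-1 * \int[lebesgue_measure]_(x in `[0, pi]) area_density (p := p_ m) x).
    by apply/funext => m; case: (int m).
  apply: cvgM; first exact: cvg_cst.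
  apply: (Rintegral_cvg (N := N) (M := 8 * bound ^+ 2)) => //.
  - by move=> m; case: (int m) => -[].
  - move=> m th hth hn; have [_ hi _] := hp_ m.
    have [j [k [s [t [r [jk hc ->]]]]]] := area_density_chord hi (nN _ m hth hn).
    rewrite (env_limE hi (proj1 hc)); apply: dens_bound; first exact: through_bound (proj1 hc).
    exact: env_pt_bound hi (proj1 hc).
  - move=> th hth hn; have [|X0 [-> hX]] := hN th hth; first by move=> h; apply: hn; left.
    apply/cvgrPdist_lt => d d0; have H2 : \forall m \near \oo, inner (p_ m) -> ~ transition P (p_ m) th ->
        `|area_density (p := p_ m) th - dens p0 th X0| < d.
      exact: cp _ (area_density_near d0 hX).
    apply: filterS H2 => m h; rewrite distrC; apply: h; last exact: nN.
    by have [_ hi _] := hp_ m.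
have /cvgrPdist_lt /(_ _ e0) [m _ /(_ m (leqnn m)) hm] := hcv.
by have [_ _] := hp_ m; apply.
Unshelve. all: by end_near. Qed.

Lemma area_limit_inner p0 : inner p0 ->
  ART_area P p @[p --> within inner (nbhs p0)] --> ART_area P p0.
Proof.
move=> hp; have [[h1 _] ->] := area_formula hp.
apply: (ART_area_limit (N0 := (`]0, (pi : R)[%classic `&` transition P p0) `|` [set 0; pi])) => //.
  apply: countable_setU; last by apply: finite_set_countable; exact: finite_set2.
  by apply: finite_set_countable; apply: (transition_finite hp); rewrite add0r.
move=> th /andP[ge0 lepi] nN.
have nt : ~ transition P p0 th.
  move=> ht; apply: nN; have [->|n0] := eqVneq th 0; first by right; left.
  have [->|np] := eqVneq th pi; first by right; right.
  by left; split => //=; rewrite in_itv /= !lt_neqAle ge0 lepi np eq_sym n0.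
exists (envelope P p0 th); split; first exact: area_densityE.
move=> j k s t r jk h.
have hc : cell (p := p0) j k th by exists s, t, r.
by rewrite (env_limE hp (proj1 h)); have [-> _] := envelopeE hp nt hc; rewrite (cell_envE hp h).
Qed.

Lemma dens_integral p (X : R * R) : has_int (fun th => dens p th X) 0 pi 0.
Proof.
pose F (th : R) := - (dot2 (nvec th) (X - p) * dot2 (tvec th) (X - p)).
have e : F pi - F 0 = 0.
  rewrite /F -[X in nvec X](add0r pi) nvecDpi -[X in tvec X](add0r pi) tvecDpi.
  by rewrite /dot2 !coordE; ring.
rewrite -[X in has_int _ _ _ X]e; apply: has_int_FTC; first exact: pi_gt0.
- by move=> th _; rewrite /dens; cont.
- by move=> th _; rewrite /F; cont.
- move=> th _; rewrite /F /dens /dot2 /nvec /tvec /=; apply: is_derive_eq.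
  by rewrite /GRing.scale /=; ring.
Qed.

Lemma opposite_neighbours_imgvec i : imgvec (i + 1) (i - 1) 0 1 = - (mu i *: edge P i).
Proof.
rewrite /imgvec side_pt0 side_pt1 -(cppos_edge hP) !opp_idxD /edge.
by rewrite subrK.
Qed.

Lemma imgvec_sym j k s t : imgvec k j t s = - imgvec j k s t.
Proof. by rewrite /imgvec opprB. Qed.

(** The values 0 and 1 of [v] are allowed, so vertices are covered. An exceptional limit chord runs
    along side [i], so its image is parallel to the edge and its angle is [th0], unique in [0, pi);
    this is why [pi] is excluded as well. *)
Lemma area_limit_boundary i (v : R) : 0 <= v <= 1 ->
  ART_area P p @[p --> within inner (nbhs (side_pt P i v))] --> (0 : R).
Proof.
move=> hv; set p0 := side_pt P i v.
have [h1 h2] := dens_integral p0 (side_pt P (opp_idx i) v).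
have [th0 h0 d0] := exists_perp 0 (edge P i).
rewrite -[X in _ --> X](mulr0 2^-1) -h2.
apply: (ART_area_limit (N0 := [set th0; pi])) => //.
  by apply: finite_set_countable; exact: finite_set2.
move=> th /andP[ge0 lepi] nN; exists (side_pt P (opp_idx i) v); split => // j k s t r jk [hth hd].
case: (boundary_chord jk hv hth) => // -[_ _ hcase]; case: nN.
have [->|np] := eqVneq th pi; [by right | left].
apply: (nvec_perp_eq (a := 0) (v := edge P i)) => //; first exact: edge_neq0.
  by rewrite add0r ge0 lt_neqAle np.
have : dot2 (nvec th) (- (mu i *: edge P i)) = 0.
  rewrite -opposite_neighbours_imgvec; case: hcase => -[[e1 e2] [[e3 e4] _]].
    by move: hd; rewrite e1 e2 e4 [i in i - 1]e3 addrK.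
  have : dot2 (nvec th) (imgvec k j t s) = 0 by rewrite imgvec_sym -scaleN1r dot2Zr hd mulr0.
  by rewrite e1 e2 e4 [i in i - 1]e3 addrK.
rewrite -scaleNr dot2Zr => /eqP; rewrite mulf_eq0 oppr_eq0.
by rewrite (gt_eqF (cppos_mu_gt0 hP i)) => /eqP.
Qed.

(** * Monotone parametrizations of the front *)

Section Paths.
Context {p : R * R} (hp : inner p).
Local Notation env_left := (envelope_left P p).
Local Notation env_right := (envelope_right P p).
Local Notation cell := (cell (p := p)).
Local Notation cell_env := (cell_env (p := p)).

Definition front_pt (th l : R) : R * R := env_left th + l *: (env_right th - env_left th).

Lemma front_pt0 (th : R) : front_pt th 0 = env_left th.
Proof. by rewrite /front_pt scale0r addr0. Qed.

Lemma front_pt1 (th : R) : front_pt th 1 = env_right th.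
Proof. by rewrite /front_pt scale1r addrC subrK. Qed.

(* A monotone parametrization, by [x, y], of the part of the completed front from
   the state (th, lam) = (c, l) to the state (d, m), within [e] of the curve [h]. *)
Definition front_path (e : R) (h : R -> R * R) (x y c l d m : R) : Prop :=
  exists (T lam : R -> R) (g : R -> R * R),
  [/\ continuous T /\ continuous g, {homo T : a b / a <= b},
      (T x = c /\ lam x = l) /\ (T y = d /\ lam y = m),
      forall a b : R, x <= a -> a <= b -> b <= y -> T a = T b -> lam a <= lam b &
      forall a : R, x <= a <= y ->
        [/\ 0 <= lam a <= 1, g a = front_pt (T a) (lam a) & `|g a - h a| <= e]].

Lemma front_path_cat e h (x y z c l d m c' l' : R) : x <= y -> y <= z ->
  front_path e h x y c l d m -> front_path e h y z d m c' l' -> front_path e h x z c l c' l'.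
Proof.
move=> xy yz [T1 [l1 [g1 [[cT1 cg1] mT1 [[e1 e2] [e3 e4]] ml1 v1]]]].
move=> [T2 [l2 [g2 [[cT2 cg2] mT2 [[e5 e6] [e7 e8]] ml2 v2]]]].
have cmin (u : R) : {for u, continuous (fun w : R => Num.min w y)}.
  by apply: for_min; [exact: for_id | exact: for_cst].
have cmax (u : R) : {for u, continuous (fun w : R => Num.max w y)}.
  by apply: for_max; [exact: for_id | exact: for_cst].
have hy1 : x <= y <= y by rewrite xy lexx.
have hy2 : y <= y <= z by rewrite yz lexx.
have g12 : g1 y = g2 y.
  by have [_ -> _] := v1 _ hy1; have [_ -> _] := v2 _ hy2; rewrite e3 e4 e5 e6.
(* Each half is stopped at [y], and their sum minus the common value is continuous on the whole line
   without a case distinction. *)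
pose T (u : R) := T1 (Num.min u y) + (T2 (Num.max u y) - d).
pose g (u : R) := g1 (Num.min u y) + (g2 (Num.max u y) - g2 y).
pose lam (u : R) := if u <= y then l1 u else l2 u.
have TL (u : R) : u <= y -> T u = T1 u.
  by move=> uy; rewrite /T (min_idPl uy) (max_idPr uy) e5 subrr addr0.
have TR (u : R) : y <= u -> T u = T2 u.
  by move=> uy; rewrite /T (min_idPr uy) (max_idPl uy) e3 addrC subrK.
have gL (u : R) : u <= y -> g u = g1 u.
  by move=> uy; rewrite /g (min_idPl uy) (max_idPr uy) subrr addr0.
have gR (u : R) : y <= u -> g u = g2 u.
  by move=> uy; rewrite /g (min_idPr uy) (max_idPl uy) g12 addrC subrK.
have lR (u : R) : y <= u -> lam u = l2 u.
  rewrite le_eqVlt /lam => /orP[/eqP <-|h1]; first by rewrite lexx e4 e6.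
  by rewrite leNgt h1.
have lL (u : R) : u <= y -> lam u = l1 u by rewrite /lam => ->.
exists T, lam, g; split.
- split=> u.
  + have h1 := for_comp cT1 (cmin u); have h2 := for_comp cT2 (cmax u).
    by have : {for u, continuous (fun w : R => T1 (Num.min w y) + (T2 (Num.max w y) - d))} by cont.
  + have h1 := for_comp cg1 (cmin u); have h2 := for_comp cg2 (cmax u).
    by have : {for u, continuous (fun w : R => g1 (Num.min w y) + (g2 (Num.max w y) - g2 y))} by cont.
- move=> a b ab; rewrite /T lerD//; last rewrite lerD2r.
    by apply: mT1; rewrite le_min !ge_min ab lexx orbT.
  by apply: mT2; rewrite ge_max !le_max ab lexx orbT.
- by rewrite (TL x)// (lL x)// (TR z)// (lR z)//.
- move=> a b xa ab bz; case: (leP b y) => hb.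
    have ay := le_trans ab hb; rewrite (TL a)// (TL b)// (lL a)// (lL b)//.
    exact: ml1.
  have yb := ltW hb; case: (leP a y) => ha; last first.
    have ya := ltW ha; rewrite (TR a)// (TR b)// (lR a)// (lR b)//.
    exact: ml2.
  rewrite (TL a)// (TR b)// (lL a)// (lR b)// => Tab.
  (* Equal angles on the two sides of [y] force both to be [d], so [lam] is compared through its
     value [m] at [y]. *)
  have h1 : T1 a <= d by rewrite -e3; exact: mT1.
  have h2 : d <= T2 b by rewrite -e5; exact: mT2.
  have /eqP h3 : T1 a == d by rewrite eq_le h1 Tab.
  have /eqP h4 : d == T2 b by rewrite eq_le h2 -Tab.
  apply: (@le_trans _ _ m); first by rewrite -e4; apply: ml1; rewrite // e3.
  by rewrite -e6; apply: ml2; rewrite // e5.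
- move=> a /andP[xa az]; case: (leP a y) => ha.
    by rewrite TL// gL// lL//; apply: v1; rewrite xa.
  by have ya := ltW ha; rewrite TR// gR// lR//; apply: v2; rewrite ya.
Qed.

Lemma front_path_jump e h (x y d : R) : x < y ->
  (forall u : R, x <= u <= y -> `|front_pt d ((u - x) / (y - x)) - h u| <= e) ->
  front_path e h x y d 0 d 1.
Proof.
move=> xy hh; have yx : 0 < y - x by rewrite subr_gt0.
pose lam (u : R) := (u - x) / (y - x).
exists (fun _ => d), lam, (fun u : R => front_pt d (lam u)); split.
- split=> u; first exact: for_cst.
  have : {for u, continuous (fun w : R => env_left d + ((w - x) / (y - x)) *: (env_right d - env_left d))} by cont.
  by [].
- by [].
- by rewrite /lam subrr mul0r divff ?gt_eqF.
- by move=> a b _ ab _ _; rewrite /lam ler_pM2r ?invr_gt0// lerD2r.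
- move=> a hxy; split=> //; last exact: hh.
  move/andP: hxy => [xa ay]; apply/andP; split.
    by rewrite divr_ge0 ?subr_ge0// ltW.
  by rewrite ler_pdivrMr// mul1r lerD2r.
Qed.

Lemma front_path_cell e (X : R * R) (x y a b : R) : x < y -> a < b ->
  (forall th, a < th < b -> ~ transition P p th) ->
  (forall th j k, a <= th <= b -> cell j k th -> j != k ->
     (exists2 th', a < th' < b & cell j k th') -> `|cell_env j k th - X| <= e) ->
  front_path e (fun _ => X) x y a 1 b 0.
Proof.
move=> xy ab nt hX; have [j [k hc]] := interval_cell hp ab nt.
have yx : 0 < y - x by rewrite subr_gt0.
have ba : 0 < b - a by rewrite subr_gt0.
have jk : j != k.
  have [|s [t [r [h _]]]] := hc a; first by rewrite lexx ltW.
  exact: through_neq h.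
pose T (u : R) := a + (u - x) / (y - x) * (b - a).
(* The angle stopped at [a] and [b]: [cell_env] is known to be continuous only on the cell, whereas
   the path must be continuous on the whole line. *)
pose S (u : R) := a + clamp ((u - x) / (y - x)) * (b - a).
have Sab (u : R) : a <= S u <= b.
  have /andP[h1 h2] := clamp_itv ((u - x) / (y - x)).
  by rewrite /S; move: (clamp _) h1 h2 => w h1 h2; apply/andP; split; nra.
have TS (u : R) : x <= u <= y -> S u = T u.
  move=> /andP[h1 h2]; rewrite /S clamp_id//; apply/andP; split.
    by rewrite divr_ge0 ?subr_ge0// ltW.
  by rewrite ler_pdivrMr// mul1r lerD2r.
have Tx : T x = a by rewrite /T subrr !mul0r addr0.
have Ty : T y = b by rewrite /T divff ?gt_eqF// mul1r addrC subrK.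
have Tinj (u v : R) : T u = T v -> u = v.
  move=> /addrI /(mulIf (lt0r_neq0 ba)) /(mulIf _) h; apply: (addIr (- x)); apply: h.
  by rewrite invr_neq0// gt_eqF.
(* The value 1 of [lam] selects the right envelope point at [a], the value 0 the left one at [b]; in
   between the two points agree. [T] is injective, so the drop of [lam] is harmless. *)
exists T, (fun u : R => if u <= x then 1 else 0), (fun u : R => cell_env j k (S u)); split.
- split=> u; first by change (continuous_at u T); rewrite /T; cont.
  have cS : {for u, continuous S}.
    rewrite /S; apply: forD; first exact: for_cst.
    apply: forM; last exact: for_cst.
    by apply: (for_comp clamp_continuous); cont.
  have [h1 h2] := cell_env_C0 hp hc.
  have h3 := h1 _ (Sab u); have h4 := h2 _ (Sab u).
  have h5 : {for S u, continuous (fun th => ((cell_env j k th).1, (cell_env j k th).2))} by exact: for_pair.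
  have -> : cell_env j k = (fun th => ((cell_env j k th).1, (cell_env j k th).2)).
    by apply/funext => th; case: (cell_env j k th).
  exact: (continuous_comp cS h5).
- move=> u v uv; rewrite /T lerD2l ler_pM2r// ler_pM2r ?invr_gt0//.
  by rewrite lerD2r.
- by rewrite lexx Tx Ty leNgt xy.
- by move=> u v _ uv _ /Tinj ->.
- move=> u hu; rewrite (TS u hu); have hT := Sab u; rewrite (TS u hu) in hT.
  have [ux|ux] := leP u x.
    have -> : u = x by apply/eqP; rewrite eq_le ux; case/andP: hu.
    rewrite ler01 lexx Tx front_pt1 (envelope_rightE hp ab hc); split => //.
    apply: hX => //; first by rewrite lexx ltW.
      by apply: hc; rewrite lexx ltW.
    exists ((a + b) / 2); first by apply/andP; split; lra.
    by apply: hc; apply/andP; split; lra.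
  rewrite ler01 lexx; split => //; last first.
    apply: hX => //; first exact: hc.
    exists ((a + b) / 2); first by apply/andP; split; lra.
    by apply: hc; apply/andP; split; lra.
  rewrite front_pt0; case/andP: hT => _; rewrite le_eqVlt => /orP[/eqP ->|Tb].
    by rewrite (envelope_leftE hp ab hc).
  have hab : a < T u < b.
    by rewrite Tb -Tx /T ltrD2l ltr_pM2r// ltr_pM2r ?invr_gt0// ltrD2r ux.
  have [-> _] := envelope_sides hp (nt _ hab).
  have hcT : cell j k (T u) by apply: hc; case/andP: hab => h1 h2; rewrite !ltW.
  by have [-> _] := envelopeE hp (nt _ hab) hcT.
Qed.

Lemma front_path_ends e h (x y c l d m : R) : x <= y -> front_path e h x y c l d m ->
  `|front_pt c l - h x| <= e /\ `|front_pt d m - h y| <= e.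
Proof.
move=> xy [T [lam [g [_ _ [[<- <-] [<- <-]] _ v]]]].
have hx : x <= x <= y by rewrite lexx.
have hy : x <= y <= y by rewrite lexx andbT.
by have [_ <- ?] := v _ hx; have [_ <- ?] := v _ hy.
Qed.

Lemma front_pt_near (d l : R) (Y0 Y1 : R * R) (e : R) : 0 <= l <= 1 ->
  `|env_left d - Y0| <= e -> `|env_right d - Y1| <= e ->
  `|front_pt d l - (Y0 + l *: (Y1 - Y0))| <= e.
Proof.
move=> /andP[l0 l1] h0 h1.
have -> : front_pt d l - (Y0 + l *: (Y1 - Y0)) = (1 - l) *: (env_left d - Y0) + l *: (env_right d - Y1).
  by rewrite /front_pt; apply: eq_coord; rewrite !coordE; ring.
by apply: convex_bound => //; rewrite ?subr_ge0 ?subrK.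
Qed.

Lemma front_path_cells e (X : R * R) (x y a b : R) : x < y -> a < b -> b <= a + pi ->
  (forall th j k, a <= th <= b -> cell j k th -> j != k ->
     (exists th', [/\ a < th' < b, ~ transition P p th' & cell j k th']) -> `|cell_env j k th - X| <= e) ->
  front_path e (fun _ => X) x y a 1 b 0.
Proof.
move=> xy ab bpi hX.
have [l hl] := transition_seq hp a.
move: x y xy; apply: (@interval_ind _ (transition P p)
  (fun c d => forall x y : R, x < y -> front_path e (fun _ => X) x y c 1 d 0) a b l) => //.
- move=> th /andP[h1 h2]; apply: hl; rewrite (ltW h1)/=.
  exact: lt_le_trans h2 bpi.
- move=> c d ac cd db nt x y xy; apply: (front_path_cell xy cd nt).
  move=> th j k /andP[h1 h2] h3 h4 [th' /andP[h5 h6] h7]; apply: hX => //.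
    by rewrite (le_trans ac h1) (le_trans h2 db).
  exists th'; split => //; first by rewrite (le_lt_trans ac h5) (lt_le_trans h6 db).
  by apply: nt; rewrite h5.
- move=> c d f _ _ _ _ _ IH1 IH2 x y xy.
  pose x1 := (2 * x + y) / 3; pose y1 := (x + 2 * y) / 3.
  have xx1 : x < x1 by rewrite /x1; lra.
  have x1y1 : x1 < y1 by rewrite /x1 /y1; lra.
  have y1y : y1 < y by rewrite /y1; lra.
  have p1 := IH1 _ _ xx1; have p2 := IH2 _ _ y1y.
  have [_ n1'] := front_path_ends (ltW xx1) p1; have [n2 _] := front_path_ends (ltW y1y) p2.
  apply: (front_path_cat (ltW xx1) _ p1); first exact: ltW (lt_trans x1y1 y1y).
  apply: (front_path_cat (ltW x1y1) (ltW y1y) _ p2).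
  apply: front_path_jump => // u /andP[u1 u2].
  have := @front_pt_near d ((u - x1) / (y1 - x1)) X X e; rewrite subrr scaler0 addr0; apply.
  + apply/andP; split; first by rewrite divr_ge0// subr_ge0// ltW.
    by rewrite ler_pdivrMr ?subr_gt0// mul1r lerD2r.
  + by rewrite -front_pt0.
  + by rewrite -front_pt1.
Qed.

Lemma front_path_ART e h (a : R) : front_path e h 0 1 a 0 (a + pi) 0 -> 
  h 0 = h 1 ->
  exists2 c, ART P p c & forall t, 0 <= t <= 1 -> `|c t - h t| <= e.
Proof.
move=> [T [lam [g [[cT cg] mT [[e1 e2] [e3 e4]] ml v]]]] h01.
have i01 (u : R) : 0 <= frac u <= 1 by have /andP[h1 h2] := frac_itv u; rewrite h1 ltW.
have i0 := cls0.
have i1 := cls1.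
have frontDpi (th l : R) (m : int) : front_pt (th + m%:~R * pi) l = front_pt th l.
  have E1 := @periodic_int R _ env_left pi m th (envelope_leftDpi hp).
  by rewrite /front_pt E1 (periodic_int _ _ (envelope_rightDpi hp)).
have g10 : g 1 = g 0.
  have [_ -> _] := v 1 i1; have [_ -> _] := v 0 i0; rewrite e1 e2 e3 e4.
  by have := frontDpi a 0 1; rewrite mul1r.
pose T' (u : R) := T (frac u) + (Num.floor u)%:~R * pi.
have flt (u w : R) : (Num.floor u < Num.floor w)%R -> (Num.floor u)%:~R + 1 <= (Num.floor w)%:~R :> R.
  by rewrite -lezD1 -(ler_int R) intrD.
(* The angle reached at the integer following [u] separates parameters with different integer
   parts. *)
have step (u w : R) : (Num.floor u < Num.floor w)%R -> T' u <= a + pi + (Num.floor u)%:~R * pi /\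
    a + pi + (Num.floor u)%:~R * pi <= T' w.
  move=> /flt h1; have p0 : 0 < pi :> R := pi_gt0 R.
  have h2 : T (frac u) <= a + pi by rewrite -e3; apply: mT; case/andP: (i01 u).
  have h3 : a <= T (frac w) by rewrite -e1; apply: mT; case/andP: (i01 w).
  rewrite /T' lerD2r h2; split => //; nra.
exists (fun u : R => g (frac u)).
  split.
    have := extension_continuous cg (c := 0); rewrite addr0 => /(_ g10).
    by under eq_fun do rewrite scaler0 addr0.
  split; first by move=> u; rewrite fracD1.
  exists T', (fun u : R => lam (frac u)); split.
  - by apply: (@extension_continuous R R T pi cT); rewrite e1 e3.
  - move=> u w uw; have := le_floor uw; rewrite le_eqVlt => /orP[/eqP fl|fl].
      rewrite /T' fl lerD2r; apply: mT; rewrite /frac fl.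
      by rewrite lerD2r.
    by have [h1 h2] := step _ _ fl; exact: le_trans h1 h2.
  - by move=> u; rewrite /T' fracD1 floorD1 intrD mulrDl mul1r addrA.
  - split; first by move=> u; have [] := v _ (i01 u).
    move=> u w uw; have := le_floor uw; rewrite le_eqVlt => /orP[/eqP fl|fl].
      rewrite /T' fl => /addIr; apply: ml.
      + by case/andP: (i01 u).
      + by rewrite /frac fl lerD2r.
      + by case/andP: (i01 w).
    have [h1 h2] := step _ _ fl => E.
    have /eqP : T' u == a + pi + (Num.floor u)%:~R * pi by rewrite eq_le h1 E h2.
    (* Here [T (frac u)] is already the final angle [T 1], where [lam] is 0, so [lam (frac u)] is at
       most 0. *)
    rewrite /T' => /addIr Tu; apply: (@le_trans _ _ 0); last by have [/andP[]] := v _ (i01 w).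
    rewrite -[leRHS]e4; apply: ml => //; try by case/andP: (i01 u).
    by rewrite Tu.
  - move=> u; have [_ gE _] := v _ (i01 u); rewrite gE -(frontDpi _ _ (Num.floor u)).
    split=> // nt; rewrite /front_pt; have [-> ->] := envelope_sides hp nt.
    by rewrite subrr scaler0 addr0.
move=> t /andP[t0 t1]; move: t1; rewrite le_eqVlt => /orP[/eqP ->|t1].
  have -> : frac 1 = 0 :> R by rewrite /frac floor1 subrr.
  by rewrite -h01; have [] := v 0 i0.
have ht : 0 <= t <= 1 by rewrite t0 ltW.
by rewrite frac_id ?t0//; have [] := v _ ht.
Qed.

End Paths.

(** * The front near a side *)

Lemma neighbours_neq i : i + 1 != i - 1.
Proof.
have -> : i + 1 = (i - 1) + 2%:R by rewrite -[2%:R]/(1 + 1) addrA subrK.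
exact: (idx_neqD n1).
Qed.

Lemma neighbours_not_adjacent i : ~~ adjacent (i + 1) (i - 1).
Proof.
rewrite /adjacent subrK negb_or; apply/andP; split; last exact: (idx_neqD n1 _ (m := 1)).
rewrite eq_sym; have -> : i + 1 + 1 = (i - 1) + 3%:R.
  by rewrite -[3%:R]/(1 + (1 + 1)) 2!addrA subrK.
exact: (idx_neqD n1).
Qed.

(** Such a chord can only be side [i] itself, run backwards from [P (i + 1)] to [P i]; this explains
    the ratio 1 - v. *)
Lemma boundary_chord_neighbours i (v s t r : R) : 0 < v < 1 ->
  through (side_pt P i v) (i + 1) (i - 1) s t r -> [/\ s = 0, t = 1 & r = 1 - v].
Proof.
move=> hv [hs ht /andP[r0 r1] pE].
have n1' : i + 1 != i by exact: (idx_neqD n1 _ (m := 1)).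
have n2 : i - 1 != i by rewrite -(inj_eq (addIr 1)) subrK eq_sym.
have r00 : r != 0.
  apply/eqP => r00; move: pE; rewrite r00 scale0r addr0 => pE.
  by have [e _] := side_pt_interior hv hs (esym pE); rewrite e eqxx in n1'.
have r10 : r != 1.
  apply/eqP => r10; move: pE; rewrite r10 scale1r addrC subrK => pE.
  by have [e _] := side_pt_interior hv ht (esym pE); rewrite e eqxx in n2.
have {}r0 : 0 < r by rewrite lt_neqAle eq_sym r00.
have {}r1 : r < 1 by rewrite lt_neqAle r10.
have h0 : height i (side_pt P i v) = 0 by rewrite height_own.
have hx := height_side_ge0 i (i + 1) hs; have hy := height_side_ge0 i (i - 1) ht.
have m1 : 0 <= (1 - r) * height i (side_pt P (i + 1) s).
  by apply: mulr_ge0 => //; rewrite subr_ge0 ltW.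
have m2 : 0 <= r * height i (side_pt P (i - 1) t) by apply: mulr_ge0 => //; exact: ltW.
have /eqP := h0; rewrite pE height_aff paddr_eq0//.
rewrite !mulf_eq0 (gt_eqF r0) /= subr_eq0 (gt_eqF r1) /= => /andP[/eqP hx0 /eqP hy0].
have s0 : s = 0.
  case: (height_side_eq0 hs n1' hx0) => -[] // e _.
  by have := idx_neqD n1 i (m := 2) isT; rewrite -[2%:R]/(1 + 1) addrA -e eqxx.
have t1 : t = 1.
  case: (height_side_eq0 ht n2 hy0) => -[] // e _.
  by have := neighbours_neq i; rewrite -e eqxx.
split => //; have : side_pt P i v = side_pt P i (1 - r).
  rewrite pE s0 t1 side_pt0 side_pt1 subrK /side_pt /edge.
  by apply: eq_coord; rewrite !coordE; ring.
by move=> /side_pt_inj ->; ring.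
Qed.

(** The limit values are s = 0 and t = 1. The bound 1/2 is any number strictly between: it keeps the
    ends of the chord away from the far vertices of the two neighbouring sides. *)
Lemma near_boundary_neighbours i (v e : R) : 0 < v < 1 -> 0 < e ->
  \forall p \near side_pt P i v, forall s t r, through p (i + 1) (i - 1) s t r ->
    [/\ s < 1 / 2, 1 / 2 < t & `|env_lim (i + 1) (i - 1) s t r - Rpoint P mu i v| < e].
Proof.
move=> hv e0.
have := @through_tube (side_pt P i v) (i + 1) (i - 1)
  (fun _ a => [/\ a.1.1 < 1 / 2, 1 / 2 < a.1.2 &
    `|env_lim (i + 1) (i - 1) a.1.1 a.1.2 a.2 - Rpoint P mu i v| < e]).
move=> H; apply: (filterS _ (H _)) => [p h s t r hth|]; first exact: h hth.
move=> s t r h; have [hs ht hr _] := h.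
have [s0 t1 rE] := boundary_chord_neighbours hv h.
have cE := env_lim_continuous (neighbours_neq i) hs ht hr.
have E : env_lim (i + 1) (i - 1) s t r = Rpoint P mu i v.
  rewrite s0 t1 rE /env_lim (negbTE (neighbours_not_adjacent i)).
  exact: env_pt_opposite_neighbours.
have n0 := for_near_lt cE e0 E.
have c1 : {for ((s, t, r) : R * R * R), continuous (fun a : R * R * R => 1 / 2 - a.1.1)} by cont.
have c2 : {for ((s, t, r) : R * R * R), continuous (fun a : R * R * R => a.1.2 - 1 / 2)} by cont.
have n1' : \forall a \near ((s, t, r) : R * R * R), 0 < 1 / 2 - a.1.1.
  by apply: for_gt0_near c1 _; rewrite /= s0; lra.
have n2 : \forall a \near ((s, t, r) : R * R * R), 0 < a.1.2 - 1 / 2.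
  by apply: for_gt0_near c2 _; rewrite /= t1; lra.
have N : \forall a \near ((s, t, r) : R * R * R), `|env_lim (i + 1) (i - 1) a.1.1 a.1.2 a.2 - Rpoint P mu i v| < e /\
    0 < 1 / 2 - a.1.1 /\ 0 < a.1.2 - 1 / 2.
  by apply: filterI n0 (filterI n1' n2).
have fstc : {for ((s, t, r), side_pt P i v), continuous (fst : (R * R * R) * (R * R) -> R * R * R)}.
  exact: cvg_fst.
have N2 : \forall w \near ((s, t, r), side_pt P i v),
    `|env_lim (i + 1) (i - 1) w.1.1.1 w.1.1.2 w.1.2 - Rpoint P mu i v| < e /\
    0 < 1 / 2 - w.1.1.1 /\ 0 < w.1.1.2 - 1 / 2 by exact: fstc _ N.
apply: filterS N2 => -[[[a b] c] q] [/= h1 [h2 h3]].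
by split => //; lra.
Qed.

Lemma near_boundary_other i (v e : R) : 0 <= v <= 1 -> 0 < e ->
  \forall p \near side_pt P i v, forall j k, j != k ->
    ~ (j = i + 1 /\ k = i - 1) -> ~ (k = i + 1 /\ j = i - 1) ->
    forall s t r, through p j k s t r ->
    `|env_lim j k s t r - side_pt P (opp_idx i) v| < e.
Proof.
move=> hv e0.
suff H0 j k : \forall p \near side_pt P i v, j != k ->
    ~ (j = i + 1 /\ k = i - 1) -> ~ (k = i + 1 /\ j = i - 1) ->
    forall s t r, through p j k s t r -> `|env_lim j k s t r - side_pt P (opp_idx i) v| < e.
  exact: (near_forall2 H0).
have [[jk [njk nkj]]|bad] := pselect (j != k /\ ~ (j = i + 1 /\ k = i - 1) /\ ~ (k = i + 1 /\ j = i - 1)); last first.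
  by apply: (filterS _ filterT) => p _ h1 h2 h3; case: bad.
have := @through_tube (side_pt P i v) j k
  (fun _ a => `|env_lim j k a.1.1 a.1.2 a.2 - side_pt P (opp_idx i) v| < e).
move=> H; apply: (filterS _ (H _)) => [p h _ _ _ s t r hth|]; first exact: h hth.
move=> s t r h; have [hs ht hr _] := h.
have cE := env_lim_continuous jk hs ht hr.
have E : env_lim j k s t r = side_pt P (opp_idx i) v.
  case: (boundary_chord jk hv h) => // -[_ _ [] [[e1 _] [[e2 _] _]]].
    by case: njk; split => //; rewrite e2 addrK.
  by case: nkj; split => //; rewrite e2 addrK.
have n0 := for_near_lt cE e0 E.
have fstc : {for ((s, t, r), side_pt P i v), continuous (fst : (R * R * R) * (R * R) -> R * R * R)}.
  exact: cvg_fst.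
have N2 : \forall w \near ((s, t, r), side_pt P i v),
    `|env_lim j k w.1.1.1 w.1.1.2 w.1.2 - side_pt P (opp_idx i) v| < e by exact: fstc _ n0.
by apply: filterS N2 => -[[[a b] c] q].
Qed.

(** * The window of angles whose chords join the two neighbours of a side *)

Section NearSide.
Context {p : R * R} (hp : inner p) (i : 'Z_n.*2).
Local Notation cell := (cell (p := p)).
Local Notation vertex_chord := (vertex_chord (p := p)).
Context (near : forall s t r, through p (i + 1) (i - 1) s t r -> s < 1 / 2 /\ 1 / 2 < t).

Lemma near_cell_vertex (th : R) : cell (i + 1) (i - 1) th ->
  (exists s t r, [/\ 0 < s < 1, 0 < t < 1 & chord p th (i + 1) (i - 1) s t r]) \/
  (vertex_chord (i + 1) th \/ vertex_chord i th).
Proof.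
move=> [s [t [r h]]]; have [s2 t2] := near (proj1 h); have [[/andP[s0 s1] /andP[t0 t1] _ _] _] := h.
have [s00|s00] := eqVneq s 0.
  by right; left; exists (i - 1), t, r; rewrite -s00.
have [t11|t11] := eqVneq t 1.
  right; right; exists (i + 1), s, (1 - r); apply: (chord_reindex _ _ (chord_sym h)).
    by rewrite lexx ler01.
  by rewrite t11 side_pt1 side_pt0 subrK.
left; exists s, t, r; split => //; apply/andP; split; rewrite ?lt_neqAle.
- by rewrite eq_sym s00.
- by rewrite -lt_neqAle; lra.
- by rewrite -lt_neqAle; lra.
- by rewrite t11.
Qed.

Lemma near_cell_transition (th : R) : cell (i + 1) (i - 1) th -> transition P p th ->
  vertex_chord (i + 1) th \/ vertex_chord i th.
Proof.
move=> /near_cell_vertex [[s [t [r [hs ht h]]]]|//] ht'.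
by have := chord_not_transition hp hs ht h.
Qed.

Lemma near_cell_sides (th : R) j k : cell (i + 1) (i - 1) th -> ~ transition P p th -> cell j k th ->
  (j = i + 1 /\ k = i - 1) \/ (j = i - 1 /\ k = i + 1).
Proof.
move=> hc nt [s2 [t2 [r2 h2]]]; case: (near_cell_vertex hc) => [[s [t [r [hs ht h]]]]|hv].
  exact: chord_sides hs ht h h2.
by case: nt; apply/(transition_vertex hp); case: hv; [exists (i + 1) | exists i].
Qed.

Lemma vertex_chord_consecutive (th : R) : vertex_chord i th -> vertex_chord (i + 1) th -> False.
Proof.
move=> [k [t [r h]]] [k' [t' [r' h']]].
have [_ _ _ pE] := proj1 h.
have n1' : i + 1 != i by exact: (idx_neqD n1 _ (m := 1)).
have yE : side_pt P k t = P (i + 1).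
  case: (chord_unique hp h h') => -[]; rewrite !side_pt0 => e1 _ //.
  by have := cppos_inj hP e1 => e; rewrite e eqxx in n1'.
have := hp i; rewrite pE height_aff yE side_pt0 height_P height_P1 !mulr0 addr0.
by rewrite ltxx.
Qed.

Lemma near_window (th0 : R) : ~ transition P p th0 -> cell (i + 1) (i - 1) th0 ->
  exists a b : R, [/\ a < th0 < b, b < a + pi,
    (forall th, a < th < b -> ~ transition P p th),
    (forall th, a <= th <= b -> cell (i + 1) (i - 1) th) &
    (transition P p a /\ transition P p b) /\
    ((vertex_chord (i + 1) a /\ vertex_chord i b) \/ (vertex_chord i a /\ vertex_chord (i + 1) b))].
Proof.
move=> nt0 hc.
have [a /andP[a0 a1] [Sa na]] := prev_transition hp th0.
have [b /andP[b0 b1] [Sb nb]] := next_transition hp th0.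
have nt th : a < th < b -> ~ transition P p th.
  move=> /andP[h1 h2]; case: (ltgtP th th0) => [h|h|->] //.
    by apply: na; rewrite h1.
  by apply: nb; rewrite h2 h.
have ab : a < b by exact: lt_trans b0.
have p0 := pi_gt0 R.
have hcab th : a <= th <= b -> cell (i + 1) (i - 1) th.
  by apply: (cell_interval hp _ nt hc); rewrite a1 b0.
have ha : cell (i + 1) (i - 1) a by apply: hcab; rewrite lexx ltW.
have hb : cell (i + 1) (i - 1) b by apply: hcab; rewrite lexx ltW.
have bpi : b < a + pi.
  (* A window as long as the period would leave all vertices with the same transition [a], which
     consecutive vertices cannot share: [p] would lie on their side. *)
  rewrite ltNge; apply/negP => h.
  have eqa (m : 'Z_(n.*2)) : vertex_chord m a.
    have [th /andP[h1 h2] hv] := vertex_chord_exists hp m a.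
    have [<- //|ne] := eqVneq th a; have [] := nt th.
      by rewrite lt_neqAle eq_sym ne h1 (lt_le_trans h2 h).
    by apply/(transition_vertex hp); exists m.
  exact: vertex_chord_consecutive (eqa i) (eqa (i + 1)).
have hva := near_cell_transition ha Sa; have hvb := near_cell_transition hb Sb.
have aa : a <= a < a + pi by rewrite lexx ltrDl.
have ba : a <= b < a + pi by rewrite ltW.
have diff (m : 'Z_(n.*2)) : vertex_chord m a -> vertex_chord m b -> False.
  by move=> h1 h2; have := vertex_chord_eq hp aa ba h1 h2 => e; move: ab; rewrite e ltxx.
exists a, b; split => //; first by rewrite a1.
split => //; case: hva hvb => h1 [] h2.
- by case: (diff _ h1 h2).
- by left.
- by right.
- by case: (diff _ h1 h2).
Qed.

Lemma vertex_chord_far (th : R) : cell (i + 1) (i - 1) th -> vertex_chord (i + 2%:R) th -> False.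
Proof.
move=> [s [t [r h]]] [k [t' [r' h']]].
have [s2 t2] := near (proj1 h); have [[hs /andP[t0 t1] _ _] _] := h.
have e2 : i + 2%:R = i + 1 + 1 by rewrite -[2%:R]/(1 + 1) addrA.
case: (chord_unique hp h h') => -[]; rewrite side_pt0 => e1 _.
  have : side_pt P (i + 1) 1 = side_pt P (i + 1) s by rewrite side_pt1 -e2.
  by move=> /side_pt_inj e; move: s2; rewrite -e; lra.
have [t11|t11] := eqVneq t 1.
  move: e1; rewrite t11 side_pt1 subrK => /(cppos_inj hP) e.
  by have := idx_neqD n1 i (m := 2) isT; rewrite e eqxx.
have ht : 0 < t < 1 by apply/andP; split; [lra | rewrite lt_neqAle t11].
have [|e _] := @side_pt_interior (i - 1) (i + 2%:R) t 0 ht cls0; first by rewrite side_pt0.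
have := idx_neqD n1 (i - 1) (m := 3) isT.
by rewrite -[3%:R]/(1 + (1 + 1)) addrA subrK e eqxx.
Qed.

(** A second window would end at transitions of [P i] and [P (i + 1)], hence at [b] and [a + pi].
    The two windows would fill the period and leave no room for the transition of [P (i + 2)], whose
    chord does not join the neighbours of side [i]. *)
Lemma near_window_only (th0 a b : R) : a < b < a + pi ->
  (transition P p a /\ transition P p b) ->
  (forall th, a < th < b -> ~ transition P p th) ->
  (forall th, a <= th <= b -> cell (i + 1) (i - 1) th) ->
  ((vertex_chord (i + 1) a /\ vertex_chord i b) \/ (vertex_chord i a /\ vertex_chord (i + 1) b)) ->
  b < th0 < a + pi -> ~ transition P p th0 -> ~ cell (i + 1) (i - 1) th0.
Proof.
move=> /andP[ab bpi] [Sa Sb] nt hc hv /andP[bt ta] nt0 hc0.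
have p0 := pi_gt0 R.
have uniq th : a <= th < a + pi -> vertex_chord (i + 1) th \/ vertex_chord i th -> th = a \/ th = b.
  move=> hth; have aa : a <= a < a + pi by rewrite lexx ltrDl.
  have ba : a <= b < a + pi by rewrite ltW.
  case: hv => -[v1 v2] [] v3.
  - by left; exact: vertex_chord_eq aa hth v1 v3.
  - by right; exact: vertex_chord_eq ba hth v2 v3.
  - by right; exact: vertex_chord_eq ba hth v2 v3.
  - by left; exact: vertex_chord_eq aa hth v1 v3.
have [a' [b' [/andP[a't tb'] b'a' nt' hc' [[Sa' Sb'] _]]]] := near_window nt0 hc0.
have ab' : a' < b' by exact: lt_trans tb'.
have Sapi : transition P p (a + pi) by apply/(transitionDpi hp).
have ba' : b <= a' by rewrite leNgt; apply/negP => h; apply: (nt' b) => //; rewrite h (lt_trans bt).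
have b'a : b' <= a + pi by rewrite leNgt; apply/negP => h; apply: (nt' (a + pi)) => //; rewrite h (lt_trans a't).
have a'b : a' = b.
  have h := near_cell_transition (hc' a' _) Sa'; case: (uniq a' _ (h _)) => //.
  - by apply/andP; split; lra.
  - by rewrite lexx ltW.
  - by move=> e; lra.
have b'E : b' = a + pi.
  have [//|ne] := eqVneq b' (a + pi).
  have h := near_cell_transition (hc' b' _) Sb'; case: (uniq b' _ (h _)) => [||e|e].
  - by apply/andP; split; [lra | rewrite lt_neqAle ne].
  - by rewrite lexx ltW.
  - by lra.
  - by lra.
have [th /andP[h1 h2] hv2] := vertex_chord_exists hp (i + 2%:R) a.
have St : transition P p th by apply/(transition_vertex hp); exists (i + 2%:R).
have [hb|hb] := leP th b.
  by apply: vertex_chord_far hv2; apply: hc; rewrite h1.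
by apply: (nt' th) => //; rewrite a'b b'E hb.
Qed.

End NearSide.

(** The chord is cut out by the parallel to side [i] through [p]. Height grows linearly along both
    neighbours, which gives [s] and [t'] as quotients; side [i - 1] is run towards [P i], whence the
    parameter [1 - t']. *)
Lemma parallel_chord p i : inner p ->
  height i p < det2 (edge P i) (edge P (i + 1)) -> height i p < det2 (edge P (i - 1)) (edge P i) ->
  exists s t r, [/\ 0 < s < 1, 0 < t < 1 & through p (i + 1) (i - 1) s t r].
Proof.
move=> hp h1 h2; have h0 := hp i; have t1 := edge_turn i; have t2 := edge_turnN i.
pose s := height i p / det2 (edge P i) (edge P (i + 1)).
pose t' := height i p / det2 (edge P (i - 1)) (edge P i).
have hs : 0 < s < 1 by rewrite /s divr_gt0//= ltr_pdivrMr// mul1r.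
have ht' : 0 < t' < 1 by rewrite /t' divr_gt0//= ltr_pdivrMr// mul1r.
have ht : 0 < 1 - t' < 1 by move/andP: ht' => [? ?]; apply/andP; split; lra.
have cs (x : R) : 0 < x < 1 -> 0 <= x <= 1 by move=> /andP[? ?]; rewrite !ltW.
pose A := side_pt P (i + 1) s; pose B := side_pt P (i - 1) (1 - t').
have hA : height i A = height i p.
  by rewrite /A /side_pt heightD height_P1 add0r det2Zr /s divfK// gt_eqF.
have hB : height i B = height i p.
  have -> : B = P i + (- t') *: edge P (i - 1).
    by rewrite /B /side_pt /edge subrK; apply: eq_coord; rewrite !coordE; ring.
  by rewrite heightD height_P add0r det2Zr det2C mulrNN /t' divfK// gt_eqF.
have n0 := neighbours_neq i; have na := neighbours_not_adjacent i.
have pB : 0 < height (i + 1) B by apply: height_side_gt0 => //; exact: cs.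
have pA : 0 < height (i - 1) A.
  by apply: height_side_gt0; [rewrite eq_sym | rewrite adjacent_sym | exact: cs].
have zA : height (i + 1) A = 0 by rewrite height_own.
have zB : height (i - 1) B = 0 by rewrite height_own.
have [w wE] : exists w, A - B = w *: edge P i.
  apply: det2_col; first exact: edge_neq0.
  have -> : A - B = (A - P i) - (B - P i) by apply: eq_coord; rewrite !coordE; ring.
  by rewrite det2Br -!/(height i _) hA hB subrr.
have [c cE] : exists c, p - B = c *: edge P i.
  apply: det2_col; first exact: edge_neq0.
  have -> : p - B = (p - P i) - (B - P i) by apply: eq_coord; rewrite !coordE; ring.
  by rewrite det2Br -!/(height i _) hB subrr.
have w0 : w != 0.
  apply/eqP => w0; move: wE; rewrite w0 scale0r => /subr0_eq e.
  by move: pA; rewrite e zB ltxx.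
have pE : p = B + (c / w) *: (A - B).
  by rewrite wE scalerA divfK// -cE addrC subrK.
have k0 : 0 < c / w.
  by have := hp (i - 1); rewrite pE height_aff zB mulr0 add0r pmulr_lgt0.
have k1 : 0 < 1 - c / w.
  by have := hp (i + 1); rewrite pE height_aff zA mulr0 addr0 pmulr_lgt0.
exists s, (1 - t'), (1 - c / w); split => //; apply: through_sym; split.
- exact: cs.
- exact: cs.
- by apply/andP; split; apply: ltW => //; rewrite -subr_gt0.
- exact: pE.
Qed.

Lemma front_path_weaken p e e' (h h' : R -> R * R) (x y c l d m : R) :
  (forall u : R, x <= u <= y -> `|h u - h' u| <= e') ->
  front_path (p := p) e h x y c l d m -> front_path (p := p) (e + e') h' x y c l d m.
Proof.
move=> hh [T [lam [g [cTg mT ends ml v]]]]; exists T, lam, g; split => // u hu.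
have [v1 v2 v3] := v u hu; split => //.
have -> : g u - h' u = (g u - h u) + (h u - h' u) by rewrite addrA subrK.
by apply: le_trans (ler_normD _ _) _; rewrite lerD// hh.
Qed.

Lemma there_and_back_there (a b : R * R) (u : R) : u <= 1 / 2 ->
  there_and_back a b u = a + (2 * u) *: (b - a).
Proof.
by move=> hu; rewrite /there_and_back ger0_norm; [congr (_ + _ *: _); ring | lra].
Qed.

Lemma there_and_back_back (a b : R * R) (u : R) : 1 / 2 <= u ->
  there_and_back a b u = b + (2 * u - 1) *: (a - b).
Proof.
move=> hu; rewrite /there_and_back ler0_norm; last by lra.
by apply: eq_coord; rewrite !coordE; ring.
Qed.

Lemma ART_near_segment p e (Y0 Y1 : R * R) (a b : R) : inner p -> 0 < e ->
  a < b -> b < a + pi ->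
  (forall x y : R, x < y -> front_path (p := p) (e / 2) (fun _ => Y1) x y a 1 b 0) ->
  (forall x y : R, x < y -> front_path (p := p) (e / 2) (fun _ => Y0) x y b 1 (a + pi) 0) ->
  exists2 c, ART P p c & forall t, 0 <= t <= 1 -> `|c t - there_and_back Y0 Y1 t| <= e.
Proof.
move=> hp e0 ab bpi near1 near0.
pose D := `|Y1 - Y0|; have D0 : 0 <= D by rewrite /D.
(* The time allotted to the cell near [Y1], and to the rest of the period near [Y0]. The model curve
   has speed [2 * D], so it moves by at most [e / 2] meanwhile; the summand [e] keeps the quotient
   defined when [D = 0]. *)
pose dl := e / (8 * (D + e)).
have De : 0 < 8 * (D + e) by lra.
have dl0 : 0 < dl by rewrite /dl divr_gt0.
have dl1 : dl <= 1 / 8.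
  by rewrite /dl ler_pdivrMr//; lra.
have dlD : 2 * dl * D <= e / 2.
  have : dl * (8 * (D + e)) = e by rewrite /dl divfK// gt_eqF.
  by nra.
have xy1 : 1 / 2 < 1 / 2 + dl by lra.
have xy2 : 1 - dl < 1 by lra.
have [hR1 hR0] : `|front_pt (p := p) a 1 - Y1| <= e / 2 /\ `|front_pt (p := p) b 0 - Y1| <= e / 2.
  exact: front_path_ends (ltW xy1) (near1 _ _ xy1).
have [hS1 hS0] : `|front_pt (p := p) b 1 - Y0| <= e / 2 /\ `|front_pt (p := p) (a + pi) 0 - Y0| <= e / 2.
  exact: front_path_ends (ltW xy2) (near0 _ _ xy2).
rewrite front_pt1 in hR1; rewrite front_pt0 in hR0; rewrite front_pt1 in hS1.
rewrite front_pt0 (envelope_leftDpi hp) in hS0.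
have segE (u v : R) (X Y : R * R) : `|Y - X| = D -> `|v - u| <= 2 * dl ->
    `|(X + u *: (Y - X)) - (X + v *: (Y - X))| <= e / 2.
  move=> DE huv; have -> : (X + u *: (Y - X)) - (X + v *: (Y - X)) = (u - v) *: (Y - X).
    by rewrite opprD addrACA subrr add0r -scalerBl.
  rewrite normrZ DE distrC; apply: le_trans dlD.
  by rewrite ler_wpM2r.
have eE : e / 2 + e / 2 = e by field.
have D' : `|Y0 - Y1| = D by rewrite distrC.
set h := there_and_back Y0 Y1.
(* Four pieces: the jump at [a] out to [Y1], the cell near [Y1], the jump at [b] back, and the
   remaining cells near [Y0]. The initial state is near [Y0] because it is the final state one
   period earlier. *)
have p1 : front_path (p := p) e h 0 (1 / 2) a 0 a 1.
  apply: front_path_jump => [|u /andP[u0 u1]]; first by lra.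
  rewrite /h there_and_back_there// !subr0.
  have -> : u / (1 / 2) = 2 * u by field.
  apply: (@le_trans _ _ (e / 2)); last by lra.
  by apply: front_pt_near => //; apply/andP; split; lra.
have p2 : front_path (p := p) e h (1 / 2) (1 / 2 + dl) a 1 b 0.
  rewrite -eE; apply: front_path_weaken (near1 _ _ xy1) => u /andP[u0 u1].
  rewrite /h there_and_back_back//.
  have := @segE 0 (2 * u - 1) Y1 Y0 D'; rewrite scale0r addr0; apply.
  by rewrite subr0 ger0_norm; lra.
have p3 : front_path (p := p) e h (1 / 2 + dl) (1 - dl) b 0 b 1.
  apply: front_path_jump => [|u /andP[u0 u1]]; first by lra.
  have w0 : 0 < 1 - dl - (1 / 2 + dl) by lra.
  set l := (u - _) / _.
  have lE : l * (1 - dl - (1 / 2 + dl)) = u - (1 / 2 + dl) by rewrite /l divfK// gt_eqF.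
  have l01 : 0 <= l <= 1.
    by rewrite /l divr_ge0 ?ler_pdivrMr//= ?mul1r; lra.
  have -> : front_pt (p := p) b l - h u = (front_pt (p := p) b l - (Y1 + l *: (Y0 - Y1))) + ((Y1 + l *: (Y0 - Y1)) - h u).
    by rewrite addrA subrK.
  rewrite -eE; apply: le_trans (ler_normD _ _) _; apply: lerD; first exact: front_pt_near.
  rewrite /h there_and_back_back; last by lra.
  apply: segE => //; move/andP: l01 => [l0 l1].
  have -> : 2 * u - 1 - l = 2 * dl - 4 * dl * l.
    have -> : u = l * (1 - dl - (1 / 2 + dl)) + (1 / 2 + dl) by rewrite lE subrK.
    by field.
  by rewrite ler_norml; apply/andP; split; nra.
have p4 : front_path (p := p) e h (1 - dl) 1 b 1 (a + pi) 0.
  rewrite -eE; apply: front_path_weaken (near0 _ _ xy2) => u /andP[u0 u1].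
  rewrite /h there_and_back_back; last by lra.
  have := @segE 1 (2 * u - 1) Y1 Y0 D'; rewrite scale1r subrKC; apply.
  by rewrite ler_norml; apply/andP; split; lra.
apply: (front_path_ART hp (a := a)); last first.
  rewrite /h there_and_back_there; last by lra.
  rewrite there_and_back_back; last by lra.
  by apply: eq_coord; rewrite !coordE; ring.
apply: (front_path_cat _ _ p1); [lra | lra |].
apply: (front_path_cat _ _ p2); [lra | lra |].
by apply: (front_path_cat _ _ p3 p4); lra.
Qed.

Lemma cell_env_lim p (th : R) j k s t r : inner p -> chord p th j k s t r ->
  cell_env (p := p) j k th = env_lim j k s t r.
Proof. by move=> hp h; rewrite (cell_envE hp h) (env_limE hp (proj1 h)). Qed.

Lemma ART_curves_cvg i (v : R) : 0 < v < 1 ->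
  curves_cvg (within inner (nbhs (side_pt P i v))) (ART P)
    (there_and_back (side_pt P (opp_idx i) v) (Rpoint P mu i v)).
Proof.
move=> hv e e0; have e2 : 0 < e / 2 by lra.
have hv' : 0 <= v <= 1 by move/andP: hv => [? ?]; rewrite !ltW.
have N1 := near_boundary_neighbours i hv e2.
have N2 := near_boundary_other i hv' e2.
have cH : {for side_pt P i v, continuous (fun z : R * R => height i z)} by cont.
have hE : height i (side_pt P i v) = 0 by rewrite height_own.
have N3 := for_near_lt cH (edge_turn i) hE.
have N4 := for_near_lt cH (edge_turnN i) hE.
rewrite near_withinE; near=> p => hp.
have n1' : forall s t r, through p (i + 1) (i - 1) s t r ->
    [/\ s < 1 / 2, 1 / 2 < t & `|env_lim (i + 1) (i - 1) s t r - Rpoint P mu i v| < e / 2].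
  by near: p; exact: N1.
have n2 : forall j k, j != k -> ~ (j = i + 1 /\ k = i - 1) -> ~ (k = i + 1 /\ j = i - 1) ->
    forall s t r, through p j k s t r -> `|env_lim j k s t r - side_pt P (opp_idx i) v| < e / 2.
  by near: p; exact: N2.
have n3 : `|height i p - 0| < det2 (edge P i) (edge P (i + 1)) by near: p; exact: N3.
have n4 : `|height i p - 0| < det2 (edge P (i - 1)) (edge P i) by near: p; exact: N4.
rewrite subr0 gtr0_norm// in n3; rewrite subr0 gtr0_norm// in n4.
have near s t r : through p (i + 1) (i - 1) s t r -> s < 1 / 2 /\ 1 / 2 < t by case/n1'.
(* The parallel to the side supplies an angle in the interior of the wanted cell, from which the
   window is grown. *)
have [s [t [r [hs ht hth]]]] := parallel_chord hp n3 n4.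
have [th0 _ hd] := exists_perp 0 (imgvec (i + 1) (i - 1) s t).
have hch : chord p th0 (i + 1) (i - 1) s t r by split.
have nt0 := chord_not_transition hp hs ht hch.
have hc0 : cell (p := p) (i + 1) (i - 1) th0 by exists s, t, r.
have [a [b [/andP[a0 b0] bpi nt hc [hSab hvert]]]] := near_window hp near nt0 hc0.
have ab : a < b by exact: lt_trans b0.
apply: (ART_near_segment hp e0 ab bpi) => x y xy.
- apply: (front_path_cells hp xy ab (ltW bpi)) => th j k _ [s1 [t1 [r1 h1]]] jk [th' [hth' nt' hc']].
  have hcc : cell (p := p) (i + 1) (i - 1) th' by apply: hc; move/andP: hth' => [? ?]; rewrite !ltW.
  rewrite (cell_env_lim hp h1); apply: ltW.
  case: (near_cell_sides hp near hcc nt' hc') => -[ej ek]; move: h1; rewrite ej ek => -[h1 _].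
    by have [] := n1' _ _ _ h1.
  by rewrite -env_lim_sym; have [] := n1' _ _ _ (through_sym h1).
- have hb : a + pi <= b + pi by rewrite lerD2r ltW.
  apply: (front_path_cells hp xy bpi hb) => th j k _ [s1 [t1 [r1 h1]]] jk [th' [hth' nt' hc']].
  have nocell : ~ cell (p := p) (i + 1) (i - 1) th'.
    by apply: (near_window_only hp near _ hSab nt hc hvert hth' nt'); rewrite ab.
  rewrite (cell_env_lim hp h1); apply: ltW; apply: n2 (proj1 h1) => // -[ej ek]; apply: nocell.
    by move: hc'; rewrite ej ek.
  by move: hc'; rewrite ej ek => /cell_sym.
Unshelve. all: by end_near. Qed.

(** * Interior, boundary and central symmetry *)

Lemma interior_region : (region P)^° = inner.
Proof.
apply/seteqP; split=> p hp; last first.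
  have H i : \forall z \near p, 0 < height i z.
    have cH : {for p, continuous (fun z : R * R => height i z)} by cont.
    exact: for_gt0_near cH (hp i).
  by apply: (filterS _ (near_forall H)) => z h i; exact: ltW (h i).
move=> i; have := nbhs_singleton hp i; rewrite le_eqVlt => /orP[/eqP e|//].
(* A shift against the direction of the next edge lowers the height over side [i], so it takes a
   point of that side out of the region. *)
have cH : {for (0 : R), continuous (fun t : R => p - t *: edge P (i + 1))} by cont.
have : \forall t \near (0 : R), region P (p - t *: edge P (i + 1)).
  by apply: cH; rewrite scale0r subr0.
move=> /(@nbhs_dnbhs _ _ _)/right_dnbhs N.
near (0 : R)^'+ => t.
have t0 : 0 < t by near: t; exact: nbhs_right_gt.
have : region P (p - t *: edge P (i + 1)) by near: t.
move=> /(_ i); rewrite -/(height i _) -scaleNr heightD /height -e add0r det2Zr.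
by rewrite mulNr oppr_ge0 leNgt mulr_gt0// edge_turn.
Unshelve. all: by end_near. Qed.

Lemma region_boundary x : region P x -> ~ inner x -> exists i s, 0 <= s <= 1 /\ x = side_pt P i s.
Proof.
move=> hx ninn; have [i hi] : exists i, ~ 0 < height i x.
  by apply: contrapT => h; apply: ninn => i; apply: contrapT => h'; apply: h; exists i.
have h0 : height i x = 0.
  by apply/eqP; rewrite eq_le; apply/andP; split; [rewrite leNgt; exact/negP | exact: hx].
by have [s hs ->] := region_on_line hx h0; exists i, s.
Qed.

Lemma boundary_not_inner x : boundary P x -> ~ inner x.
Proof. by move=> [i [s [_ ->]]] /(_ i); rewrite height_own ltxx. Qed.

Lemma area_extension : exists G : R * R -> R,
  [/\ {within region P, continuous G},
      forall p, (region P)^° p -> G p = ART_area P p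
    & forall p, boundary P p -> G p = 0].
Proof.
pose G x : R := if `[< inner x >] then ART_area P x else 0.
have G1 x : inner x -> G x = ART_area P x by rewrite /G => /asboolT ->.
have G0 x : ~ inner x -> G x = 0 by rewrite /G => /asboolF ->.
exists G; split; last first.
- by move=> x /boundary_not_inner; exact: G0.
- by move=> x; rewrite interior_region; exact: G1.
apply/subspace_continuousP => x hx; apply/cvgrPdist_lt => e e0.
suff : \forall z \near x, region P z -> `|G x - G z| < e by [].
have [inx|ninx] := pselect (inner x).
  have := area_limit_inner inx => /cvgrPdist_lt /(_ _ e0).
  rewrite near_withinE (G1 x)// => N.
  have I : \forall z \near x, inner z by rewrite -interior_region in inx *; exact: nbhs_interior.
  apply: (filterS _ (filterI N I)) => z [h hz] _.
  by rewrite G1//; exact: h.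
have [i [s [hs xE]]] := region_boundary hx ninx.
have := area_limit_boundary i hs; rewrite -xE => /cvgrPdist_lt /(_ _ e0).
rewrite near_withinE (G0 x)//; apply: filterS => z h _.
have [inz|ninz] := pselect (inner z); first by rewrite G1//; exact: h.
by rewrite (G0 z)// subrr normr0.
Qed.

Lemma sigma_Rpoint i (s : R) : 0 < s < 1 ->
  side_pt P (opp_idx i) s = Rpoint P mu i s <-> mu (i - 1) = mu (i + 1).
Proof.
move=> /andP[s0 s1]; have a0 := cppos_mu_gt0 hP (i - 1); have b0 := cppos_mu_gt0 hP (i + 1).
have d0 : mu (i - 1) * s + mu (i + 1) * (1 - s) != 0.
  by rewrite gt_eqF// addr_gt0// mulr_gt0// subr_gt0.
rewrite /Rpoint /rho; move: (mu (i - 1)) (mu (i + 1)) a0 b0 d0 => a b a0 b0 d0; split => [/side_pt_inj e|ab].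
  have E : s * (a * s + b * (1 - s)) = a * s by rewrite {1}e divfK.
  have /eqP : (a - b) * (s * (1 - s)) = 0.
    have -> : (a - b) * (s * (1 - s)) = a * s - s * (a * s + b * (1 - s)) by ring.
    by rewrite E subrr.
  by rewrite !mulf_eq0 !subr_eq0 (gt_eqF s0) (gt_eqF s1) !orbF => /eqP.
congr side_pt; rewrite -ab; have -> : a * s + a * (1 - s) = a by ring.
by rewrite mulrAC divff ?mul1r// gt_eqF.
Qed.

Lemma mu_opp i : mu i * mu (opp_idx i) = 1.
Proof.
have := cppos_edge hP (opp_idx i); rewrite (opp_idxK n1) (cppos_edge hP) scalerN opprK scalerA => /eqP.
rewrite -{1}[edge P i]scale1r -subr_eq0 -scalerBl scaler_eq0 (negbTE (edge_neq0 i)) orbF.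
by rewrite subr_eq0 mulrC => /eqP.
Qed.

(** The reflected side has height [K] over side [i], at least that of the opposite side, so it lies
    on the opposite side. A segment as long as edge [i] thus fits into one that is [mu i] times as
    long. The same for the opposite side, together with [mu_opp], gives equality. *)
Lemma symmetric_mu_ge1 i : centrally_symmetric P -> 1 <= mu i.
Proof.
move=> [c hc]; have m0 := cppos_mu_gt0 hP i.
have hopp z : height (opp_idx i) z = - (mu i * (height i z - height i (P (opp_idx i)))).
  by rewrite /height (cppos_edge hP) !det2E; ring.
have Rc z : region P z -> region P (c + c - z) by rewrite -mulr2n; exact: hc.
pose K := det2 (edge P i) (c + c - P i - P i).
have HK : height i (P (opp_idx i)) <= K.
  have := Rc _ (region_P (opp_idx i)) i; rewrite /K /height !det2E; lra.
have on j : (j = i \/ j = i + 1) -> exists2 a, 0 <= a <= 1 & c + c - P j = side_pt P (opp_idx i) a.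
  move=> hj; have hz : height i (c + c - P j) = K.
    case: hj => ->; rewrite /K /height //.
    by rewrite -[P (i + 1)](subrK (P i)) -/(edge P i) !det2E; ring.
  have hr := Rc _ (region_P j); apply: region_on_line => //.
  apply/eqP; rewrite eq_le; apply/andP; split; last exact: hr.
  by rewrite hopp hz oppr_le0 mulr_ge0 ?subr_ge0 ?(ltW m0).
have [a0 /andP[h1 h2] e0] := on i (or_introl erefl).
have [a1 /andP[h3 h4] e1] := on (i + 1) (or_intror erefl).
have /eqP : (1 - (a1 - a0) * mu i) *: edge P i = 0.
  have -> : (1 - (a1 - a0) * mu i) *: edge P i = edge P i + (a1 - a0) *: edge P (opp_idx i).
    by rewrite (cppos_edge hP); apply: eq_coord; rewrite !coordE; ring.
  have -> : (a1 - a0) *: edge P (opp_idx i) = side_pt P (opp_idx i) a1 - side_pt P (opp_idx i) a0.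
    by rewrite /side_pt; apply: eq_coord; rewrite !coordE; ring.
  by rewrite -e0 -e1 /edge; apply: eq_coord; rewrite !coordE; ring.
rewrite scaler_eq0 (negbTE (edge_neq0 i)) orbF subr_eq0 => /eqP h.
by rewrite h; nra.
Qed.

Lemma symmetric_mu i : centrally_symmetric P -> mu i = 1.
Proof.
move=> hs; have h1 := symmetric_mu_ge1 i hs; have h2 := symmetric_mu_ge1 (opp_idx i) hs.
have h3 := mu_opp i; apply/eqP; rewrite eq_le h1 andbT; nra.
Qed.

End Geometry.

Theorem theorem6p19 (R : realType) (n : nat)
    (P : 'Z_(n.*2) -> R * R) (mu : 'Z_(n.*2) -> R) (hP : cppos P mu) :
  (exists G : R * R -> R,
     [/\ {within region P, continuous G},
         forall p, (region P)^° p -> G p = ART_area P p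
       & forall p, boundary P p -> G p = 0])
  /\
  (forall (i : 'Z_(n.*2)) (s : R), 0 < s < 1 ->
     let x := side_pt P i s in
     [/\ curves_cvg (within (region P)^° (nbhs x)) (ART P)
           (there_and_back (sigma P x) (Rpoint P mu i s)),
         ART_area P p @[p --> within (region P)^° (nbhs x)] --> (0 : R),
         sigma P x = Rpoint P mu i s <-> mu (i - 1) = mu (i + 1)
       & centrally_symmetric P -> sigma P x = Rpoint P mu i s]).
Proof.
split; first exact: (area_extension hP).
move=> i s hs; have hs' : 0 <= s <= 1 by move/andP: hs => [? ?]; rewrite !ltW.
rewrite /= (interior_region hP) (sigmaE hP i hs'); split.
- exact: (ART_curves_cvg hP).
- exact: (area_limit_boundary hP).
- exact: (sigma_Rpoint hP).
- by move=> sym; apply/(sigma_Rpoint hP i hs); rewrite !(symmetric_mu hP _ sym).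
Qed.
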